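(* Let $n\ge 2$, let $\Gamma_0$ be an $(n-1)$-dimensional Bieberbach group, and let $\mathbb{R}^{n-1}/\Gamma_0$ be the corresponding Bieberbach manifold. The following properties are equivalent. (1) $\mathbb{R}^{n-1}/\Gamma_0$ can be realized as the totally geodesic boundary of a compact flat $n$-dimensional Riemannian manifold. (2) $\mathbb{R}^{n-1}/\Gamma_0$ admits a fixed-point-free isometric involution. (3) There is an exact sequence $$1\longrightarrow \Gamma_0\longrightarrow \Gamma\longrightarrow \mathbb{Z}_2\longrightarrow 1,$$ where $\Gamma\subset \mathrm{Isom}(\mathbb{R}^{n-1})$ is an $(n-1)$-dimensional Bieberbach group containing $\Gamma_0$ and the map $\Gamma_0\to\Gamma$ is the inclusion.
   Context: All manifolds are assumed connected. A flat Riemannian manifold is a Riemannian manifold locally isometric to Euclidean space. A Bieberbach group in dimension $m$ is a discrete, co-compact group of affine isometries of $\mathbb{R}^m$ acting without fixed points; the quotient of $\mathbb{R}^m$ by such a group, with the induced flat metric, is a Bieberbach manifold. A Bieberbach manifold $N$ is realized as the totally geodesic boundary of a compact flat manifold $M$ if $M$ is a compact flat Riemannian manifold with totally geodesic boundary $\partial M$ and $\partial M$, with its induced metric, is isometric to $N$. *)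

(* Defs.v *)
From HB Require Import structures.
From mathcomp Require Import all_boot all_order all_algebra.
From mathcomp Require Import all_classical all_reals all_analysis.

Set Implicit Arguments.
Unset Strict Implicit.
Unset Printing Implicit Defensive.

Import Order.TTheory GRing.Theory Num.Theory numFieldNormedType.Exports.
Local Open Scope classical_set_scope.
Local Open Scope quotient_scope.
Local Open Scope ring_scope.

(* C^oo functions on an open set V: every iterated partial derivative is
   Frechet differentiable, hence also continuous, at every point of V. *)
Section smooth.
Context {R : realType} {n : nat}.

Fixpoint partials (s : seq 'I_n) (h : 'rV[R]_n -> R) : 'rV[R]_n -> R :=
  if s is i :: s' then fun x => 'D_'e_i (partials s' h) x else h.

Definition smooth_on (V : set 'rV[R]_n) (h : 'rV[R]_n -> R) : Prop :=
  forall (s : seq 'I_n) (x : 'rV[R]_n), V x -> differentiable (partials s h) x.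

End smooth.

(* A chart together with the components of a Riemannian metric in it.
   [rcoord] and [rmetric] are only meaningful on the domain [rdom]; the entry
   (i, j) of [rmetric c p] is g_p(d/dx_i, d/dx_j). A Riemannian manifold is
   given by a topological space and an atlas of such charts. *)
Record rchart (R : realType) (T : Type) (n : nat) := RChart {
  rdom : set T ;
  rcoord : T -> 'rV[R]_n ;
  rmetric : T -> 'M[R]_n }.

Section local_isometry.
Context {R : realType}.

(* The coordinate expression F of f near p is smooth; as usual for manifolds
   with boundary, this means that it extends to a smooth map on an open subset
   V of R^n. The pullback of the metric by f is the metric. The library's
   Jacobian matrix acts on row vectors: its entry (i, j) is dF_j/dx_i. *)
Definition isometric_at {T T' : Type} {n n' : nat} (c : rchart R T n)
    (c' : rchart R T' n') (f : T -> T') (p : T) : Prop :=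
  exists (V : set 'rV[R]_n) (F : 'rV[R]_n -> 'rV[R]_n'),
    [/\ open V, V (rcoord c p),
        forall j, smooth_on V (fun x => F x 0 j),
        forall q, rdom c q -> V (rcoord c q) -> rdom c' (f q) ->
          rcoord c' (f q) = F (rcoord c q)
      & rmetric c p = jacobian F (rcoord c p) *m rmetric c' (f p)
                      *m (jacobian F (rcoord c p))^T].

Definition local_isometry {T T' : Type} {n n' : nat} (A : set (rchart R T n))
    (A' : set (rchart R T' n')) (U : set T) (f : T -> T') : Prop :=
  forall c c' p, A c -> A' c' -> U p -> rdom c p -> rdom c' (f p) ->
    isometric_at c c' f p.

Definition is_isometry {T T' : topologicalType} {n n' : nat}
    (A : set (rchart R T n)) (A' : set (rchart R T' n')) (f : T -> T') : Prop :=
  exists g : T' -> T,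
    [/\ cancel f g, cancel g f, continuous f & continuous g] /\
    local_isometry A A' setT f /\ local_isometry A' A setT g.

Definition isometric {T T' : topologicalType} {n n' : nat}
    (A : set (rchart R T n)) (A' : set (rchart R T' n')) : Prop :=
  exists f : T -> T', is_isometry A A' f.

End local_isometry.

Section manifold_with_boundary.
Context {R : realType}.

Definition half_space (m : nat) : set 'rV[R]_m.+1 := [set x | 0 <= x 0 ord0].

Section charts.
Context {T : topologicalType} {m : nat}.
Implicit Types (c : rchart R T m.+1) (A : set (rchart R T m.+1)).

Definition interior_chart c : Prop :=
  forall W, open W -> W `<=` rdom c -> open (rcoord c @` W).

Definition half_chart c : Prop :=
  forall W, open W -> W `<=` rdom c ->
    exists2 V : set 'rV[R]_m.+1, open V & rcoord c @` W = V `&` @half_space m.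

(* A homeomorphism from an open set onto an open subset of R^n or of H^n. *)
Definition is_chart c : Prop :=
  [/\ open (rdom c), {in rdom c &, injective (rcoord c)},
      forall p, rdom c p -> {for p, continuous (rcoord c)}
    & interior_chart c \/ half_chart c].

Definition metric_extension c (p : T) (V : set 'rV[R]_m.+1)
    (G : 'rV[R]_m.+1 -> 'M[R]_m.+1) : Prop :=
  [/\ open V, V (rcoord c p),
      forall i j, smooth_on V (fun x => G x i j)
    & forall q, rdom c q -> V (rcoord c q) -> rmetric c q = G (rcoord c q)].

Definition is_metric c : Prop :=
  forall p, rdom c p ->
    [/\ exists V G, metric_extension c p V G,
        (rmetric c p)^T = rmetric c p
      & forall v : 'rV[R]_m.+1, v != 0 ->
          0 < (v *m rmetric c p *m v^T) 0 0].

(* Applied to the identity map, [local_isometry] says that the coordinate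
   changes are smooth and that the local metrics transform as a tensor. *)
Definition riemannian_manifold A : Prop :=
  [/\ hausdorff_space T, @second_countable T,
      forall p, exists2 c, A c & rdom c p,
      forall c, A c -> is_chart c /\ is_metric c
    & local_isometry A A setT id].

Definition boundary A : set T :=
  [set p | exists c, [/\ A c, half_chart c, rdom c p
                       & rcoord c p 0 ord0 = 0]].

Definition restrict_chart A c : rchart R (boundary A) m :=
  RChart [set q : boundary A | rdom c (set_val q)]
    (fun q => \row_j rcoord c (set_val q) 0 (lift ord0 j))
    (fun q => \matrix_(i, j) rmetric c (set_val q) (lift ord0 i) (lift ord0 j)).

(* The boundary with the induced metric. *)
Definition boundary_atlas A : set (rchart R (boundary A) m) :=
  restrict_chart A @` (A `&` half_chart).

Definition christoffel (G : 'rV[R]_m.+1 -> 'M[R]_m.+1) (k i j : 'I_m.+1)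
    (x : 'rV[R]_m.+1) : R :=
  2^-1 * \sum_l invmx (G x) k l *
    ('D_'e_i (fun y => G y j l) x + 'D_'e_j (fun y => G y i l) x
     - 'D_'e_l (fun y => G y i j) x).

(* Vanishing of the second fundamental form of the boundary, which is
   {x_0 = 0} in a half-space chart: for i, j <> 0 the covariant derivative of
   d/dx_j along d/dx_i is tangent to the boundary, i.e. its component along
   d/dx_0 is zero. *)
Definition totally_geodesic_boundary A : Prop :=
  forall c p, A c -> half_chart c -> rdom c p -> rcoord c p 0 ord0 = 0 ->
    exists V G, metric_extension c p V G /\
      forall i j, i != ord0 -> j != ord0 ->
        christoffel G ord0 i j (rcoord c p) = 0.

Definition euclidean_chart : rchart R 'rV[R]_m.+1 m.+1 :=
  RChart setT id (fun=> 1%:M).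

(* Every point has a neighbourhood isometric to a subset of Euclidean space of
   the same dimension; at boundary points that subset is of course not open. *)
Definition flat A : Prop :=
  forall p : T, exists (U : set T) (f : T -> 'rV[R]_m.+1),
    [/\ open U, U p, {in U &, injective f}
      & local_isometry A [set euclidean_chart] U f].

End charts.

End manifold_with_boundary.

Arguments boundary {R T m} A.
Arguments restrict_chart {R T m} A c.
Arguments boundary_atlas {R T m} A.

Section bieberbach.
Context {R : realType} {m : nat}.
Local Notation E := 'rV[R]_m.
Implicit Types (Gamma : set (E -> E)).

(* The library's norm on row vectors is the sup norm; it induces the same
   topology, but isometries refer to this distance. *)
Definition edist (x y : E) : R := Num.sqrt (\sum_i (x 0 i - y 0 i) ^+ 2).

Definition affine_isometry (f : E -> E) : Prop :=
  (exists (A : 'M[R]_m) (b : E), forall x, f x = x *m A + b) /\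
  (forall x y, edist (f x) (f y) = edist x y).

Definition isometry_group Gamma : Prop :=
  [/\ Gamma `<=` affine_isometry, Gamma id,
      forall f g, Gamma f -> Gamma g -> Gamma (f \o g)
    & forall f, Gamma f -> exists g, [/\ Gamma g, cancel f g & cancel g f]].

Definition discrete_isometries Gamma : Prop :=
  Gamma `<=` isolated (Gamma : set {compact-open, E -> E}).

Definition orbit_of Gamma (x : E) : set E := [set f x | f in Gamma].

Definition orbit_rel Gamma : rel E :=
  fun x y => `[< orbit_of Gamma x = orbit_of Gamma y >].

Lemma orbit_rel_refl Gamma : reflexive (orbit_rel Gamma).
Proof. by move=> x; apply/asboolP. Qed.

Lemma orbit_rel_sym Gamma : symmetric (orbit_rel Gamma).
Proof. by move=> x y; apply/asboolP/asboolP. Qed.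

Lemma orbit_rel_trans Gamma : transitive (orbit_rel Gamma).
Proof. by move=> y x z /asboolP xy /asboolP yz; apply/asboolP; rewrite xy. Qed.

Canonical orbit_equiv Gamma : equiv_rel E :=
  EquivRel (orbit_rel Gamma) (orbit_rel_refl Gamma) (orbit_rel_sym Gamma)
    (@orbit_rel_trans Gamma).

(* R^m / Gamma, with the quotient topology. *)
Definition orbit_space Gamma : topologicalType :=
  quotient_topology {eq_quot (orbit_equiv Gamma)}.

Definition orbit_proj Gamma (x : E) : orbit_space Gamma :=
  \pi_{eq_quot (orbit_equiv Gamma)} x.

(* The charts are the inverses of the restrictions of the projection to the
   open sets on which it is injective, with the Euclidean metric. *)
Definition orbit_atlas Gamma : set (rchart R (orbit_space Gamma) m) :=
  [set c | exists W : set E,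
    [/\ open W, {in W &, injective (orbit_proj Gamma)},
        rdom c = orbit_proj Gamma @` W,
        forall x, W x -> rcoord c (orbit_proj Gamma x) = x
      & forall q, rdom c q -> rmetric c q = 1%:M]].
Arguments orbit_atlas Gamma : clear implicits.

Definition bieberbach_group Gamma : Prop :=
  [/\ isometry_group Gamma, discrete_isometries Gamma,
      compact [set: orbit_space Gamma]
    & forall f, Gamma f -> f <> id -> forall x, f x <> x].

Definition realized_as_totally_geodesic_boundary Gamma : Prop :=
  exists (T : topologicalType) (A : set (rchart R T m.+1)),
    [/\ riemannian_manifold A, connected [set: T], compact [set: T]
      & [/\ flat A, totally_geodesic_boundary A
          & isometric (boundary_atlas A) (orbit_atlas Gamma)]].

Definition has_free_isometric_involution Gamma : Prop :=
  exists s : orbit_space Gamma -> orbit_space Gamma,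
    [/\ is_isometry (orbit_atlas Gamma) (orbit_atlas Gamma) s,
        involutive s & forall q, s q <> q].

(* Exactness of 1 -> Gamma0 -> Gamma -> Z/2 -> 1 with the inclusion as first
   map: chi is a homomorphism from Gamma onto Z/2 with kernel Gamma0. *)
Definition exact_over_Z2 (Gamma0 Gamma : set (E -> E)) : Prop :=
  Gamma0 `<=` Gamma /\
  exists chi : (E -> E) -> 'Z_2,
    [/\ forall f g, Gamma f -> Gamma g -> chi (f \o g) = chi f + chi g,
        forall z, exists2 f, Gamma f & chi f = z
      & forall f, Gamma f -> (chi f = 0 <-> Gamma0 f)].

End bieberbach.

Arguments orbit_atlas {R m} Gamma.

(* Main.v *)
From mathcomp Require Import all_boot all_order all_algebra.
From mathcomp Require Import all_classical all_reals all_analysis.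
From mathcomp Require Import ring lra.
Require Import Defs.

Set Implicit Arguments.
Unset Strict Implicit.
Unset Printing Implicit Defensive.

Import Order.TTheory GRing.Theory Num.Theory numFieldNormedType.Exports.
Local Open Scope classical_set_scope.
Local Open Scope ring_scope.

(** All three properties are equivalent to the existence of a flip: an affine
    isometry [al] of R^m that descends to a fixed-point-free involution of
    R^m / Gamma0.

    Suppose that R^m / Gamma0 bounds the compact flat manifold M. As the boundary
    is totally geodesic, M is covered by patches isometric to half-balls, and the
    universal cover R^m of the boundary extends along the normal geodesics to a
    local isometry from a slab [0, t] x R^m to M. By compactness there is a largest
    t = a; on the hyperplane of height a the extension runs into the boundary
    everywhere. Leaving along the normals from there, one obtains an isometry of
    the slab that exchanges its two faces and commutes with the map to M; its
    trace on the boundary is the flip.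

    An isometry of R^m / Gamma0 lifts to an affine isometry of R^m by continuation,
    since a map whose derivative is isometric at each point of a ball is an
    isometry of that ball. A flip generates, together with Gamma0, the group Gamma.
    Conversely, given Gamma and its character eps with values 1 and -1, the
    quotient of [-1, 1] x R^m by the maps (t, x) -> (eps f t, f x), f in Gamma, is
    flat with totally geodesic boundary R^m / Gamma0. *)

(** * Euclidean space and affine isometries *)

(** Everything rests on rigidity. An affine isometry is determined on any ball, so two local
    isometries on a convex domain that agree near one point agree throughout. Continuation along
    segments thus replaces covering theory and geodesics, and the extension along the normals is
    just the unique local isometry of the slab with the given values on its lower face. It stops at
    a finite height: otherwise compactness would give two points of different heights the same
    image, and following this coincidence vertically down to height 0 would place a boundary point
    in the interior. Metrics enter through estimates |u z' - u z| <= (1 + e) |z' - z| for z' near z.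
    On a convex set they make u distance-nonincreasing; applied to a map and to its inverse, they
    yield an isometry. A half-ball patch needs a developing map to send the boundary into a
    hyperplane, which holds because the vanishing second fundamental form keeps the normal line
    constant. That the image then fills a half-ball is shown by minimizing the distance to a given
    point of it. *)

Section euclidean_space.
Context {R : realType}.

Definition dotp {k} (x y : 'rV[R]_k) : R := \sum_i x 0 i * y 0 i.
Definition en {k} (x : 'rV[R]_k) : R := Num.sqrt (dotp x x).

Section fixed_dimension.
Context {k : nat}.
Implicit Types x y z v w : 'rV[R]_k.

Lemma dotpE x y : dotp x y = (x *m y^T) 0 0.
Proof. by rewrite mxE; apply: eq_bigr => i _; rewrite mxE. Qed.

Lemma dotpC x y : dotp x y = dotp y x.
Proof. by apply: eq_bigr => i _; rewrite mulrC. Qed.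

Lemma dotpDl x y z : dotp (x + y) z = dotp x z + dotp y z.
Proof. by rewrite -big_split; apply: eq_bigr => i _; rewrite mxE mulrDl. Qed.

Lemma dotpZl a x z : dotp (a *: x) z = a * dotp x z.
Proof. by rewrite mulr_sumr; apply: eq_bigr => i _; rewrite mxE mulrA. Qed.

Lemma dotpNl x z : dotp (- x) z = - dotp x z.
Proof. by rewrite -scaleN1r dotpZl mulN1r. Qed.

Lemma dotpDr x y z : dotp z (x + y) = dotp z x + dotp z y.
Proof. by rewrite dotpC dotpDl !(dotpC z). Qed.

Lemma dotpZr a x z : dotp z (a *: x) = a * dotp z x.
Proof. by rewrite dotpC dotpZl dotpC. Qed.

Lemma dotpNr x z : dotp z (- x) = - dotp z x.
Proof. by rewrite dotpC dotpNl dotpC. Qed.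

Definition dotpB := (dotpDl, dotpDr, dotpNl, dotpNr, dotpZl, dotpZr).

Lemma dotp0l z : dotp 0 z = 0.
Proof. by rewrite -(scale0r 0) dotpZl mul0r. Qed.

Lemma dotp0r z : dotp z 0 = 0.
Proof. by rewrite dotpC dotp0l. Qed.

Lemma dotp_ge0 x : 0 <= dotp x x.
Proof. by apply: sumr_ge0 => i _; rewrite -expr2 sqr_ge0. Qed.

Lemma dotp_eq0 x : (dotp x x == 0) = (x == 0).
Proof.
apply/eqP/eqP => [|->]; last by rewrite dotp0l.
move/eqP; rewrite psumr_eq0; last by move=> i _; rewrite -expr2 sqr_ge0.
move=> /allP h; apply/rowP => i; rewrite mxE.
by have := h i (mem_index_enum i); rewrite mulf_eq0 orbb => /eqP.
Qed.

Lemma dotp_gt0 x : x != 0 -> 0 < dotp x x.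
Proof. by move=> x0; rewrite lt_neqAle dotp_ge0 eq_sym dotp_eq0 x0. Qed.

Lemma dotp_delta x i : dotp x 'e_i = x 0 i.
Proof.
rewrite /dotp (bigD1 i) //= big1 => [|j ji]; rewrite mxE !eqxx ?mulr1 ?addr0//.
by rewrite (negbTE ji) /= mulr0.
Qed.

Lemma dotp_CS x y : dotp x y ^+ 2 <= dotp x x * dotp y y.
Proof.
have [->|y0] := eqVneq y 0; first by rewrite !dotp0r expr0n mulr0.
have yy := dotp_gt0 y0.
have := dotp_ge0 (dotp y y *: x - dotp x y *: y).
rewrite !dotpB (dotpC y x) => h.
suff : 0 <= dotp y y * (dotp x x * dotp y y - dotp x y ^+ 2).
  by rewrite pmulr_rge0 // subr_ge0.
by lra.
Qed.

Lemma en_ge0 x : 0 <= en x. Proof. exact: sqrtr_ge0. Qed.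

Lemma en_sqr x : en x ^+ 2 = dotp x x.
Proof. by rewrite sqr_sqrtr // dotp_ge0. Qed.

Lemma en_eq0 x : (en x == 0) = (x == 0).
Proof. by rewrite -dotp_eq0 -en_sqr sqrf_eq0. Qed.

Lemma en0 : en (0 : 'rV[R]_k) = 0.
Proof. by apply/eqP; rewrite en_eq0. Qed.

Lemma en_gt0 x : x != 0 -> 0 < en x.
Proof. by move=> x0; rewrite lt_neqAle en_ge0 eq_sym en_eq0 x0. Qed.

Lemma enN x : en (- x) = en x.
Proof. by rewrite /en !dotpB opprK. Qed.

Lemma enB x y : en (x - y) = en (y - x).
Proof. by rewrite -enN opprB. Qed.

Lemma enZ a x : en (a *: x) = `|a| * en x.
Proof. by rewrite /en !dotpB mulrA -expr2 sqrtrM ?sqr_ge0// sqrtr_sqr. Qed.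

Lemma le_dotp_en x y : dotp x y <= en x * en y.
Proof.
have [h|/ltW h] := leP (dotp x y) 0.
  by apply: (le_trans h); rewrite mulr_ge0 // en_ge0.
rewrite -(@ler_pXn2r _ 2) ?nnegrE // ?mulr_ge0 ?en_ge0 //.
by rewrite exprMn !en_sqr dotp_CS.
Qed.

Lemma en_triangle x y : en (x + y) <= en x + en y.
Proof.
rewrite -(@ler_pXn2r _ 2) ?nnegrE ?addr_ge0 ?en_ge0 //.
rewrite sqrrD !en_sqr !dotpB (dotpC y x).
have := le_dotp_en x y; lra.
Qed.

Lemma en_triangleB z x y : en (x - y) <= en (x - z) + en (z - y).
Proof. by have := en_triangle (x - z) (z - y); rewrite addrA subrK. Qed.

Lemma en_le_add x y : en x <= en y + en (x - y).
Proof. by have := en_triangle y (x - y); rewrite addrC subrK addrC. Qed.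

Lemma edistE x y : edist x y = en (x - y).
Proof.
by congr Num.sqrt; apply: eq_bigr => i _; rewrite !mxE expr2.
Qed.

Lemma coord_le_en x i : `|x 0 i| <= en x.
Proof.
rewrite -(@ler_pXn2r _ 2) ?nnegrE ?en_ge0 // en_sqr real_normK ?num_real //.
rewrite /dotp (bigD1 i) //= -expr2 lerDl; apply: sumr_ge0 => j _.
by rewrite -expr2 sqr_ge0.
Qed.

Lemma normr_le_en x : `|x| <= en x.
Proof.
rewrite [`|x|]mx_normrE; apply/bigmax_leP; split; first exact: en_ge0.
by move=> [i j] _ /=; rewrite ord1 coord_le_en.
Qed.

Lemma coord_le_normr x i : `|x 0 i| <= `|x|.
Proof.
rewrite [`|x|]mx_normrE; exact: (le_bigmax _ (fun ij => `|x ij.1 ij.2|) (0, i)).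
Qed.

(** The constant is [k.+1] so that it can be divided by in dimension 0 as well. *)
Lemma en_le_normr x : en x <= k.+1%:R * `|x|.
Proof.
rewrite -(@ler_pXn2r _ 2) ?nnegrE ?en_ge0 ?mulr_ge0 // en_sqr.
apply: (@le_trans _ _ (\sum_(i < k) `|x| ^+ 2)).
  apply: ler_sum => i _; rewrite -expr2 -[x 0 i ^+ 2]real_normK ?num_real //.
  by rewrite ler_pXn2r ?nnegrE // coord_le_normr.
rewrite sumr_const card_ord -[leLHS]mulr_natl exprMn ler_wpM2r ?sqr_ge0 //.
by rewrite -natrX ler_nat (leq_trans (leqnSn k)) // expnS leq_pmulr.
Qed.

(** The library's topology comes from the sup norm; this equivalence lets all later neighbourhoods
    be Euclidean balls. *)
Lemma nbhs_enP x (P : set 'rV[R]_k) :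
  nbhs x P <-> exists2 r, 0 < r & forall y, en (y - x) < r -> P y.
Proof.
split=> [/nbhs_ballP[r /= r0 h]|[r r0 h]].
  exists r => // y yx; apply: h; rewrite mx_norm_ball /ball_ /=.
  by apply: le_lt_trans yx; rewrite enB normr_le_en.
apply/nbhs_ballP; exists (r / k.+1%:R) => /=; first by rewrite divr_gt0.
move=> y; rewrite mx_norm_ball /ball_ /= => yx; apply: h.
rewrite enB; apply: le_lt_trans (en_le_normr _) _.
by rewrite mulrC -ltr_pdivlMr.
Qed.

Lemma near_en x r : 0 < r -> \forall y \near x, en (y - x) < r.
Proof. by move=> r0; apply/nbhs_enP; exists r. Qed.

Lemma cvx_en a r x y t : en (x - a) < r -> en (y - a) < r -> 0 <= t <= 1 ->
  en (x + t *: (y - x) - a) < r.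
Proof.
move=> xr yr /andP[t0 t1].
have -> : x + t *: (y - x) - a = (1 - t) *: (x - a) + t *: (y - a).
  by apply/rowP => i; rewrite !mxE; ring.
apply: le_lt_trans (en_triangle _ _) _; rewrite !enZ !ger0_norm ?subr_ge0 //.
have [->|t0'] := eqVneq t 0; first by rewrite subr0 mul1r mul0r addr0.
have : t * en (y - a) < t * r by rewrite ltr_pM2l // lt_def t0' t0.
have : (1 - t) * en (x - a) <= (1 - t) * r by rewrite ler_wpM2l ?subr_ge0 // ltW.
lra.
Qed.

End fixed_dimension.

Lemma dotp_mulmx k l (x : 'rV[R]_k) (A : 'M[R]_(k, l)) y :
  dotp (x *m A) y = dotp x (y *m A^T).
Proof. by rewrite !dotpE trmx_mul trmxK mulmxA. Qed.

Lemma sub_line k (x v : 'rV[R]_k) s t :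
  x + s *: v - (x + t *: v) = (s - t) *: v.
Proof. by rewrite opprD addrACA subrr add0r scalerBl. Qed.

Lemma en_delta k (i : 'I_k) : en ('e_i : 'rV[R]_k) = 1.
Proof. by rewrite /en dotp_delta mxE !eqxx sqrtr1. Qed.

Lemma dotp_polar k (x y : 'rV[R]_k) :
  dotp x y = (dotp x x + dotp y y - dotp (x - y) (x - y)) / 2.
Proof. by rewrite !dotpB (dotpC y x); field. Qed.

Section affine_isometries.
Context {k : nat}.
Implicit Types (f g : 'rV[R]_k -> 'rV[R]_k).

Lemma affine_isometryP f : affine_isometry f <->
  exists A b, A *m A^T = 1%:M /\ forall x, f x = x *m A + b.
Proof.
split=> [[[A [b fE]] fd]|[A [b [AA fE]]]]; last first.
  split; first by exists A, b.
  move=> x y; rewrite !edistE !fE opprD addrACA subrr addr0 -mulmxBl.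
  by rewrite /en dotp_mulmx -mulmxA AA mulmx1.
exists A, b; split=> //.
have AE v : dotp (v *m A) (v *m A) = dotp v v.
  have := fd v 0; rewrite !edistE !fE mul0mx add0r addrK subr0 => h.
  by rewrite -!en_sqr h.
apply/matrixP => i j.
have : dotp ('e_i *m A) ('e_j *m A) = dotp 'e_i 'e_j :> R.
  by rewrite dotp_polar -mulmxBl !AE -dotp_polar.
rewrite dotp_delta !mxE !eqxx eq_sym /= => <-.
rewrite /dotp; apply: eq_bigr => l _; rewrite mxE.
by rewrite -!rowE !mxE.
Qed.

Lemma affine_isometry_en f x y : affine_isometry f -> en (f x - f y) = en (x - y).
Proof. by move=> [_ h]; have := h x y; rewrite !edistE. Qed.

Lemma affine_isometry_id : affine_isometry (@id 'rV[R]_k).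
Proof.
apply/affine_isometryP; exists 1%:M, 0.
by rewrite trmx1 mulmx1; split=> // x; rewrite mulmx1 addr0.
Qed.

Lemma affine_isometry_comp f g :
  affine_isometry f -> affine_isometry g -> affine_isometry (f \o g).
Proof.
move=> [[A [b fE]] fd] [[B [c gE]] gd]; split; last by move=> x y; rewrite /= fd.
by exists (B *m A), (c *m A + b) => x /=; rewrite fE gE mulmxDl mulmxA addrA.
Qed.

Lemma affine_isometry_inv f : affine_isometry f ->
  exists g, [/\ affine_isometry g, cancel f g & cancel g f].
Proof.
move=> /affine_isometryP[A [b [AA fE]]]; have AA' := mulmx1C AA.
exists (fun x => x *m A^T + - (b *m A^T)); split.
- by apply/affine_isometryP; exists A^T, (- (b *m A^T)); rewrite trmxK AA'.
- by move=> x; rewrite fE mulmxDl addrK -mulmxA AA mulmx1.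
- by move=> x; rewrite fE mulmxDl mulNmx -!mulmxA AA' !mulmx1 subrK.
Qed.

Lemma affine_isometry_inj f : affine_isometry f -> injective f.
Proof. by move=> /affine_isometry_inv[g [_ fg _]]; exact: can_inj fg. Qed.

Lemma affine_isometry_near f x (P : set 'rV[R]_k) : affine_isometry f ->
  nbhs (f x) P -> \forall y \near x, P (f y).
Proof.
move=> fi /nbhs_enP[r r0 h]; apply/nbhs_enP; exists r => // y yx; apply: h.
by rewrite affine_isometry_en.
Qed.

Lemma affine_isometry_cont f : affine_isometry f -> continuous f.
Proof. by move=> fi x P /(affine_isometry_near fi). Qed.

Lemma affine_isometry_line f x v t : affine_isometry f ->
  f (x + t *: v) = f x + t *: (f (x + v) - f x).
Proof.
move=> [[A [b fE]] _]; rewrite !fE !mulmxDl -scalemxAl.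
move: (x *m A) (v *m A) => p q; apply/rowP => i; rewrite !mxE; ring.
Qed.

(** The values at [z] and at the points [z + (r / 2) e_i] determine the linear part row by row. All
    uniqueness arguments below end here. *)
Lemma affine_isometry_eq f g (z : 'rV[R]_k) : affine_isometry f -> affine_isometry g ->
  (\forall x \near z, f x = g x) -> f = g.
Proof.
move=> [[A [b fE]] _] [[B [c gE]] _] /nbhs_enP[r r0 h].
have fz : z *m A + b = z *m B + c by rewrite -fE -gE h // subrr en0.
have AB : A = B.
  apply/row_matrixP => i; rewrite !rowE.
  have := h (z + (r / 2) *: 'e_i); rewrite addrAC subrr add0r enZ en_delta.
  rewrite mulr1 gtr0_norm ?divr_gt0 // fE gE => e.
  have {}e : z *m A + b + (r / 2) *: ('e_i *m A) = z *m B + c + (r / 2) *: ('e_i *m B).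
    rewrite !scalemxAl [LHS]addrAC -mulmxDl [RHS]addrAC -mulmxDl; apply: e; lra.
  move: e; rewrite fz => /addrI; apply: scalerI; by rewrite gt_eqF // divr_gt0.
apply/funext => x; rewrite fE gE AB; congr (_ + _).
by move: fz; rewrite AB => /addrI.
Qed.

(* The images of the frame give an orthonormal basis, in which the coordinates
   of every other image are prescribed by its distances to the frame. *)
Lemma affine_isometry_ext (S : set 'rV[R]_k) f p e : e != 0 -> S p ->
  (forall i, S (p + e *: 'e_i)) ->
  (forall x y, S x -> S y -> en (f x - f y) = en (x - y)) ->
  exists2 g, affine_isometry g & forall x, S x -> f x = g x.
Proof.
move=> e0 Sp Se fd.
have fdot x y : S x -> S y -> dotp (f x - f p) (f y - f p) = dotp (x - p) (y - p).
  move=> Sx Sy; rewrite dotp_polar [RHS]dotp_polar -!en_sqr !fd //.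
  by rewrite !opprB !addrA !subrK fd.
pose u i := e^-1 *: (f (p + e *: 'e_i) - f p).
have uE x i : S x -> dotp (f x - f p) (u i) = (x - p) 0 i.
  move=> Sx; rewrite dotpZr fdot // [p + _ - p]addrAC subrr add0r dotpZr dotp_delta.
  by rewrite mulrA mulVf ?mul1r.
pose A := \matrix_(i, j) u i 0 j.
have AA : A *m A^T = 1%:M.
  apply/matrixP => i j; rewrite !mxE.
  transitivity (dotp (u i) (u j)); first by apply: eq_bigr => l _; rewrite !mxE.
  rewrite {1}/u dotpZl uE // [p + _ - p]addrAC subrr add0r !mxE eqxx /= mulrA.
  by rewrite mulVf // mul1r eq_sym.
exists (fun x => x *m A + (f p - p *m A)).
  by apply/affine_isometryP; exists A, (f p - p *m A).
move=> x Sx; rewrite addrCA -mulmxBl.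
have -> : x - p = (f x - f p) *m A^T.
  apply/rowP => i; rewrite -uE // mxE; apply: eq_bigr => j _; by rewrite !mxE.
by rewrite -mulmxA (mulmx1C AA) mulmx1 addrC subrK.
Qed.

Lemma affine_isometry_of_en f : (forall x y, en (f x - f y) = en (x - y)) ->
  affine_isometry f.
Proof.
move=> fd; have [//|//|x y _ _|g gi fg] := @affine_isometry_ext setT f 0 1 (oner_neq0 _).
  exact: fd.
by rewrite (_ : f = g) //; apply/funext => x; exact: fg.
Qed.

End affine_isometries.

(** At the infimum of the parameters where [P] fails, the first hypothesis gives [P], and the second
    then pushes the infimum further. For t = 0 the premise of the first hypothesis is empty, so it
    also supplies the start. *)
Lemma real_induction (P : R -> Prop) :
  (forall t, 0 <= t <= 1 -> (forall s, 0 <= s < t -> P s) -> P t) ->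
  (forall t, 0 <= t < 1 -> P t ->
    exists2 d, 0 < d & forall s, t < s < t + d -> s <= 1 -> P s) ->
  forall t, 0 <= t <= 1 -> P t.
Proof.
move=> hl hr t t01; apply: contrapT => nPt.
pose S := [set s | 0 <= s <= 1 /\ ~ P s].
have lS : lbound S 0 by move=> s [/andP[]].
have hS : has_inf S by split; [exists t | exists 0].
have [i0 i1] : 0 <= inf S /\ inf S <= 1.
  split; first by apply: lb_le_inf => //; exists t.
  apply: le_trans (ge_inf _ _) _; [by exists 0|split; [exact: t01|by []]|].
  by case/andP: t01.
have Pi : forall s, 0 <= s < inf S -> P s.
  move=> s /andP[s0 si]; apply: contrapT => nPs.
  have : inf S <= s.
    apply: ge_inf; first by exists 0.
    by split=> //; rewrite s0 (le_trans (ltW si)).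
  by rewrite leNgt si.
have Pinf : P (inf S) by apply: hl => //; rewrite i0.
have [i1'|i1'] := ltP (inf S) 1; last first.
  have e1 : inf S = 1 by apply/eqP; rewrite eq_le i1.
  apply: nPt; case/andP: t01 => t0; rewrite le_eqVlt => /predU1P[->|t1].
    by rewrite -e1.
  by apply: Pi; rewrite t0 e1.
have [|d d0 hd] := hr (inf S) _ Pinf; first by rewrite i0.
have [s [/andP[s0 s1] nPs] sd] := inf_adherent d0 hS.
apply: nPs; have [si|si] := ltP s (inf S); first by apply: Pi; rewrite s0.
move: si; rewrite le_eqVlt => /predU1P[<-//|si].
by apply: hd => //; rewrite si.
Qed.

Definition cvx k (D : set 'rV[R]_k) :=
  forall x y t, D x -> D y -> 0 <= t <= 1 -> D (x + t *: (y - x)).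

Lemma le_mul1Deps (a b : R) : 0 <= b -> (forall e, 0 < e -> a <= (1 + e) * b) ->
  a <= b.
Proof.
move=> b0 h; apply/ler_addgt0Pr => e e0.
have b1 : 0 < b + 1 by lra.
apply: le_trans (h (e / (b + 1)) _) _; first by rewrite divr_gt0.
rewrite mulrDl mul1r lerD2l mulrAC ler_pdivrMr // ler_wpM2l ?ltW //; lra.
Qed.

(** Distances between points of a segment are additive, so the local bounds add up along the segment
    from [x] to [y] with the factor [1 + e]; then [e] tends to 0. *)
Lemma infinitesimally_short_lip k l (D : set 'rV[R]_k) (u : 'rV[R]_k -> 'rV[R]_l) :
  cvx D ->
  (forall z, D z -> forall e, 0 < e ->
     \forall z' \near z, D z' -> en (u z' - u z) <= (1 + e) * en (z' - z)) ->
  forall x y, D x -> D y -> en (u y - u x) <= en (y - x).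
Proof.
move=> cD hu x y Dx Dy; apply: le_mul1Deps; first exact: en_ge0.
move=> e e0; pose z t := x + t *: (y - x).
have zB s t : en (z s - z t) = `|s - t| * en (y - x) by rewrite sub_line enZ.
have Dz t : 0 <= t <= 1 -> D (z t) by exact: cD.
have L0 := en_ge0 (y - x).
have L1 : 0 < en (y - x) + 1 by lra.
have step s t : 0 <= s -> s <= t ->
    en (u (z t) - u (z s)) <= (1 + e) * en (z t - z s) ->
    en (u (z s) - u x) <= (1 + e) * (s * en (y - x)) ->
    en (u (z t) - u x) <= (1 + e) * (t * en (y - x)).
  move=> s0 st; rewrite zB ger0_norm ?subr_ge0 // => h1 h2.
  have := en_triangleB (u (z s)) (u (z t)) (u x); nra.
suff /(_ 1) : forall t, 0 <= t <= 1 -> en (u (z t) - u x) <= (1 + e) * (t * en (y - x)).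
  by rewrite /z scale1r subrKC mul1r ler01 lexx; apply.
apply: real_induction => t /andP[t0 t1].
  move=> IH; move: t0; rewrite le_eqVlt => /predU1P[<-|t0].
    by rewrite /z scale0r addr0 subrr en0 mul0r mulr0.
  have Dt : D (z t) by apply: Dz; rewrite ltW.
  have /nbhs_enP[r r0 hr] := hu _ Dt _ e0.
  (* The first bound keeps the earlier parameter [t - d] nonnegative, the second keeps its point in
     the ball of radius [r]; adding 1 to the denominator admits [x = y]. *)
  pose d := Num.min (t / 2) (r / (en (y - x) + 1) / 2).
  have d0 : 0 < d by rewrite lt_min !divr_gt0.
  have dt : d <= t / 2 by rewrite ge_min lexx.
  have dr : d * (en (y - x) + 1) < r.
    have : d <= r / (en (y - x) + 1) / 2 by rewrite ge_min lexx orbT.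
    rewrite mulrAC ler_pdivlMr // => h; lra.
  have s01 : 0 <= t - d < t by apply/andP; split; lra.
  apply: (step (t - d)); [lra|lra| |exact: IH].
  rewrite enB [en (z t - _)]enB; apply: hr; last by apply: Dz; apply/andP; split; lra.
  rewrite zB addrAC subrr sub0r normrN gtr0_norm //; nra.
move=> Pt; have Dt : D (z t) by apply: Dz; rewrite t0 ltW.
have /nbhs_enP[r r0 hr] := hu _ Dt _ e0.
exists (r / (en (y - x) + 1)); first by rewrite divr_gt0.
move=> s /andP[ts sr] s1; apply: (step t) => //; first exact: ltW.
apply: hr; last by apply: Dz; rewrite s1 (le_trans t0 (ltW ts)).
rewrite zB gtr0_norm ?subr_gt0 //.
have : s - t < r / (en (y - x) + 1) by lra.
by rewrite ltr_pdivlMr //; nra.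
Qed.

End euclidean_space.

(** * Flat spaces with boundary *)

Section flat_spaces.
Context {R : realType}.

(* [pmap] parametrizes a piece of the space by the part of a ball of radius
   [prad] lying in the half-space [dotp y pnor >= poff]; a patch away from the
   boundary may have [pnor = 0] and [poff <= 0]. *)
Record patch (T : Type) (k : nat) := Patch {
  pcen : 'rV[R]_k ; prad : R ; pnor : 'rV[R]_k ; poff : R ;
  pmap : 'rV[R]_k -> T }.

Definition pdom T k (p : patch T k) : set 'rV[R]_k :=
  [set y | en (y - pcen p) < prad p /\ poff p <= dotp y (pnor p)].

(** The interface between Riemannian geometry and the continuation arguments; both the orbit spaces
    and the flat manifolds with totally geodesic boundary satisfy it. In [fs_compat] the germs are
    compared on [pdom p] only, because at a boundary point this is half of a neighbourhood. *)
Record flat_space (T : topologicalType) k (P : set (patch T k)) (bd : set T)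
    : Prop := FlatSpace {
  fs_hausdorff : hausdorff_space T ;
  fs_cover : forall q, exists p,
    [/\ P p, pdom p (pcen p) & pmap p (pcen p) = q] ;
  fs_shrink : forall p c r, P p -> pdom p c -> 0 < r ->
    en (c - pcen p) + r <= prad p -> P (Patch c r (pnor p) (poff p) (pmap p)) ;
  fs_inj : forall p y y', P p -> pdom p y -> pdom p y' ->
    pmap p y = pmap p y' -> y = y' ;
  fs_cont : forall p y N, P p -> pdom p y -> nbhs (pmap p y) N ->
    \forall z \near y, pdom p z -> N (pmap p z) ;
  fs_nbhs : forall p y N, P p -> pdom p y -> nbhs y N ->
    nbhs (pmap p y) (pmap p @` (pdom p `&` N)) ;
  fs_compat : forall p p' y y', P p -> P p' -> pdom p y -> pdom p' y' ->
    pmap p y = pmap p' y' ->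
    exists g, [/\ affine_isometry g, g y = y' &
      \forall z \near y, pdom p z -> pdom p' (g z) /\ pmap p z = pmap p' (g z)] ;
  fs_bd : forall p y, P p -> pdom p y ->
    bd (pmap p y) <-> pnor p != 0 /\ dotp y (pnor p) = poff p ;
  fs_unit : forall p, P p -> pnor p != 0 -> en (pnor p) = 1 }.

(** Every point of [D] is a limit of interior points. At a boundary point of [D] only a partial germ
    is known; nearby interior points are where an affine isometry can be pinned down. *)
Definition fat k (D : set 'rV[R]_k) :=
  forall z N, D z -> nbhs z N -> exists2 y, N y & nbhs y D.

Lemma near_near k (x : 'rV[R]_k) A : nbhs x A -> \forall y \near x, nbhs y A.
Proof. exact: nbhs_interior. Qed.

Lemma near_line k (x v : 'rV[R]_k) t (N : set 'rV[R]_k) : nbhs (x + t *: v) N ->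
  exists2 d, 0 < d & forall s, `|s - t| < d -> N (x + s *: v).
Proof.
move=> /nbhs_enP[r r0 h]; have L0 := en_ge0 v.
exists (r / (en v + 1)) => [|s]; first by rewrite divr_gt0 //; lra.
rewrite ltr_pdivlMr; last lra.
move=> st; apply: h; rewrite sub_line enZ; have := normr_ge0 (s - t); nra.
Qed.

Lemma near_dotp k (x n : 'rV[R]_k) c : dotp x n < c ->
  \forall y \near x, dotp y n < c.
Proof.
move=> h; have L0 := en_ge0 n; apply/nbhs_enP.
exists ((c - dotp x n) / (en n + 1)) => [|y]; first by rewrite divr_gt0 //; lra.
rewrite ltr_pdivlMr; last lra.
move=> yx; have := le_dotp_en (y - x) n; rewrite !dotpB.
have := en_ge0 (y - x); nra.
Qed.

Lemma near_dotp_gt k (x n : 'rV[R]_k) c : c < dotp x n ->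
  \forall y \near x, c < dotp y n.
Proof.
rewrite -ltrN2 -dotpNr => /near_dotp; apply: filterS => y.
by rewrite dotpNr ltrN2.
Qed.

(** Real induction along the segment from [z0] to [z1]. The last hypothesis says that the property
    is closed; that it is open is automatic, because it is a property of germs. *)
Lemma cvx_continuation k (D Q : set 'rV[R]_k) z0 z1 : cvx D -> D z0 -> D z1 ->
  (\forall w \near z0, D w -> Q w) ->
  (forall z, D z ->
    (forall N, nbhs z N -> exists y, [/\ N y, D y & \forall w \near y, D w -> Q w]) ->
    \forall w \near z, D w -> Q w) ->
  Q z1.
Proof.
move=> cD D0 D1 Q0 hQ; pose z t := z0 + t *: (z1 - z0).
have Dz t : 0 <= t <= 1 -> D (z t) by exact: cD.
suff /(_ 1) : forall t, 0 <= t <= 1 -> \forall w \near z t, D w -> Q w.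
  rewrite /z scale1r subrKC ler01 lexx => /(_ isT)/nbhs_singleton; exact.
apply: real_induction => t /andP[t0 t1].
  move=> IH; move: t0; rewrite le_eqVlt => /predU1P[<-|t0].
    by rewrite /z scale0r addr0.
  apply: hQ; first by apply: Dz; rewrite ltW.
  move=> N /near_line[d d0 hd].
  pose s := Num.max 0 (t - d / 2).
  have s0 : 0 <= s by rewrite le_max lexx.
  have st : s < t by rewrite gt_max t0; lra.
  have ds : t - d / 2 <= s by rewrite le_max lexx orbT.
  exists (z s); split; last by apply: IH; rewrite s0.
  - by apply: hd; rewrite ltr0_norm ?subr_lt0 //; lra.
  - by apply: Dz; rewrite s0 /=; lra.
move=> /near_near/near_line[d d0 hd]; exists d => // s /andP[ts sd] s1.
by apply: hd; rewrite gtr0_norm ?subr_gt0 //; lra.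
Qed.

(** * Local isometries into a flat space and their continuation *)

Section local_isometries.
Context {T : topologicalType} {k : nat} {P : set (patch T k)} {bd : set T}.
Hypothesis FS : flat_space P bd.
Implicit Types (x y z w : 'rV[R]_k) (D : set 'rV[R]_k) (Phi Psi : 'rV[R]_k -> T) (p : patch T k).

(** The condition is relative to [D], so that it makes sense on the faces of a closed slab. *)
Definition loc_iso D Phi z := exists p g, [/\ P p, affine_isometry g &
  \forall w \near z, D w -> pdom p (g w) /\ Phi w = pmap p (g w)].

Lemma loc_iso_sub D D' Phi Phi' z : loc_iso D Phi z ->
  (\forall w \near z, D' w -> D w /\ Phi' w = Phi w) -> loc_iso D' Phi' z.
Proof.
move=> [p [g [Pp gi h]]] h'; exists p, g; split=> //.
by move: h h'; apply: filterS2 => w h h' /h'[/h[? <-] ->].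
Qed.

Lemma loc_iso_comp D D' Phi g z : affine_isometry g -> loc_iso D Phi (g z) ->
  (\forall w \near z, D' w -> D (g w)) -> loc_iso D' (Phi \o g) z.
Proof.
move=> gi [p [h [Pp hi H]]] H'; exists p, (h \o g).
split=> //; first exact: affine_isometry_comp.
by move: (affine_isometry_near gi H) H'; apply: filterS2 => w hw hw' /hw'/hw.
Qed.

(** By [fs_compat] the patch in [loc_iso] may be exchanged for any other patch through [Phi z], for
    instance one centred there with a prescribed radius. *)
Lemma loc_iso_any D Phi z p y : loc_iso D Phi z -> D z -> P p -> pdom p y ->
  pmap p y = Phi z ->
  exists g, [/\ affine_isometry g, g z = y &
    \forall w \near z, D w -> pdom p (g w) /\ Phi w = pmap p (g w)].
Proof.
move=> [p' [g [Pp' gi H]]] Dz Pp py pyE.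
have [gz gzE] := nbhs_singleton H Dz.
have [|h [hi hz hH]] := @fs_compat _ _ _ _ FS p' p (g z) y Pp' Pp gz py.
  by rewrite -gzE pyE.
exists (h \o g); split=> //; first exact: affine_isometry_comp.
move: H (affine_isometry_near gi hH); apply: filterS2 => w H1 H2 /H1[/H2[h1 h2] ->].
by [].
Qed.

Lemma loc_iso_cont D Phi z N : loc_iso D Phi z -> D z -> nbhs (Phi z) N ->
  \forall w \near z, D w -> N (Phi w).
Proof.
move=> [p [g [Pp gi H]]] Dz; have [gz ->] := nbhs_singleton H Dz.
move=> /(fs_cont FS Pp gz)/(affine_isometry_near gi).
by move: H; apply: filterS2 => w H1 H2 /H1[/H2 ? ->].
Qed.

(** Read in one common patch, the two maps are affine isometries; they agree on an open set, so they
    are equal. *)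
Lemma agree_fat D Phi Psi z : loc_iso D Phi z -> loc_iso D Psi z -> D z ->
  Phi z = Psi z ->
  (forall N, nbhs z N -> exists y, [/\ N y, nbhs y D &
     \forall w \near y, Phi w = Psi w]) ->
  \forall w \near z, D w -> Phi w = Psi w.
Proof.
move=> [p [g [Pp gi H]]] LPsi Dz PhiPsi hN.
have [gz gzE] := nbhs_singleton H Dz.
have [|g' [g'i _ H']] := loc_iso_any LPsi Dz Pp gz; first by rewrite -gzE.
have [y [Ny yD yE]] := hN _ (near_near (filterI H H')).
suff e : g = g'.
  by move: H H'; apply: filterS2; rewrite -e => w H1 H2 Dw; rewrite (H1 Dw).2 (H2 Dw).2.
apply: (affine_isometry_eq (z := y)) => //.
move: Ny yD yE; apply: filterS3 => w [H1 H2] Dw wE.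
have [d1 e1] := H1 Dw; have [d2 e2] := H2 Dw.
by apply: (fs_inj FS Pp d1 d2); rewrite -e1 -e2.
Qed.

(** Agreement at points arbitrarily close to [z] passes to [z] because the space is Hausdorff, and
    [fat] moves the agreement to interior points of [D], where [agree_fat] applies. *)
Lemma unique_continuation D Phi Psi z0 : cvx D -> fat D ->
  (forall z, D z -> loc_iso D Phi z) -> (forall z, D z -> loc_iso D Psi z) ->
  D z0 -> (\forall w \near z0, D w -> Phi w = Psi w) ->
  forall z, D z -> Phi z = Psi z.
Proof.
move=> cD fD LPhi LPsi D0 H0 z Dz.
apply: (@cvx_continuation _ D [set w | Phi w = Psi w] z0 z) => //= {Dz}z Dz hz.
apply: agree_fat; [exact: LPhi|exact: LPsi|by []| |].
  apply: (fs_hausdorff FS) => A B nA nB.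
  have hA := loc_iso_cont (LPhi _ Dz) Dz nA.
  have hB := loc_iso_cont (LPsi _ Dz) Dz nB.
  have [y [[yA yB] Dy /nbhs_singleton/(_ Dy) e]] := hz _ (filterI hA hB).
  by exists (Phi y); split; [exact: yA|rewrite e; exact: yB].
move=> N /near_near/hz[y [Ny Dy yE]].
have [y' [Ny' yE'] nDy'] := fD _ _ Dy (filterI Ny (near_near yE)).
exists y'; split=> //; by move: yE' nDy'; apply: filterS2 => w; apply.
Qed.

(** A patch describes [Phi] as far as its radius reaches, since the part of [D] that [g] sends into
    the ball is again convex. The points [g z] stay in the half-space of the patch because that
    half-space is closed. This is what makes a uniform radius useful. *)
Lemma patch_continuation D Phi p g z0 : cvx D -> fat D ->
  (forall z, D z -> loc_iso D Phi z) -> P p -> affine_isometry g -> D z0 ->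
  (\forall w \near z0, D w -> pdom p (g w) /\ Phi w = pmap p (g w)) ->
  forall z, D z -> en (g z - pcen p) < prad p ->
    pdom p (g z) /\ Phi z = pmap p (g z).
Proof.
move=> cD fD LPhi Pp gi D0 H0 z Dz gz.
pose D' := [set w | D w /\ en (g w - pcen p) < prad p].
pose Q := [set w | pdom p (g w) /\ Phi w = pmap p (g w)].
have nearB w : en (g w - pcen p) < prad p ->
    \forall w' \near w, en (g w' - pcen p) < prad p.
  move=> hw; apply: (affine_isometry_near (P := [set y | en (y - pcen p) < prad p]) gi).
  apply/nbhs_enP; exists (prad p - en (g w - pcen p)); first by rewrite subr_gt0.
  by move=> y yw /=; have := en_triangleB (g w) y (pcen p); lra.
have relD w (A : set 'rV[R]_k) : en (g w - pcen p) < prad p ->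
    (\forall w' \near w, D' w' -> A w') -> (\forall w' \near w, D w' -> A w').
  by move=> /nearB; apply: filterS2 => w' h1 h2 h3; exact: h2.
apply: (@cvx_continuation _ D' Q z0 z) => //.
- move=> x y t [Dx gx] [Dy gy] t01; split; first exact: cD.
  by rewrite affine_isometry_line // subrKC; exact: cvx_en.
- by split=> //; have [[]] := nbhs_singleton H0 D0.
- by move: H0; apply: filterS => w h [/h].
move=> {Dz gz}z [Dz gz] hz.
have gzd : pdom p (g z).
  split=> //; rewrite leNgt; apply/negP => h.
  have [y [yh D'y /nbhs_singleton/(_ D'y)[[_ +] _]]] :=
    hz _ (affine_isometry_near gi (near_dotp h)).
  by rewrite leNgt yh.
have gzE : pmap p (g z) = Phi z.
  apply: (fs_hausdorff FS) => A B nA nB.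
  have hA := affine_isometry_near gi (fs_cont FS Pp gzd nA).
  have hB := loc_iso_cont (LPhi _ Dz) Dz nB.
  have [y [[yA yB] D'y /nbhs_singleton/(_ D'y)[h1 h2]]] := hz _ (filterI hA hB).
  by exists (Phi y); split; [rewrite h2; exact: yA|exact: yB D'y.1].
have [g' [g'i g'z H']] := loc_iso_any (LPhi _ Dz) Dz Pp gzd gzE.
suff e : g = g'.
  by rewrite /Q /D' e; move: H'; apply: filterS => w h [/h].
have [y [Ny Dy yE]] := hz _ (near_near H').
have gy := Dy.2.
have [y' [[Ny' yE'] gy'] nDy'] := fD _ _ Dy.1
  (filterI (filterI (near_near Ny) (near_near (relD _ _ gy yE))) (nearB _ gy)).
apply: (affine_isometry_eq (z := y')) => //.
move: Ny' yE' nDy'; apply: filterS3 => w H1 H2 Dw.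
have [d1 e1] := H1 Dw; have [d2 e2] := H2 Dw.
by apply: (fs_inj FS Pp d2 d1); rewrite -e1 -e2.
Qed.

(** At a boundary point the patch is a half-ball, whereas [g] would carry a full neighbourhood of
    [z] into it: a step of length [r / 2] against the unit normal leaves the half-space. *)
Lemma interior_not_bd D Phi z : nbhs z D -> loc_iso D Phi z -> ~ bd (Phi z).
Proof.
move=> nD [p [g [Pp gi H]]].
have [gz ->] := nbhs_singleton H (nbhs_singleton nD).
move=> /(fs_bd FS Pp gz)[n0 gzE].
have [h [hi gh hg]] := affine_isometry_inv gi.
have /nbhs_enP[r r0 hr] : \forall w \near g z, pdom p w.
  have nD' : nbhs (h (g z)) D by rewrite gh.
  have H' : nbhs (h (g z)) [set w | D w -> pdom p (g w)].
    by rewrite gh; move: H; apply: filterS => w H /H[].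
  move: (affine_isometry_near hi nD') (affine_isometry_near hi H').
  by apply: filterS2 => w Dw /(_ Dw); rewrite hg.
have := (hr (g z - (r / 2) *: pnor p)).
have n1 := fs_unit FS Pp n0.
rewrite addrAC subrr add0r enN enZ n1 mulr1 gtr0_norm ?divr_gt0 // => -[|_]; first lra.
rewrite !dotpB gzE -en_sqr n1; lra.
Qed.

(** A Lebesgue number. By [fs_shrink], points within [prad p / 2] of the centre have patches of
    every radius below [prad p / 2]; compactness makes the bound uniform. *)
Lemma uniform_radius : compact [set: T] -> exists2 r, 0 < r &
  forall q, exists p, [/\ P p, pdom p (pcen p), pmap p (pcen p) = q & prad p = r].
Proof.
move=> /compact_near_coveringP cT.
pose Q (r : R) (q : T) := exists p,
  [/\ P p, pdom p (pcen p), pmap p (pcen p) = q & prad p = r].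
have : \forall r \near 0^'+, [set: T] `<=` Q r.
  apply: cT => q _.
  have [p [Pp cp pE]] := fs_cover FS q.
  have r0 : 0 < prad p by apply: le_lt_trans cp.1; exact: en_ge0.
  have r20 : 0 < prad p / 2 by rewrite divr_gt0.
  have := fs_nbhs FS Pp cp (near_en (pcen p) r20); rewrite pE => nq.
  exists (pmap p @` (pdom p `&` [set y | en (y - pcen p) < prad p / 2]),
          [set r | 0 < r < prad p / 2]); last first.
    move=> [q' r] /= [[y [py yc] <-]] /andP[r00 rr].
    exists (Patch y r (pnor p) (poff p) (pmap p)); split=> //.
      by move: yc => /= yc; apply: (fs_shrink FS) => //; lra.
    by split => /=; [rewrite subrr en0|exact: py.2].
  split=> //=; near=> r; apply/andP; split; first by near: r; exact: nbhs_right_gt.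
  by near: r; exact: nbhs_right_lt.
move=> h; near (0 : R)^'+ => r.
exists r; first by near: r; exact: nbhs_right_gt.
move=> q; have : [set: T] `<=` Q r by near: r.
  by apply.
Unshelve. all: by end_near. Qed.

End local_isometries.

End flat_spaces.

(** * Splitting off the first coordinate *)

Section splitting.
Context {R : realType} {m : nat}.
Implicit Types (x y : 'rV[R]_m) (z w : 'rV[R]_m.+1) (t s a c : R).

Definition ht z : R := z 0 ord0.
Definition cat t x : 'rV[R]_m.+1 :=
  \row_j (if unlift ord0 j is Some i then x 0 i else t).
Definition tl z : 'rV[R]_m := \row_j z 0 (lift ord0 j).

Lemma cat0E t x : ht (cat t x) = t.
Proof. by rewrite /ht mxE unlift_none. Qed.

Lemma catSE t x i : cat t x 0 (lift ord0 i) = x 0 i.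
Proof. by rewrite mxE liftK. Qed.

Lemma tl_cat t x : tl (cat t x) = x.
Proof. by apply/rowP => i; rewrite mxE catSE. Qed.

Lemma cat_tl z : cat (ht z) (tl z) = z.
Proof. by apply/rowP => j; rewrite mxE /ht; case: unliftP => [i|] -> //; rewrite mxE. Qed.

Lemma eq_cat z w : ht z = ht w -> tl z = tl w -> z = w.
Proof. by move=> h h'; rewrite -(cat_tl z) h h' cat_tl. Qed.

Lemma catB t s x y : cat t x - cat s y = cat (t - s) (x - y).
Proof. by apply/rowP => j; rewrite !mxE; case: unliftP => [i|] _ //; rewrite !mxE. Qed.

Lemma tlB z w : tl (z - w) = tl z - tl w.
Proof. by apply/rowP => j; rewrite !mxE. Qed.

Lemma tlD z w : tl (z + w) = tl z + tl w.
Proof. by apply/rowP => j; rewrite !mxE. Qed.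

Lemma tlZ t w : tl (t *: w) = t *: tl w.
Proof. by apply/rowP => j; rewrite !mxE. Qed.

Lemma tl_e0 : tl 'e_ord0 = 0.
Proof. by apply/rowP => j; rewrite !mxE. Qed.

Lemma dotp_split z w : dotp z w = ht z * ht w + dotp (tl z) (tl w).
Proof.
by rewrite /dotp big_ord_recl; congr (_ + _); apply: eq_bigr => i _; rewrite !mxE.
Qed.

Lemma en_split z : en z ^+ 2 = ht z ^+ 2 + en (tl z) ^+ 2.
Proof. by rewrite !en_sqr dotp_split -expr2. Qed.

Lemma en_cat0 x : en (cat 0 x) = en x.
Proof.
apply/eqP; rewrite -(@eqrXn2 _ 2) ?en_ge0 // en_split tl_cat cat0E expr0n add0r.
by [].
Qed.

Lemma en_cat_tl0 t : en (cat t 0) = `|t|.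
Proof.
apply/eqP; rewrite -(@eqrXn2 _ 2) ?en_ge0 // en_split tl_cat cat0E en0 expr0n addr0.
by rewrite real_normK ?num_real.
Qed.

Lemma en_cat_cat t x y : en (cat t x - cat t y) = en (x - y).
Proof. by rewrite catB subrr en_cat0. Qed.

Lemma en_cat_tl t z : en (z - cat t (tl z)) = `|ht z - t|.
Proof. by rewrite -{1}(cat_tl z) catB subrr en_cat_tl0. Qed.

Lemma en_tl_le z : en (tl z) <= en z.
Proof.
rewrite -(@ler_pXn2r _ 2) ?nnegrE ?en_ge0 // en_split lerDr.
by rewrite sqr_ge0.
Qed.

Lemma coord_near z w : `|ht w - ht z| <= en (w - z).
Proof. by have := coord_le_en (w - z) ord0; rewrite /ht !mxE. Qed.

Lemma htB z w : ht (z - w) = ht z - ht w.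
Proof. by rewrite /ht !mxE. Qed.

Lemma htZ t w : ht (t *: w) = t * ht w.
Proof. by rewrite /ht !mxE. Qed.

Lemma ht_e0 : ht 'e_ord0 = 1.
Proof. by rewrite /ht mxE !eqxx. Qed.

Lemma ht_line z w t :
  ht (z + t *: w) = ht z + t * ht w.
Proof. by rewrite /ht !mxE. Qed.

Lemma near_coord_lt z c : ht z < c -> \forall w \near z, ht w < c.
Proof.
rewrite /ht -dotp_delta => /near_dotp; apply: filterS => w; by rewrite dotp_delta.
Qed.

Lemma near_coord_gt z c : c < ht z -> \forall w \near z, c < ht w.
Proof.
rewrite /ht -dotp_delta => /near_dotp_gt; apply: filterS => w; by rewrite dotp_delta.
Qed.

Lemma near_tl z (N : set 'rV[R]_m) : nbhs (tl z) N -> \forall w \near z, N (tl w).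
Proof.
move=> /nbhs_enP[r r0 h]; apply/nbhs_enP; exists r => // w wz; apply: h.
by rewrite -tlB; apply: le_lt_trans wz; exact: en_tl_le.
Qed.

Lemma near_cat t x (N : set 'rV[R]_m.+1) : nbhs (cat t x) N ->
  \forall y \near x, N (cat t y).
Proof.
move=> /nbhs_enP[r r0 h]; apply/nbhs_enP; exists r => // y yx; apply: h.
by rewrite en_cat_cat.
Qed.

Lemma near_ball k (z a : 'rV[R]_k) r : en (z - a) < r ->
  \forall w \near z, en (w - a) < r.
Proof.
move=> h; apply/nbhs_enP; exists (r - en (z - a)); first by rewrite subr_gt0.
by move=> w; have := en_triangleB z w a; lra.
Qed.

Definition slab t : set 'rV[R]_m.+1 := [set z | 0 <= ht z <= t].

Lemma cvx_slab t : cvx (slab t).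
Proof.
move=> z w s /andP[z0 zt] /andP[w0 wt] /andP[s0 s1].
by rewrite /slab /= /ht !mxE -!/(ht _); apply/andP; split; nra.
Qed.

Lemma nbhs_slab t z : 0 < ht z < t -> nbhs z (slab t).
Proof.
move=> /andP[/near_coord_gt z0 /near_coord_lt zt]; move: z0 zt.
by apply: filterS2 => w w0 wt; rewrite /slab /= !ltW.
Qed.

Lemma fat_slab t : 0 < t -> fat (slab t).
Proof.
move=> t0 z N /andP[z0 zt] nN.
(* Interior points of the slab are reached by moving towards its middle level [t / 2]. *)
pose v : 'rV[R]_m.+1 := (t / 2 - ht z) *: 'e_ord0.
have [|d d0 hd] := @near_line _ _ z v 0 N; first by rewrite scale0r addr0.
pose s := Num.min (d / 2) 1.
have s0 : 0 < s by rewrite lt_min ltr01 divr_gt0.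
have s1 : s <= 1 by rewrite ge_min lexx orbT.
have sd : s <= d / 2 by rewrite ge_min lexx.
exists (z + s *: v); first by apply: hd; rewrite subr0 gtr0_norm //; lra.
apply: nbhs_slab; rewrite ht_line htZ ht_e0 mulr1.
by apply/andP; split; nra.
Qed.

Lemma cvx_half_open (B : set 'rV[R]_m.+1) : cvx B -> cvx [set z | 0 <= ht z /\ B z].
Proof.
move=> cB z w s [z0 Bz] [w0 Bw] s01; split; last exact: cB.
by case/andP: s01 => s0 s1; rewrite ht_line htB; nra.
Qed.

Lemma fat_half_open (B : set 'rV[R]_m.+1) : (forall z, B z -> nbhs z B) ->
  fat [set z | 0 <= ht z /\ B z].
Proof.
move=> oB z N [z0 Bz] nN.
have [|d d0 hd] := @near_line _ _ z 'e_ord0 0 (N `&` B).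
  by rewrite scale0r addr0; apply: filterI => //; exact: oB.
have [|Nz Bz'] := hd (d / 2); first by rewrite subr0 gtr0_norm ?divr_gt0 //; lra.
exists (z + (d / 2) *: 'e_ord0) => //.
have /near_coord_gt : 0 < ht (z + (d / 2) *: 'e_ord0).
  by rewrite ht_line ht_e0 mulr1; lra.
move: (oB _ Bz'); apply: filterS2 => w Bw w0; split=> //; exact: ltW.
Qed.

Lemma affine_isometry_slab (f : 'rV[R]_m -> 'rV[R]_m) s c : s ^+ 2 = 1 ->
  affine_isometry f ->
  affine_isometry (fun z => cat (s * ht z + c) (f (tl z))).
Proof.
move=> s1 fi; apply: affine_isometry_of_en => z w.
apply/eqP; rewrite -(@eqrXn2 _ 2) ?en_ge0 // !en_split catB cat0E tl_cat.
rewrite affine_isometry_en // -tlB htB.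
have -> : s * ht z + c - (s * ht w + c) = s * (ht z - ht w) by ring.
by rewrite exprMn s1 mul1r.
Qed.

(** One half-space through [z] is locally contained in another. The directions [e_i] and [- e_i] for
    i <> 0 both lie in the first, so [v] has no such components; its length is 1, and the direction
    [s e_0] decides the sign. *)
Lemma half_orient z v s : s ^+ 2 = 1 -> en v = 1 ->
  (\forall w \near z, 0 <= s * (ht w - ht z) -> 0 <= dotp (w - z) v) ->
  v = s *: 'e_ord0.
Proof.
move=> s1 v1 /nbhs_enP[r r0 h].
have h' u : en u < r -> 0 <= s * ht u -> 0 <= dotp u v.
  move=> ur u0; have := h (z + u); rewrite addrAC subrr add0r -htB addrAC subrr add0r; exact.
have vi i : i != ord0 -> v 0 i = 0.
  move=> i0; have hh e : `|e| < r -> 0 <= e * v 0 i.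
    move=> er; have := h' (e *: 'e_i); rewrite enZ en_delta mulr1 dotpZl dotpC.
    rewrite dotp_delta; apply=> //.
    by rewrite /ht !mxE [ord0 == i]eq_sym (negbTE i0) /= !mulr0.
  have := hh (r / 2); have := hh (- (r / 2)).
  rewrite normrN gtr0_norm ?divr_gt0 //.
  have rr : r / 2 < r by lra.
  by move=> /(_ rr) h1 /(_ rr) h2; nra.
have vE : v = v 0 ord0 *: 'e_ord0.
  apply/rowP => i; rewrite !mxE; have [->|/vi ->] := eqVneq i ord0.
    by rewrite eqxx mulr1.
  by rewrite mulr0.
rewrite vE; congr (_ *: _).
have vv : v 0 ord0 ^+ 2 = 1.
  by rewrite -[RHS](expr1n _ 2) -v1 {2}vE enZ en_delta mulr1 real_normK // num_real.
have := h' ((s * (r / 2)) *: 'e_ord0).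
have sn : `|s| = 1 by apply/eqP; rewrite -(@eqrXn2 _ 2) // real_normK ?num_real // s1 expr1n.
rewrite enZ en_delta mulr1 normrM sn mul1r gtr0_norm ?divr_gt0 // htZ ht_e0 mulr1.
rewrite mulrA -expr2 s1 mul1r dotpZl dotpC dotp_delta => hh.
have {}hh : 0 <= s * (r / 2) * v 0 ord0 by apply: hh; lra.
have sv : 0 <= s * v 0 ord0.
  by move: hh; rewrite mulrAC pmulr_lge0 ?divr_gt0.
have /eqP : (s * v 0 ord0) ^+ 2 = 1 by rewrite exprMn s1 vv mulr1.
rewrite sqrf_eq1 => /orP[/eqP e|/eqP e]; last by lra.
by rewrite -[LHS]mul1r -s1 expr2 -mulrA e mulr1.
Qed.

(** Agreement on a hyperplane leaves only the reflection in it as an ambiguity, and the common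
    formula for the height excludes that. *)
Lemma affine_isometry_hyperplane_eq (g g' : 'rV[R]_m.+1 -> 'rV[R]_m.+1) n c x :
  affine_isometry g -> affine_isometry g' ->
  (forall w, dotp (g w) n - c = ht w) ->
  (forall w, dotp (g' w) n - c = ht w) ->
  (\forall y \near x, g (cat 0 y) = g' (cat 0 y)) -> g = g'.
Proof.
move=> gi gi' gn gn' e; have [h [hi gh hg]] := affine_isometry_inv gi.
apply: (affine_isometry_eq (z := cat 0 x)) => //.
have : \forall w \near cat 0 x, g (cat 0 (tl w)) = g' (cat 0 (tl w)).
  by apply: (near_tl (N := [set y | g (cat 0 y) = g' (cat 0 y)])); rewrite tl_cat.
apply: filterS => w e'.
suff wE : w = h (g' w) by rewrite {1}wE hg.
have h0 : ht (h (g' w)) = ht w by rewrite -gn -gn' hg.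
apply: eq_cat => //.
have : en (h (g' w) - cat 0 (tl w)) = en (w - cat 0 (tl w)).
  by rewrite -(affine_isometry_en _ _ gi) hg e' affine_isometry_en.
move=> /(congr1 (fun u => u ^+ 2)).
rewrite !en_split !tlB tl_cat subrr en0 expr0n addr0 !htB !cat0E h0 => /eqP.
rewrite -[eqbRHS]addr0 (inj_eq (addrI _)) sqrf_eq0 en_eq0 subr_eq0 => /eqP.
by move=> ->.
Qed.

End splitting.

(** * The collar flow and the flip *)

Section collar_flow.
Context {R : realType} {m : nat} {T : topologicalType}.
Context {P : set (@patch R T m.+1)} {bd : set T}.
Hypothesis FS : flat_space P bd.
Implicit Types (x y : 'rV[R]_m) (z w : 'rV[R]_m.+1) (t s a c r e : R).
Implicit Types (Phi Psi : 'rV[R]_m.+1 -> T) (p : @patch R T m.+1).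
Implicit Types (D : set 'rV[R]_m.+1).
Local Notation loc_iso := (@loc_iso R T m.+1 P).

(** In a patch through the common image point the germs are two affine isometries; [g] is one of
    them followed by the inverse of the other. *)
Lemma loc_iso_transfer D D' Phi Psi z z' : loc_iso D Phi z -> loc_iso D' Psi z' ->
  D z -> D' z' -> Phi z = Psi z' ->
  exists g, [/\ affine_isometry g, g z' = z &
    \forall w \near z', D' w -> D (g w) -> Phi (g w) = Psi w].
Proof.
move=> LPhi [p [g1 [Pp g1i H1]]] Dz Dz' e.
have [gz' gE] := nbhs_singleton H1 Dz'.
have [|g2 [g2i g2z H2]] := loc_iso_any FS LPhi Dz Pp gz'; first by rewrite -gE.
have [h [hi gh hg]] := affine_isometry_inv g2i.
exists (h \o g1); split; [exact: affine_isometry_comp|by rewrite /= -g2z gh|].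
have : nbhs ((h \o g1) z') [set w | D w -> pdom p (g2 w) /\ Phi w = pmap p (g2 w)].
  by rewrite /= -g2z gh.
move/(affine_isometry_near (affine_isometry_comp hi g1i)); move: H1.
apply: filterS2 => w H1 {}H2 /H1[_ ->] /H2[_ ->].
by rewrite /= hg.
Qed.

Lemma near_not_bd D Phi z : loc_iso D Phi z -> D z -> ~ bd (Phi z) ->
  \forall w \near z, D w -> ~ bd (Phi w).
Proof.
move=> [p [g [Pp gi H]]] Dz; have [gz ->] := nbhs_singleton H Dz.
move=> nb.
have : \forall w \near g z, ~ (pnor p != 0 /\ dotp w (pnor p) = poff p).
  have [n0|n0] := eqVneq (pnor p) 0; first by near=> w => -[].
  have h : poff p < dotp (g z) (pnor p).
    rewrite lt_neqAle gz.2 andbT; apply/eqP => e; apply: nb.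
    exact/(fs_bd FS Pp gz).
  by move: (near_dotp_gt h); apply: filterS => w hw [_ hw']; rewrite hw' ltxx in hw.
move=> /(affine_isometry_near gi); move: H; apply: filterS2 => w H h /H[gw ->].
by move/(fs_bd FS Pp gw).
Unshelve. all: by end_near. Qed.

(** The sign tells on which side of the level of [z] the domain lies: 1 on the lower face of a slab,
    -1 on the upper one. [half_orient] then identifies the pulled-back normal of the patch. *)
Lemma bd_orient D Phi z p g s : s ^+ 2 = 1 -> P p -> affine_isometry g -> D z ->
  (\forall w \near z, D w -> pdom p (g w) /\ Phi w = pmap p (g w)) ->
  (\forall w \near z, 0 <= s * (ht w - ht z) -> D w) -> bd (Phi z) ->
  pnor p != 0 /\ forall w, dotp (g w) (pnor p) - poff p = s * (ht w - ht z).
Proof.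
move=> s1 Pp gi Dz H HD; have [gz ->] := nbhs_singleton H Dz.
move=> /(fs_bd FS Pp gz)[n0 nz]; split=> // w.
have /affine_isometryP[A [b [AA gE]]] := gi.
have gdot u : dotp (g u) (pnor p) - poff p = dotp (u - z) (pnor p *m A^T).
  by rewrite -dotp_mulmx -nz !gE -dotpNl -dotpDl mulmxBl opprD addrACA subrr addr0.
have -> : dotp (g w) (pnor p) - poff p = dotp (w - z) (s *: 'e_ord0).
  rewrite gdot; congr (dotp _ _); apply: (half_orient (z := z) s1).
    by rewrite /en dotp_mulmx trmxK -mulmxA (mulmx1C AA) mulmx1 -/(en _) (fs_unit FS Pp).
  move: H HD; apply: filterS2 => u H HD /HD/H[[_ +] _].
  by rewrite -gdot subr_ge0.
by rewrite dotpZr dotp_delta -htB.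
Qed.

(** [iota] stands for the covering of the boundary by R^m. [iota_iso] says that in every patch it is
    the trace of an affine isometry that turns height into distance from the face, so the inward
    normal is prescribed too. *)
Context (Gam : set ('rV[R]_m -> 'rV[R]_m)) (iota : 'rV[R]_m -> T).
Hypothesis iota_bd : forall q, bd q <-> exists x, iota x = q.
Hypothesis iota_iso : forall x p (y : 'rV[R]_m.+1), P p -> pdom p y -> pmap p y = iota x ->
  exists g, [/\ affine_isometry g, g (cat 0 x) = y,
    forall z, dotp (g z) (pnor p) - poff p = ht z &
    \forall x' \near x, iota x' = pmap p (g (cat 0 x'))].
Hypothesis Gam_iso : forall f, Gam f -> affine_isometry f.
Hypothesis iota_Gam : forall f x, Gam f -> iota (f x) = iota x.
Hypothesis Gam_compact : exists2 K : set 'rV[R]_m, compact K &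
  forall x, exists2 f, Gam f & K (f x).
Hypothesis T_compact : compact [set: T].

(** The normal exponential map of the boundary up to distance [t], characterized by its values on
    the lower face and by being a local isometry. *)
Definition flow t Phi := (forall x, Phi (cat 0 x) = iota x) /\
  forall z, slab t z -> loc_iso (slab t) Phi z.

(** The germ of a flow at the lower face is forced: any isometry that describes it agrees with [g]
    on the hyperplane of height 0, and both turn height into distance from the face of the patch. *)
Lemma start_unique D Phi x p (y : 'rV[R]_m.+1) g :
  loc_iso D Phi (cat 0 x) ->
  (\forall w \near cat 0 x, 0 <= ht w -> D w) ->
  (\forall x' \near x, Phi (cat 0 x') = iota x') -> P p -> pdom p y ->
  affine_isometry g -> g (cat 0 x) = y ->
  (forall z, dotp (g z) (pnor p) - poff p = ht z) ->
  (\forall x' \near x, iota x' = pmap p (g (cat 0 x'))) ->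
  \forall w \near cat 0 x, D w -> pdom p (g w) /\ Phi w = pmap p (g w).
Proof.
move=> LPhi HD Phi0 Pp py gi gx gdot g0.
have Dx : D (cat 0 x) by apply: (nbhs_singleton HD); rewrite cat0E.
have pyE : pmap p y = Phi (cat 0 x).
  by rewrite (nbhs_singleton Phi0) (nbhs_singleton g0) gx.
have [g' [g'i g'x H']] := loc_iso_any FS LPhi Dx Pp py pyE.
have [|||n0 g'dot] := @bd_orient D Phi (cat 0 x) p g' 1 _ Pp g'i Dx H'.
- by rewrite expr1n.
- by move: HD; apply: filterS => w h; rewrite mul1r cat0E subr0.
- by rewrite (nbhs_singleton Phi0); apply/iota_bd; exists x.
suff -> : g = g' by [].
apply: (affine_isometry_hyperplane_eq (x := x) (n := pnor p) (c := poff p)) => //.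
  by move=> w; rewrite g'dot mul1r cat0E subr0.
have gd : \forall x' \near x, pdom p (g (cat 0 x')).
  have : \forall x' \near x, en (g (cat 0 x') - pcen p) < prad p.
    apply: (near_cat (N := [set w | en (g w - pcen p) < prad p])).
    apply: (affine_isometry_near (P := [set w | en (w - pcen p) < prad p]) gi).
    by rewrite gx; apply: near_ball; exact: py.1.
  apply: filterS => x' h; split=> //.
  by rewrite -subr_ge0 gdot cat0E.
near=> x'.
have Dx' : D (cat 0 x').
  suff : 0 <= ht (cat 0 x') -> D (cat 0 x') by apply; rewrite cat0E.
  by near: x'; exact: (near_cat (N := [set w | 0 <= ht w -> D w])).
have [d' e'] : pdom p (g' (cat 0 x')) /\ Phi (cat 0 x') = pmap p (g' (cat 0 x')).
  by move: Dx'; near: x'; exact: near_cat H'.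
apply: (fs_inj FS Pp); [by near: x'|by []|rewrite -e'].
have -> : Phi (cat 0 x') = iota x' by near: x'.
by apply/esym; near: x'.
Unshelve. all: by end_near. Qed.

Lemma near_slab0 t x : 0 < t -> \forall w \near cat 0 x, 0 <= ht w -> slab t w.
Proof.
move=> t0; have /near_coord_lt : ht (cat 0 x) < t by rewrite cat0E.
by apply: filterS => w wt w0; rewrite /slab /= w0 ltW.
Qed.

Lemma flow_unique t Phi Psi : 0 < t -> flow t Phi -> flow t Psi ->
  forall z, slab t z -> Phi z = Psi z.
Proof.
move=> t0 [Phi0 LPhi] [Psi0 LPsi].
have D0 : slab t (cat 0 (0 : 'rV[R]_m)) by rewrite /slab /= cat0E lexx ltW.
have [p [Pp cp pE]] := fs_cover FS (iota 0).
have [g [gi gx gdot g0]] := iota_iso Pp cp pE.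
apply: (unique_continuation FS (@cvx_slab _ _ t) (fat_slab t0) LPhi LPsi D0).
have S Q : flow t Q -> \forall w \near cat 0 (0 : 'rV[R]_m), slab t w -> pdom p (g w) /\ Q w = pmap p (g w).
  move=> [Q0 LQ]; apply: start_unique cp gi gx gdot g0 => //; first exact: LQ.
    exact: near_slab0.
  by near=> x'; exact: Q0.
have h1 : flow t Phi by []; have h2 : flow t Psi by [].
by move: (S _ h1) (S _ h2); apply: filterS2 => w H1 H2 Dw; rewrite (H1 Dw).2 (H2 Dw).2.
Unshelve. all: by end_near. Qed.

Lemma flow_le s t Phi : s <= t -> flow t Phi -> flow s Phi.
Proof.
move=> st [Phi0 LPhi]; split=> // z /andP[z0 zs].
apply: (loc_iso_sub (LPhi z _)); first by rewrite /slab /= z0 (le_trans zs).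
by near=> w => /andP[w0 ws]; rewrite /slab /= w0 (le_trans ws).
Unshelve. all: by end_near. Qed.

(** Precomposition with the action of [f] on the slab gives another flow, as [iota] is invariant
    under [f]; flows are unique. *)
Lemma flow_periodic t Phi f : 0 < t -> flow t Phi -> Gam f ->
  forall s x, 0 <= s <= t -> Phi (cat s (f x)) = Phi (cat s x).
Proof.
move=> t0 F Gf s x st.
pose h z := cat (1 * ht z + 0) (f (tl z)).
have hi : affine_isometry h by apply: affine_isometry_slab; rewrite ?expr1n //; exact: Gam_iso.
have hE u y : h (cat u y) = cat u (f y) by rewrite /h cat0E tl_cat mul1r addr0.
have hh w : ht (h w) = ht w by rewrite /h cat0E mul1r addr0.
rewrite -hE; apply: (@flow_unique t (Phi \o h)) => //; last by rewrite /slab /= cat0E.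
case: F => Phi0 LPhi; split=> [y /=|z zt]; first by rewrite hE Phi0 iota_Gam.
apply: loc_iso_comp hi _ _; first by apply: LPhi; rewrite /slab /= hh.
by near=> w; rewrite /slab /= hh.
Unshelve. all: by end_near. Qed.

(* Local pieces of width [e] above height [t] that agree near height [t] fit
   together with [Phi] to a map defined up to height [t + e / 2]. *)
Lemma flow_glue t e Phi (Psi : 'rV[R]_m -> 'rV[R]_m.+1 -> T)
    (dom := fun x => [set z | 0 <= ht z /\ en (z - cat t x) < e]) :
  0 <= t -> 0 < e ->
  (forall x z, dom x z -> loc_iso (dom x) (Psi x) z) ->
  (forall x, \forall x' \near x, \forall w \near cat t x', 0 <= ht w ->
     Psi x w = Psi x' w) ->
  (0 < t -> flow t Phi) ->
  (forall x, \forall w \near cat t x, 0 <= ht w < t -> Phi w = Psi x w) ->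
  (t = 0 -> forall x, Psi x (cat 0 x) = iota x) ->
  exists Phi', flow (t + e / 2) Phi'.
Proof.
move=> t0 e0 LPsi HPsi FPhi PhiPsi Psi0.
(* At heights from [t] to [t + e / 2] a point is less than [e] away from its foot point on level
   [t], so the piece over that foot point is defined there. *)
pose Phi' w := if ht w < t then Phi w else Psi (tl w) w.
exists Phi'; split=> [x|z /andP[z0 zt]].
  rewrite /Phi' cat0E tl_cat; case: ltP => [t0'|t0']; first by apply: (FPhi t0').1.
  by apply: Psi0; apply/eqP; rewrite eq_le t0'.
have [zt'|tz] := ltP (ht z) t.
  have t0' : 0 < t by apply: le_lt_trans zt'.
  apply: (loc_iso_sub ((FPhi t0').2 z _)); first by rewrite /slab /= z0 ltW.
  move: (near_coord_lt zt'); apply: filterS => w wt /andP[w0 _].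
  by rewrite /slab /= w0 ltW // /Phi' wt.
set x := tl z.
(* Neighbouring pieces agree near the foot point of [w], hence on the intersection of their two
   balls with the half-space, which is convex. *)
have key : \forall w \near z, 0 <= ht w -> t <= ht w -> Psi (tl w) w = Psi x w.
  near=> w => w0 tw; apply/esym.
  have cvxB (a : 'rV[R]_m) : cvx [set w | en (w - cat t a) < e].
    by move=> u v s; exact: cvx_en.
  have openB (a : 'rV[R]_m) u : en (u - cat t a) < e -> nbhs u [set w | en (w - cat t a) < e].
    exact: near_ball.
  have x'x : en ((tl w) - x) < e.
    by near: w; apply: (near_tl (N := [set y | en (y - x) < e])); exact: near_en.
  pose D := [set v | 0 <= ht v /\ (en (v - cat t x) < e /\ en (v - cat t (tl w)) < e)].
  apply: (@unique_continuation _ _ _ _ _ FS D (Psi x) (Psi (tl w)) (cat t (tl w))).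
  - apply: cvx_half_open => u v s [u1 u2] [v1 v2] s01.
    by split; [exact: cvxB|exact: cvxB].
  - by apply: fat_half_open => u [u1 u2]; apply: filterI; exact: openB.
  - move=> u [u0 [u1 u2]]; apply: (loc_iso_sub (LPsi x u _)) => //.
    by near=> v => -[v0 [v1 v2]].
  - move=> u [u0 [u1 u2]]; apply: (loc_iso_sub (LPsi (tl w) u _)) => //.
    by near=> v => -[v0 [v1 v2]].
  - by rewrite /D /= cat0E en_cat_cat subrr en0.
  - have : \forall v \near cat t (tl w), 0 <= ht v -> Psi x v = Psi (tl w) v.
      near: w.
      exact: (near_tl (HPsi (tl z))).
    by apply: filterS => v h [v0 _]; exact: h.
  - split=> //; split.
      near: w; apply: (near_ball (r := e)).
      by rewrite en_cat_tl ger0_norm ?subr_ge0 //; lra.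
    rewrite en_cat_tl ger0_norm ?subr_ge0 // ltrBlDl.
    by near: w; apply: near_coord_lt; lra.
have zd : dom (tl z) z.
  by split=> //; rewrite en_cat_tl ger0_norm ?subr_ge0 //; lra.
apply: (loc_iso_sub (LPsi (tl z) z zd)).
have : \forall w \near z, en (w - cat t (tl z)) < e by exact: near_ball zd.2.
have : \forall w \near z, 0 <= ht w < t -> Phi w = Psi (tl z) w.
  have [tz'|zt'] := ltP t (ht z).
    by move: (near_coord_gt tz'); apply: filterS => w tw /andP[_]; rewrite ltNge ltW.
  have -> : z = cat t (tl z) by rewrite -{1}(cat_tl z); congr cat; apply/eqP; rewrite eq_le zt'.
  by rewrite tl_cat; exact: PhiPsi.
move: key; apply: filterS3 => w h1 h2 h3 /andP[w0 _]; split=> //.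
by rewrite /Phi'; case: ltP => wt; [apply: h2; rewrite w0|exact: h1].
Unshelve. all: by end_near. Qed.

Lemma flow_start : exists2 t, 0 < t & exists Phi, flow t Phi.
Proof.
have [r r0 hr] := uniform_radius FS T_compact.
have /choice[q hq] : forall x, exists pg : @patch R T m.+1 * ('rV[R]_m.+1 -> 'rV[R]_m.+1),
   [/\ P pg.1 /\ pdom pg.1 (pcen pg.1), prad pg.1 = r,
       affine_isometry pg.2 /\ pg.2 (cat 0 x) = pcen pg.1,
       forall z, dotp (pg.2 z) (pnor pg.1) - poff pg.1 = ht z
     & \forall x' \near x, iota x' = pmap pg.1 (pg.2 (cat 0 x'))].
  move=> x; have [p [Pp cp pE pr]] := hr (iota x).
  by have [g [gi gx gdot g0]] := iota_iso Pp cp pE; exists (p, g).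
pose Psi x := pmap (q x).1 \o (q x).2.
(* For [t = 0] there is nothing below the level, so the constant map is only a placeholder. *)
have [|||||||Phi F] := @flow_glue 0 r (fun=> iota 0) Psi.
- by [].
- by [].
- move=> x z _; have [[Pp cp] pr [gi gx] gdot g0] := hq x.
  exists (q x).1, (q x).2; split=> //.
  near=> w => -[w0 wx]; split=> //; split; first by rewrite -gx affine_isometry_en // pr.
  by rewrite -subr_ge0 gdot.
- move=> x; have [[Pp cp] pr [gi gx] gdot g0] := hq x.
  near=> x'; have [[Pp' cp'] pr' [gi' gx'] gdot' g0'] := hq x'.
  have xx' : en (x' - x) < r by near: x'; exact: near_en.
  pose D := [set w : 'rV[R]_m.+1 | 0 <= ht w /\ en (w - cat 0 x) < r].
  have nD : \forall w \near cat 0 x', 0 <= ht w -> D w.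
    have : en (cat 0 x' - cat 0 x) < r by rewrite en_cat_cat.
    by move=> /near_ball; apply: filterS.
  have : \forall w \near cat 0 x', D w -> pdom (q x').1 ((q x').2 w) /\
      Psi x w = pmap (q x').1 ((q x').2 w).
    apply: (start_unique _ nD _ Pp' cp' gi' gx' gdot' g0').
      exists (q x).1, (q x).2; split=> //.
      near=> w => -[w0 wx]; split=> //; split; first by rewrite -gx affine_isometry_en // pr.
      by rewrite -subr_ge0 gdot.
    have : \forall x'' \near x', iota x'' = pmap (q x).1 ((q x).2 (cat 0 x'')).
      by near: x'; exact: near_near.
    by apply: filterS.
  by move: nD; apply: filterS2 => w h1 h2 /h1/h2[].
- by rewrite ltxx.
- by move=> x; near=> w => /andP[w0]; rewrite ltNge w0.
- by move=> _ x; have [_ _ _ _ /nbhs_singleton] := hq x.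
by exists (0 + r / 2); [rewrite add0r divr_gt0|exists Phi].
Unshelve. all: by end_near. Qed.

(** A point of the top level that avoids the boundary is the centre of a full ball. The radius can
    be chosen uniformly because the flow is periodic under [Gam], which has a compact set of
    representatives. *)
Lemma full_radius t Phi : 0 < t -> flow t Phi ->
  (forall x, ~ bd (Phi (cat t x))) ->
  exists2 e, 0 < e & forall x, exists p,
    [/\ P p, pmap p (pcen p) = Phi (cat t x), prad p = e &
        forall w, en (w - pcen p) < e -> pdom p w].
Proof.
move=> t0 F nb; have [K /compact_near_coveringP cK GK] := Gam_compact.
pose Q e x := exists p, [/\ P p, pmap p (pcen p) = Phi (cat t x), prad p = e &
        forall w, en (w - pcen p) < e -> pdom p w].
suff : \forall e \near (0 : R)^'+, K `<=` Q e.
  move=> h; near (0 : R)^'+ => e.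
  exists e; first by near: e; exact: nbhs_right_gt.
  move=> x; have [f Gf Kf] := GK x.
  have /(_ _ Kf)[p [Pp pE pe pd]] : K `<=` Q e by near: e.
  exists p; split=> //; rewrite pE (flow_periodic t0 F Gf) //.
  by rewrite ltW //=.
apply: cK => x _; have [p [Pp cp pE]] := fs_cover FS (Phi (cat t x)).
have [rho rho0 [rhop hrho]] : exists2 rho, 0 < rho & rho <= prad p /\
    forall w, en (w - pcen p) < rho -> pdom p w.
  have : \forall w \near pcen p, poff p <= dotp w (pnor p).
    have [n0|n0] := eqVneq (pnor p) 0.
      by have := cp.2; rewrite n0 dotp0r => h; near=> y; rewrite dotp0r.
    have /near_dotp_gt : poff p < dotp (pcen p) (pnor p).
      rewrite lt_neqAle cp.2 andbT; apply/eqP => e; apply: (nb x).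
      by rewrite -pE; apply/(fs_bd FS Pp cp).
    by apply: filterS => y /ltW.
  move=> /nbhs_enP[d d0 hd].
  have r0 : 0 < prad p by apply: le_lt_trans cp.1; exact: en_ge0.
  exists (Num.min d (prad p)); first by rewrite lt_min d0.
  split; first by rewrite ge_min lexx orbT.
  by move=> y; rewrite lt_min => /andP[yd yp]; split=> //; exact: hd.
have rho2 : 0 < rho / 2 by rewrite divr_gt0.
have st : slab t (cat t x) by rewrite /slab /= cat0E lexx ltW.
have := fs_nbhs FS Pp cp (near_en (pcen p) rho2); rewrite pE.
move=> /(loc_iso_cont FS (F.2 _ st) st)/near_cat nx.
exists ([set y | slab t (cat t y) ->
   (pmap p @` (pdom p `&` [set w | en (w - pcen p) < rho / 2])) (Phi (cat t y))],
   [set r | 0 < r < rho / 2]).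
  split=> //=; near=> r; apply/andP; split; first by near: r; exact: nbhs_right_gt.
  by near: r; exact: nbhs_right_lt.
move=> [x' r] /= [hx' /andP[r0 rr]].
case: hx'; first by rewrite /slab /= cat0E lexx ltW.
move=> y [py yc] yE; exists (Patch y r (pnor p) (poff p) (pmap p)).
move: yc => /= yc; split=> //; first by apply: (fs_shrink FS) => //; lra.
move=> v /= vr; split=> //=.
by apply: (hrho _ _).2; have := en_triangleB y v (pcen p); lra.
Unshelve. all: by end_near. Qed.

(** The full balls around the top level supply the pieces for [flow_glue]. Nearby pieces coincide
    because both continue [Phi], which is given on an open set just below the level. *)
Lemma flow_extend t Phi : 0 < t -> flow t Phi -> (forall x, ~ bd (Phi (cat t x))) ->
  exists2 t', t < t' & exists Phi', flow t' Phi'.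
Proof.
move=> t0 F nb; have [e e0 he] := full_radius t0 F nb.
have st x : slab t (cat t x) by rewrite /slab /= cat0E lexx ltW.
have /choice[q hq] : forall x, exists pg : @patch R T m.+1 * ('rV[R]_m.+1 -> 'rV[R]_m.+1),
   [/\ P pg.1 /\ prad pg.1 = e,
       forall w, en (w - pcen pg.1) < e -> pdom pg.1 w,
       affine_isometry pg.2 /\ pg.2 (cat t x) = pcen pg.1
     & \forall w \near cat t x, slab t w -> pdom pg.1 (pg.2 w) /\
         Phi w = pmap pg.1 (pg.2 w)].
  move=> x; have [p [Pp pE pr pd]] := he x.
  have cp : pdom p (pcen p) by apply: pd; rewrite subrr en0.
  have [g [gi gx H]] := loc_iso_any FS (F.2 _ (st x)) (st x) Pp cp pE.
  by exists (p, g).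
pose Psi x := pmap (q x).1 \o (q x).2.
pose dom x := [set z : 'rV[R]_m.+1 | 0 <= ht z /\ en (z - cat t x) < e].
have LPsi x z : dom x z -> loc_iso (dom x) (Psi x) z.
  move=> _; have [[Pp pr] pd [gi gx] g0] := hq x.
  exists (q x).1, (q x).2; split=> //.
  by near=> w => -[w0 wx]; split=> //; apply: pd; rewrite -gx affine_isometry_en.
have [|||||||Phi' F'] := @flow_glue t e Phi Psi.
- exact: ltW.
- by [].
- exact: LPsi.
- move=> x; have [[Pp pr] pd [gi gx] g0] := hq x.
  have nN := near_cat (near_near g0); near=> x'.
  have {}g0 : \forall w \near cat t x', slab t w -> Phi w = Psi x w.
    have : \forall w \near cat t x', slab t w ->
      pdom (q x).1 ((q x).2 w) /\ Phi w = pmap (q x).1 ((q x).2 w) by near: x'.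
    by apply: filterS => w h /h[].
  have g0' : \forall w \near cat t x', slab t w -> Phi w = Psi x' w.
    by have [_ _ _] := hq x'; apply: filterS => w h /h[].
  have xx' : en (x' - x) < e by near: x'; exact: near_en.
  pose D := dom x `&` dom x'.
  have nD z : 0 < ht z -> en (z - cat t x) < e -> en (z - cat t x') < e -> nbhs z D.
    move=> /near_coord_gt h0 /near_ball h1 /near_ball h2.
    by move: h0 h1 h2; apply: filterS3 => w /ltW w0 w1 w2.
  have nDx' : nbhs (cat t x') D.
    by apply: nD; rewrite ?cat0E ?en_cat_cat ?subrr ?en0.
  have Dx' := nbhs_singleton nDx'.
  have : \forall w \near cat t x', D w -> Psi x w = Psi x' w.
    apply: (agree_fat FS).
    + apply: (loc_iso_sub (LPsi x _ Dx'.1)); by near=> w => -[].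
    + apply: (loc_iso_sub (LPsi x' _ Dx'.2)); by near=> w => -[].
    + exact: Dx'.
    + by rewrite -(nbhs_singleton g0) // -(nbhs_singleton g0').
    + move=> M nM.
      have [y [[My yD] [yE yE']] ny] := fat_slab t0 (st x') (filterI
        (filterI nM (near_near nDx')) (filterI (near_near g0) (near_near g0'))).
      exists y; split=> //; move: ny yE yE'; apply: filterS3 => w sw h1 h2.
      by rewrite -h1 // -h2.
  by move: nDx'; apply: filterS2 => w Dw h _; exact: h.
- by [].
- move=> x; have [_ _ _] := hq x; apply: filterS => w h /andP[w0 wt].
  by apply: (h _).2; rewrite /slab /= w0 ltW.
- by move=> e1; rewrite e1 ltxx in t0.
by exists (t + e / 2); [rewrite ltrDl divr_gt0|exists Phi'].
Unshelve. all: by end_near. Qed.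

(** Flows for different times agree on the smaller slab, so at each height any flow that reaches
    beyond it may be used; [tau] chooses one. *)
Lemma flow_union (I : set R) : (forall t, I t -> 0 < t /\ exists Phi, flow t Phi) ->
  (exists t, I t) ->
  exists Phi, (forall x, Phi (cat 0 x) = iota x) /\
    forall t, I t -> (forall z, 0 <= ht z < t -> loc_iso [set w | 0 <= ht w] Phi z).
Proof.
move=> hI [t1 It1].
have /choice[F hF] : forall t, exists Phi, I t -> flow t Phi.
  move=> t; have [/hI[_ [Phi F]]|nI] := pselect (I t); first by exists Phi.
  by exists (fun=> iota 0).
have /choice[tau htau] : forall u, exists t, (exists2 t, I t & u < t) -> I t /\ u < t.
  by move=> u; have [[t It ut]|n] := pselect (exists2 t, I t & u < t); [exists t|exists 0].
pose Phi z := F (tau (ht z)) z.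
have PhiE t z : I t -> 0 <= ht z < t -> Phi z = F t z.
  move=> It /andP[z0 zt]; rewrite /Phi; set s := tau (ht z).
  have [Is zs] : I s /\ ht z < s by apply: htau; exists t.
  have [t0 _] := hI _ It; have [s0 _] := hI _ Is.
  have [st|/ltW ts] := leP s t.
    apply: (flow_unique s0 (hF _ Is) (flow_le st (hF _ It))).
    by rewrite /slab /= z0 ltW.
  apply: (flow_unique t0 (flow_le ts (hF _ Is)) (hF _ It)).
  by rewrite /slab /= z0 ltW.
exists Phi; split=> [x|t It z zt].
  by rewrite (PhiE _ _ It1) ?cat0E ?lexx ?(hI _ It1).1 // (hF _ It1).1.
have /andP[z0 zt'] := zt.
apply: (loc_iso_sub ((hF _ It).2 z _)); first by rewrite /slab /= z0 ltW.
move: (near_coord_lt zt'); apply: filterS => w wt w0.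
by rewrite /slab /= w0 ltW // (PhiE t) // w0.
Qed.

(** If the images coincide, an isometry [g] with [g z' = z] satisfies [Phi \o g = Phi] near [z'],
    hence on the half-ball of radius [ht z] around [z']. It contains the foot point of [z'], whose
    image is a boundary point, while [g] keeps this half-ball at positive height, where [Phi] avoids
    the boundary. *)
Lemma level_unique Phi :
  (forall z, 0 <= ht z -> loc_iso [set w | 0 <= ht w] Phi z) ->
  (forall x, Phi (cat 0 x) = iota x) ->
  forall z z', 0 <= ht z' -> ht z' < ht z -> Phi z <> Phi z'.
Proof.
move=> LPhi Phi0 z z' z'0 z'z e.
have z0 : 0 < ht z by apply: le_lt_trans z'z.
have [g [gi gz' H]] := loc_iso_transfer (LPhi _ (ltW z0)) (LPhi _ z'0) (ltW z0) z'0 e.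
pose D := [set w : 'rV[R]_m.+1 | 0 <= ht w /\ en (w - z') < ht z].
have gD w : en (w - z') < ht z -> 0 < ht (g w).
  rewrite -(affine_isometry_en _ _ gi) gz' => h.
  have := coord_near z (g w); rewrite ler_norml => /andP[h1 _].
  by rewrite -[ht (g w)](subrK (ht z)); lra.
have Dw : D (cat 0 (tl z')).
  split; first by rewrite cat0E.
  by rewrite enB en_cat_tl subr0 ger0_norm.
have : (Phi \o g) (cat 0 (tl z')) = Phi (cat 0 (tl z')).
  apply: (@unique_continuation _ _ _ _ _ FS D _ _ z' _ _ _ _ _ _ _ Dw).
  - by apply: cvx_half_open => u v s; exact: cvx_en.
  - by apply: fat_half_open => u; exact: near_ball.
  - move=> w [w0 wz]; apply: loc_iso_comp gi (LPhi _ (ltW (gD _ wz))) _.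
    by move: (near_ball wz); apply: filterS => v vz _; apply/ltW/gD.
  - move=> w [w0 wz]; apply: (loc_iso_sub (LPhi _ w0)).
    by near=> v => -[].
  - by split=> //; rewrite subrr en0.
  - by move: H; apply: filterS => w H [w0 wz]; apply: H => //; apply/ltW/gD.
rewrite Phi0 /= => e'.
have /gD gw := Dw.2.
apply: (@interior_not_bd _ _ _ _ _ FS [set w | 0 <= ht w] Phi (g (cat 0 (tl z')))).
- by move: (near_coord_gt gw); apply: filterS => w /ltW.
- by apply: LPhi; exact: ltW.
- by apply/iota_bd; exists (tl z').
Unshelve. all: by end_near. Qed.

(* A flow defined for all times would recur by compactness. *)
Lemma flow_bounded : ~ (forall t, 0 < t -> exists Phi, flow t Phi).
Proof.
move=> h; have [||Phi [Phi0 LPhi']] := @flow_union [set t | 0 < t].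
- by move=> t t0; split=> //; exact: h.
- by exists 1; exact: ltr01.
have LPhi z : 0 <= ht z -> loc_iso [set w | 0 <= ht w] Phi z.
  move=> z0; apply: (LPhi' (ht z + 1)); first by rewrite /=; lra.
  by rewrite z0; lra.
have [r r0 hr] := uniform_radius FS T_compact.
pose c n : T := Phi (cat n%:R 0).
have [q [_ cq]] : [set: T] `&` cluster (c @ \oo) !=set0.
  by apply: T_compact; exact: filterT.
have [p [Pp cp pE pr]] := hr q.
have r20 : 0 < r / 2 by rewrite divr_gt0.
have := fs_nbhs FS Pp cp (near_en (pcen p) r20); rewrite pE; set V := _ @` _ => nV.
have large (M : R) : exists2 n : nat, M < n%:R & V (c n).
  have [|_ [[n Mn <-] Vn]] := cq (c @` [set n : nat | M < n%:R]) V _ nV; last by exists n.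
  exists (Num.truncn (Num.max M 0)).+1 => // n /= Mn; exists n => //=.
  apply: le_lt_trans (_ : Num.max M 0 < _); first by rewrite le_max lexx.
  apply: lt_le_trans (truncnS_gt _) _; by rewrite ler_nat.
(* Two times [n] and [l] with [n > r] and [l > n + r] visit the same patch. The point [h' y'], less
   than [r] away from [cat n%:R 0], has positive height below [l] but the same image as
   [cat l%:R 0], against [level_unique]. *)
have [n rn [y [py /= yr] yE]] := large r.
have [l nl [y' [py' /= yr'] yE']] := large (n%:R + r).
have n0 : 0 <= ht (cat n%:R 0 : 'rV[R]_m.+1) by rewrite cat0E.
have [g [gi gn H]] := loc_iso_any FS (LPhi _ n0) n0 Pp py yE.
have [h' [h'i gh hg]] := affine_isometry_inv gi.
have zn : en (h' y' - cat n%:R 0) < r.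
  rewrite -(affine_isometry_en _ _ gi) hg gn.
  have := en_triangleB (pcen p) y' y; rewrite [en (pcen p - y)]enB; lra.
have := coord_near (cat n%:R 0) (h' y'); rewrite cat0E ler_norml => /andP[z1 z2].
have z0 : 0 <= ht (h' y') by lra.
have cvxH : cvx [set w : 'rV[R]_m.+1 | 0 <= ht w].
  by move=> u v s u0 v0 /andP[s0 s1]; rewrite /= ht_line htB; move: u0 v0 => /=; nra.
have fatH : fat [set w : 'rV[R]_m.+1 | 0 <= ht w].
  have -> : [set w : 'rV[R]_m.+1 | 0 <= ht w] = [set w | 0 <= ht w /\ setT w].
    by apply/seteqP; split=> [w|w []].
  by apply: fat_half_open => z _; exact: filterT.
have [||_ e] := @patch_continuation _ _ _ _ _ FS _ Phi p g (cat n%:R 0) cvxH fatH LPhi Pp gi n0 H (h' y').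
- exact: z0.
- by rewrite hg pr; lra.
have /(_ _ z0) := @level_unique Phi LPhi Phi0 (cat l%:R 0).
apply; first by rewrite cat0E; lra.
by rewrite e hg -[LHS]/(c l) yE'.
Unshelve. all: try typeclasses eauto. Qed.

(** Patches of uniform radius centred slightly below level [a] reach past it; they describe [Phi]
    below the level and so provide its values on it. *)
Lemma flow_close a : 0 < a -> (forall t, 0 < t < a -> exists Phi, flow t Phi) ->
  exists Phi, flow a Phi.
Proof.
move=> a0 h; have [||Phi [Phi0 LPhi']] := @flow_union [set t | 0 < t < a].
- by move=> t /andP[t0 ta]; split=> //; apply: h; rewrite t0.
- by exists (a / 2) => /=; lra.
pose U := [set w : 'rV[R]_m.+1 | 0 <= ht w < a].
have LPhi z : U z -> loc_iso U Phi z.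
  move=> /andP[z0 za]; apply: (loc_iso_sub (LPhi' ((ht z + a) / 2) _ z _)).
  - by rewrite /=; lra.
  - by rewrite z0; lra.
  - by near=> w => /andP[].
have cvxU : cvx U.
  move=> u v s /andP[u0 ua] /andP[v0 va] /andP[s0 s1].
  have uM : ht u <= Num.max (ht u) (ht v) by rewrite le_max lexx.
  have vM : ht v <= Num.max (ht u) (ht v) by rewrite le_max lexx orbT.
  have Ma : Num.max (ht u) (ht v) < a by rewrite gt_max ua.
  by rewrite /U /= ht_line htB; apply/andP; split; nra.
have fatU : fat U.
  move=> z N /andP[z0 za] nN.
  have zs : slab a z by rewrite /slab /= z0 ltW.
  have [y [Ny ya] ys] := fat_slab a0 zs (filterI nN (near_coord_lt za)).
  exists y => //; move: ys (near_coord_lt ya); apply: filterS2 => w /andP[w0 _] wa.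
  by rewrite /U /= w0.
have denseU w N : slab a w -> nbhs w N -> exists2 v, N v & U v.
  move=> /andP[w0 wa] nN; have [wa'|aw] := ltP (ht w) a.
    by exists w; [exact: nbhs_singleton|rewrite /U /= w0].
  have [|d d0 hd] := @near_line _ _ w 'e_ord0 0 N; first by rewrite scale0r addr0.
  pose s := Num.min (d / 2) (a / 2).
  have s0 : 0 < s by rewrite lt_min !divr_gt0.
  have sd : s <= d / 2 by rewrite ge_min lexx.
  have sa : s <= a / 2 by rewrite ge_min lexx orbT.
  exists (w + (- s) *: 'e_ord0).
    by apply: hd; rewrite subr0 normrN gtr0_norm //; lra.
  by rewrite /U /= ht_line ht_e0 mulr1; apply/andP; split; lra.
have [r r0 hr] := uniform_radius FS T_compact.
(* The level [t0] lies within [r / 4] of [a], so balls of radius [r] centred on it contain the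
   points of level [a] above their centres. *)
pose t0 := Num.max (a / 2) (a - r / 4).
have t0a : t0 < a by rewrite gt_max; apply/andP; split; lra.
have t00 : 0 <= t0 by rewrite le_max; apply/orP; left; lra.
have t0r : a - t0 <= r / 4.
  have : a - r / 4 <= t0 by rewrite le_max lexx orbT.
  by lra.
have Ut0 x : U (cat t0 x) by rewrite /U /= cat0E t00.
have /choice[q hq] : forall x, exists pg : @patch R T m.+1 * ('rV[R]_m.+1 -> 'rV[R]_m.+1),
   [/\ P pg.1, affine_isometry pg.2 &
     forall w, en (w - cat t0 x) < r ->
       (slab a w -> pdom pg.1 (pg.2 w)) /\ (U w -> Phi w = pmap pg.1 (pg.2 w))].
  move=> x; have [p [Pp cp pE pr]] := hr (Phi (cat t0 x)).
  have [g [gi gx H]] := loc_iso_any FS (LPhi _ (Ut0 x)) (Ut0 x) Pp cp pE.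
  exists (p, g); split=> //= w wr.
  have C v : U v -> en (v - cat t0 x) < r -> pdom p (g v) /\ Phi v = pmap p (g v).
    move=> Uv vr; apply: (patch_continuation FS cvxU fatU LPhi Pp gi (Ut0 x) H) => //.
    by rewrite -gx affine_isometry_en // pr.
  split=> [ws|Uw]; last exact: (C _ Uw wr).2.
  split; first by rewrite -gx affine_isometry_en // pr.
  rewrite leNgt; apply/negP => hw.
  have [v [vh vr] Uv] := denseU _ _ ws
    (filterI (affine_isometry_near gi (near_dotp hw)) (near_ball wr)).
  by have := (C _ Uv vr).1.2; rewrite leNgt vh.
(* On level [a] the patch over the point itself is used. Different patches give the same value
   there, as both extend [Phi] continuously into a Hausdorff space. *)
pose Phi' w := if ht w < a then Phi w else pmap (q (tl w)).1 ((q (tl w)).2 w).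
exists Phi'; split=> [x|w /andP[w0 wa]]; first by rewrite /Phi' cat0E a0.
have [wa'|aw] := ltP (ht w) a.
  apply: (loc_iso_sub (LPhi w _)); first by rewrite /U /= w0.
  move: (near_coord_lt wa'); apply: filterS => v va /andP[v0 _].
  by rewrite /U /= v0 va /Phi' va.
have {aw wa} wa : ht w = a by apply/eqP; rewrite eq_le wa.
have near_r (v : 'rV[R]_m.+1) : ht v = a -> en (v - cat t0 (tl v)) < r.
  by move=> va; rewrite en_cat_tl va ger0_norm ?subr_ge0 ?ltW //; lra.
have [Pp gi C] := hq (tl w).
exists (q (tl w)).1, (q (tl w)).2; split=> //.
move: (near_ball (near_r _ wa)); apply: filterS => v vr vs.
have [/(_ vs) vd vE] := C _ vr; split=> //.
have /andP[v0 va] := vs; rewrite /Phi'; case: ltP => va'.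
  by apply: vE; rewrite /U /= v0.
have {va va'} va : ht v = a by apply/eqP; rewrite eq_le va.
have [Pp' gi' C'] := hq (tl v).
have [/(_ vs) vd' _] := C' _ (near_r _ va).
apply: (fs_hausdorff FS) => A B nA nB.
have [u [[uA uB] [ur ur']] Uu] := denseU _ _ vs (filterI (filterI
  (affine_isometry_near gi' (fs_cont FS Pp' vd' nA))
  (affine_isometry_near gi (fs_cont FS Pp vd nB)))
  (filterI (near_ball vr) (near_ball (near_r _ va)))).
have us : slab a u by case/andP: Uu => u0 ua; rewrite /slab /= u0 ltW.
exists (Phi u); split.
  by have [/(_ us)/uA h1 /(_ Uu) ->] := C' _ ur'.
by have [/(_ us)/uB h1 /(_ Uu) ->] := C _ ur.
Unshelve. all: by end_near. Qed.

(** The set in question is open, since by [bd_orient] the face of a half-ball patch is tangent to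
    the whole level; it is closed, since avoiding the boundary is an open condition. *)
Lemma flow_top_bd a Phi x0 : 0 < a -> flow a Phi -> bd (Phi (cat a x0)) ->
  forall x, bd (Phi (cat a x)).
Proof.
move=> a0 [Phi0 LPhi] b0 x.
have st y : slab a (cat a y) by rewrite /slab /= cat0E lexx ltW.
have spread y : bd (Phi (cat a y)) -> \forall y' \near y, bd (Phi (cat a y')).
  move=> by_; have [p [g [Pp gi H]]] := LPhi _ (st y).
  have [||n0 gdot] := @bd_orient _ _ (cat a y) p g (-1) _ Pp gi (st y) H _ by_.
  - by rewrite sqrrN expr1n.
  - have /near_coord_gt : 0 < ht (cat a y) by rewrite cat0E.
    apply: filterS => w w0; rewrite cat0E mulN1r oppr_ge0 subr_le0 => wa.
    by rewrite /slab /= ltW.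
  move/near_cat: H; apply: filterS => y' /(_ (st y'))[gd ->].
  apply/(fs_bd FS Pp gd); split=> //; apply/eqP; rewrite -subr_eq0 gdot !cat0E.
  by rewrite subrr mulr0.
apply: (@cvx_continuation _ _ setT [set y | bd (Phi (cat a y))] x0 x) => //.
  by move: (spread _ b0); apply: filterS.
move=> y _ hy; suff /spread : bd (Phi (cat a y)) by apply: filterS.
apply: contrapT => nb.
have [y' [h _ /nbhs_singleton b]] := hy _ (near_cat (near_not_bd (LPhi _ (st y)) (st y) nb)).
by apply: h; [exact: st|exact: b].
Qed.

(** A patch at the common image point identifies the germs at the upper and the lower face. Both
    faces have the same inward normal there, so the identification [g] reverses heights; unique
    continuation gives [Phi \o g = Phi] on the slab. *)
Lemma flow_flip a Phi x0 x1 : 0 < a -> flow a Phi -> bd (Phi (cat a x0)) ->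
  Phi (cat a x0) = iota x1 ->
  exists al, [/\ affine_isometry al, al x1 = x0 &
    forall t x, 0 <= t <= a -> Phi (cat (a - t) (al x)) = Phi (cat t x)].
Proof.
move=> a0 F b0 e; have [Phi0 LPhi] := F.
have st y : slab a (cat a y) by rewrite /slab /= cat0E lexx ltW.
have s0 y : slab a (cat 0 y) by rewrite /slab /= cat0E lexx ltW.
have e' : Phi (cat a x0) = Phi (cat 0 x1) by rewrite Phi0.
have [p [g1 [Pp g1i H1]]] := LPhi _ (s0 x1).
have [g1d g1E] := nbhs_singleton H1 (s0 x1).
have [|g2 [g2i g2z H2]] := loc_iso_any FS (LPhi _ (st x0)) (st x0) Pp g1d.
  by rewrite e'.
have [|||n0 g1dot] := @bd_orient _ _ (cat 0 x1) p g1 1 _ Pp g1i (s0 x1) H1.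
- by rewrite expr1n.
- by move: (near_slab0 x1 a0); apply: filterS => w h; rewrite mul1r cat0E subr0.
- by rewrite -e'.
have [||_ g2dot] := @bd_orient _ _ (cat a x0) p g2 (-1) _ Pp g2i (st x0) H2 _ b0.
- by rewrite sqrrN expr1n.
- have /near_coord_gt : 0 < ht (cat a x0) by rewrite cat0E.
  apply: filterS => w w0; rewrite cat0E mulN1r oppr_ge0 subr_le0 => wa.
  by rewrite /slab /= ltW.
have [h [hi gh hg]] := affine_isometry_inv g2i.
pose g := h \o g1; have gi : affine_isometry g by exact: affine_isometry_comp.
have htg w : ht (g w) = a - ht w.
  have := g2dot (g w); rewrite /g /= hg g1dot !cat0E; lra.
have gz : g (cat 0 x1) = cat a x0 by rewrite /g /= -g2z gh.
have sg w : slab a w -> slab a (g w).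
  by rewrite /slab /= htg => /andP[w0 wa]; apply/andP; split; lra.
have PhiE : forall w, slab a w -> (Phi \o g) w = Phi w.
  apply: (unique_continuation FS (@cvx_slab _ _ a) (fat_slab a0) _ LPhi (s0 x1)).
    move=> w sw; apply: loc_iso_comp gi (LPhi _ (sg _ sw)) _.
    by near=> v; exact: sg.
  have : nbhs (g (cat 0 x1)) [set w | slab a w -> pdom p (g2 w) /\ Phi w = pmap p (g2 w)].
    by rewrite gz.
  move/(affine_isometry_near gi); move: H1; apply: filterS2 => w h1 h2 sw.
  by rewrite /= (h2 (sg _ sw)).2 (h1 sw).2 /g /= hg.
pose al x := tl (g (cat 0 x)).
(* The height difference of [g w] and [g (cat 0 (tl w))] already accounts for their whole distance,
   so by Pythagoras their horizontal parts coincide. *)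
have gE w : g w = cat (a - ht w) (al (tl w)).
  apply: eq_cat; rewrite ?cat0E ?tl_cat //.
  have := affine_isometry_en w (cat 0 (tl w)) gi => /(congr1 (fun u => u ^+ 2)).
  rewrite !en_split !tlB tl_cat subrr en0 expr0n addr0 !htB !htg cat0E.
  have -> : (a - ht w - (a - 0)) ^+ 2 = (ht w - 0) ^+ 2 by ring.
  move/eqP; rewrite -[eqbRHS]addr0 (inj_eq (addrI _)) sqrf_eq0 en_eq0 subr_eq0.
  by move/eqP.
exists al; split.
- apply: affine_isometry_of_en => x y; rewrite -(en_cat_cat 0 x) -(affine_isometry_en _ _ gi).
  by rewrite !gE !cat0E !tl_cat en_cat_cat.
- by rewrite /al gz tl_cat.
- move=> t x t01; have -> : cat (a - t) (al x) = g (cat t x) by rewrite gE cat0E tl_cat.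
  by apply: PhiE; rewrite /slab /= cat0E.
Unshelve. all: by end_near. Qed.

Theorem boundary_flip : exists al, [/\ affine_isometry al,
  forall f x, Gam f -> iota (al (f x)) = iota (al x),
  forall x, iota (al (al x)) = iota x & forall x, iota (al x) <> iota x].
Proof.
pose S := [set t | 0 < t /\ exists Phi, flow t Phi].
have [t0 t00 ft0] := flow_start.
have Sdown t s : S t -> 0 < s -> s <= t -> S s.
  by move=> [_ [Phi F]] s0 st; split=> //; exists Phi; exact: flow_le F.
have supS : has_sup S.
  split; first by exists t0.
  apply: contrapT => nub; apply: flow_bounded => t t1.
  have [s Ss ts] : exists2 s, S s & t < s.
    apply: contrapT => n; apply: nub; exists t => s Ss.
    by rewrite leNgt; apply/negP => ts; apply: n; exists s.
  by have [] := Sdown _ _ Ss t1 (ltW ts).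
set a := sup S.
have a0 : 0 < a.
  apply: (lt_le_trans t00).
  apply: (ub_le_sup supS.2).
  by split.
have [|Phi F] := flow_close a0.
  move=> t /andP[t1 ta]; have [s Ss] : exists2 s, S s & a - (a - t) < s.
    by apply: sup_adherent; rewrite ?subr_gt0.
  rewrite subKr => ts; by have [] := Sdown _ _ Ss t1 (ltW ts).
(* If the top level missed the boundary, the flow would extend beyond the supremum [a]. *)
have ball : forall x, bd (Phi (cat a x)).
  have [[x0 b0]|nb] := pselect (exists x, bd (Phi (cat a x))).
    exact: flow_top_bd b0.
  have [|t' at' ft'] := flow_extend a0 F; first by move=> x b; apply: nb; exists x.
  have : t' <= a by apply: (ub_le_sup supS.2); split=> //; exact: lt_trans at'.
  by rewrite leNgt at'.
have [x1 x1E] := (iota_bd _).1 (ball 0).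
have [al [ali al1 alE]] := flow_flip a0 F (ball 0) (esym x1E).
have Phi0 := F.1.
have al0 x : Phi (cat a (al x)) = iota x.
  by have := @alE 0 x; rewrite subr0 Phi0 lexx ltW //=; apply.
have ala x : iota (al x) = Phi (cat a x).
  by have := @alE a x; rewrite subrr Phi0 lexx ltW //=; apply.
exists al; split=> //.
- move=> f x Gf; rewrite !ala; apply: (flow_periodic a0 F Gf).
  by rewrite lexx ltW.
- by move=> x; rewrite ala al0.
(* For freeness: if [al] fixed the class of [x], the flip [be] based at [x] would exchange
   [(a / 2 + s, x)] and [(a / 2 - s, x)], so these two points would have the same image for small
   [s], contradicting injectivity near [(a / 2, x)]. *)
- move=> x; rewrite ala => e.
  have [be [bei be1 beE]] := flow_flip a0 F (ball x) e.
  have sa : slab a (cat (a / 2) x) by rewrite /slab /= cat0E; apply/andP; split; lra.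
  have [p [g [Pp gi]]] := F.2 _ sa.
  have -> : cat (a / 2) x = cat (a / 2) x + 0 *: 'e_ord0 by rewrite scale0r addr0.
  move=> /near_line[d d0 hd].
  pose s := Num.min (d / 2) (a / 2).
  have s0 : 0 < s by rewrite lt_min !divr_gt0.
  have sd : s <= d / 2 by rewrite ge_min lexx.
  have sa2 : s <= a / 2 by rewrite ge_min lexx orbT.
  have catE u : cat (a / 2) x + u *: 'e_ord0 = cat (a / 2 + u) x.
    by apply: eq_cat; rewrite ?ht_line ?cat0E ?ht_e0 ?mulr1 // tlD tlZ tl_e0 scaler0 addr0 !tl_cat.
  have [||d1 e1] := hd s.
  - by rewrite subr0 gtr0_norm //; lra.
  - by rewrite catE /slab /= cat0E; apply/andP; split; lra.
  have [||d2 e2] := hd (- s).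
  - by rewrite subr0 normrN gtr0_norm //; lra.
  - by rewrite catE /slab /= cat0E; apply/andP; split; lra.
  have : cat (a / 2) x + s *: 'e_ord0 = cat (a / 2) x + (- s) *: 'e_ord0.
    apply: (affine_isometry_inj gi); apply: (fs_inj FS Pp d1 d2).
    rewrite -e1 -e2 !catE -[RHS]beE; last by apply/andP; split; lra.
    by rewrite be1; congr (Phi (cat _ _)); lra.
  by rewrite !catE => /(congr1 ht); rewrite !cat0E; lra.
Qed.

End collar_flow.

(** * Free actions and orbit spaces *)

Section free_actions.
Context {R : realType} {k : nat}.
Local Notation E := 'rV[R]_k.
Implicit Types (x y z : E) (f g : E -> E) (Gam : set (E -> E)).

(** Freeness and proper discontinuity in one metric condition; [r] depends on the point. *)
Definition free_action Gam := isometry_group Gam /\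
  forall x, exists2 r, 0 < r & forall f, Gam f -> f <> id -> r <= en (f x - x).

Lemma compact_en_ball n (M : R) : compact [set v : 'rV[R]_n | en v <= M].
Proof.
apply: bounded_closed_compact.
  exists M; split; first exact: num_real.
  by move=> N MN v /= vM; apply: le_trans (normr_le_en v) _; apply: le_trans vM (ltW MN).
rewrite -[X in closed X]setCK; apply: open_closedC; rewrite openE => v /= /negP.
rewrite -ltNge => h; apply/nbhs_enP; exists (en v - M); first by rewrite subr_gt0.
by move=> w wv /= wM; have := en_triangleB w v 0; rewrite !subr0 enB; lra.
Qed.

(** * Discrete groups of isometries without fixed points *)

Section bieberbach_free.
Variable Gam : set (E -> E).
Hypothesis GI : isometry_group Gam.

Let iso f : Gam f -> affine_isometry f.
Proof. by case: GI => h _ _ _; exact: h. Qed.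

(** The affine frame formed by the origin and the basis vectors; the images of its points determine
    an affine map. *)
Let pt (i : 'I_k.+1) : E := if unlift ord0 i is Some j then 'e_j else 0.

Lemma affine_isometry_frame_bound f d M y : affine_isometry f ->
  (forall i, en (f (pt i) - pt i) <= d) -> en y <= M ->
  en (f y - y) <= d + k%:R * (M * (2 * d)).
Proof.
move=> /affine_isometryP[A [b [_ fE]]] hf yM.
have d0 : 0 <= d := le_trans (en_ge0 _) (hf ord0).
have b_ : en b <= d.
  by have := hf ord0; rewrite /pt unlift_none fE mul0mx add0r subr0.
have eE i : en ('e_i *m A - 'e_i) <= 2 * d.
  have := hf (lift ord0 i); rewrite /pt liftK fE => h.
  have -> : 'e_i *m A - 'e_i = 'e_i *m A + b - 'e_i - b.
    by move: ('e_i *m A) => u; apply/rowP => j; rewrite !mxE; ring.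
  apply: le_trans (en_triangle _ _) _; rewrite enN; lra.
have -> : f y - y = b + \sum_i y 0 i *: ('e_i *m A - 'e_i).
  rewrite fE addrAC addrC; congr (_ + _).
  under eq_bigr do rewrite scalerBr scalemxAl.
  by rewrite sumrB -mulmx_suml -row_sum_delta.
apply: le_trans (en_triangle _ _) _; apply: lerD => //.
have -> : k%:R * (M * (2 * d)) = \sum_(i < k) (M * (2 * d)).
  by rewrite sumr_const card_ord mulr_natl.
elim/big_ind2 : _ => [|u1 u2 v1 v2 h1 h2|i _]; first by rewrite en0.
  by apply: le_trans (en_triangle _ _) _; exact: lerD.
by rewrite enZ; apply: ler_pM; rewrite ?en_ge0 //; apply: le_trans (coord_le_en _ _) yM.
Qed.

(** The affine isometries that displace the frame by less than [d] form, as [d] tends to 0, a filter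
    that converges to the identity uniformly on bounded sets, hence in the compact-open topology.
    Discreteness thus becomes a condition on finitely many points. *)
Lemma discrete_frame : discrete_isometries Gam ->
  exists2 d, 0 < d & forall f, Gam f -> (forall i, en (f (pt i) - pt i) < d) -> f = id.
Proof.
move=> dG; have Gid : Gam id by case: GI.
have [_ [V nV VG]] := dG _ Gid.
pose F : set_system (E -> E) := filter_from [set d : R | 0 < d]
  (fun d => [set f | affine_isometry f /\ forall i, en (f (pt i) - pt i) < d]).
have FF : Filter F.
  apply: filter_from_filter; first by exists 1; exact: ltr01.
  move=> d d' d0 d'0; exists (Num.min d d'); first by rewrite /= lt_min d0.
  move=> f [fi h]; split; split=> // i; have := h i; rewrite lt_min => /andP[] //.
have : {compact-open, F --> (id : E -> E)}.
  apply/compact_open_cvgP => K O cK oO KO.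
  have [M M0 KM] : exists2 M, 0 < M & forall y, K y -> en y <= M.
    have [M [_ hM]] := compact_bounded cK.
    exists (k.+1%:R * (`|M| + 1)); first by rewrite mulr_gt0 // ltr_wpDl.
    move=> y Ky; apply: le_trans (en_le_normr y) _; rewrite ler_pM2l //.
    by apply: hM => //; rewrite (le_lt_trans (ler_norm _)) // ltrDl.
  have : \forall e \near (0 : R)^'+, K `<=` [set y | forall z, en (z - y) < e -> O z].
    move: cK => /compact_near_coveringP; apply => y Ky.
    have Oy : nbhs y O by apply: open_nbhs_nbhs; split=> //; apply: KO; exists y.
    have /nbhs_enP[r r0 hr] := Oy; have r20 : 0 < r / 2 by rewrite divr_gt0.
    exists ([set z | en (z - y) < r / 2], [set e | 0 < e < r / 2]).
      split=> /=; first exact: near_en.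
      near=> e; apply/andP; split; first by near: e; exact: nbhs_right_gt.
      by near: e; exact: nbhs_right_lt.
    move=> [z e] /= [zy /andP[e0 er]] w wz; apply: hr.
    by have := en_triangleB z w y; lra.
  move=> hK; near (0 : R)^'+ => e.
  have e0 : 0 < e by near: e; exact: nbhs_right_gt.
  have hKe : K `<=` [set y | forall z, en (z - y) < e -> O z] by near: e.
  (* By [affine_isometry_frame_bound], a displacement of the frame below [d] moves the points of [K]
     by at most [d * C]. *)
  pose C := 1 + k%:R * (M * 2).
  have C0 : 0 < C by rewrite ltr_pwDl // mulr_ge0 // mulr_ge0 // ltW.
  exists (e / 2 / C); first by rewrite /= !divr_gt0.
  move=> f [fi hf] _ [y Ky <-]; apply: (hKe y Ky).
  apply: (le_lt_trans (affine_isometry_frame_bound fi (fun i => ltW (hf i)) (KM _ Ky))).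
  have -> : e / 2 / C + k%:R * (M * (2 * (e / 2 / C))) = e / 2 / C * C by rewrite /C; ring.
  by rewrite divfK ?gt_eqF //; lra.
move=> /(_ _ nV)[d d0 hd]; exists d => // f Gf hf.
have : (V `&` Gam) f by split=> //; apply: hd; split=> //; exact: iso.
by rewrite VG.
Unshelve. all: by end_near. Qed.

(** If the displacements at [x] had no positive lower bound, elements with small displacement would
    have their frames in a bounded set, so the frames would cluster; but elements with close frames
    are equal. *)
Lemma discrete_free_action : discrete_isometries Gam ->
  (forall f, Gam f -> f <> id -> forall x, f x <> x) -> free_action Gam.
Proof.
move=> dG fG; split=> // x; apply: contrapT => nr.
have small r : 0 < r -> exists f, [/\ Gam f, f <> id & en (f x - x) < r].
  move=> r0; apply: contrapT => h; apply: nr; exists r => // f Gf fid.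
  by rewrite leNgt; apply/negP => fr; apply: h; exists f.
have [d d0 hd] := discrete_frame dG.
have close f g : Gam f -> Gam g -> (forall i, en (f (pt i) - g (pt i)) < d) -> f = g.
  move=> Gf Gg h; have [_ _ Gc Gi] := GI.
  have [g' [Gg' gg' g'g]] := Gi _ Gg.
  have e : g' \o f = id.
    apply: hd; first exact: Gc.
    by move=> i; rewrite /= -{2}(gg' (pt i)) affine_isometry_en //; exact: iso.
  by apply/funext => y; have := congr1 (fun h => g (h y)) e; rewrite /= g'g.
(* All images of the frame are collected in a single vector, so that compactness of a ball
   applies. *)
pose v f : 'rV[R]_(k.+1 * k) := mxvec (\matrix_(i, j) f (pt i) 0 j).
have vE f g i : en (f (pt i) - g (pt i)) <= k.+1%:R * en (v f - v g).
  apply: le_trans (en_le_normr _) _; rewrite ler_pM2l //.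
  rewrite [leLHS]mx_normrE; apply/bigmax_leP; split; first exact: en_ge0.
  move=> [i' j] _ /=; rewrite ord1.
  have := coord_le_en (v f - v g) (mxvec_index i j).
  by rewrite !mxE !mxvecE !mxE.
pose F : set_system 'rV[R]_(k.+1 * k) := filter_from [set r : R | 0 < r]
  (fun r => v @` [set f | [/\ Gam f, f <> id & en (f x - x) < r]]).
have FF : ProperFilter F.
  apply: filter_from_proper; last first.
    by move=> r /small[f hf]; exists (v f), f.
  apply: filter_from_filter; first by exists 1; exact: ltr01.
  move=> r r' r0 r'0; exists (Num.min r r'); first by rewrite /= lt_min r0.
  by move=> _ [f [Gf fid +] <-]; rewrite lt_min => /andP[h h']; split; exists f.
pose M := (k.+1 * k).+1%N%:R * (2 * en x + 2).
have [w [_ wF]] : [set u | en u <= M] `&` cluster F !=set0.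
  apply: compact_en_ball; exists 1; first exact: ltr01.
  move=> _ [f [Gf _ fx] <-] /=.
  have fpt i j : `|f (pt i) 0 j| <= 2 * en x + 2.
    apply: le_trans (coord_le_en _ _) _.
    have pt1 : en (pt i) <= 1.
      by rewrite /pt; case: unliftP => [i' _|_]; rewrite ?en_delta ?en0.
    have := en_triangleB (f x) (f (pt i)) 0; rewrite !subr0 (affine_isometry_en _ _ (iso Gf)).
    have := en_triangleB x (f x) 0; rewrite !subr0.
    have := en_triangleB 0 (pt i) x; rewrite subr0 sub0r enN; lra.
  apply: le_trans (en_le_normr _) _; rewrite /M ler_pM2l //.
  rewrite [leLHS]mx_normrE; apply/bigmax_leP.
  have L0 : 0 <= 2 * en x + 2 by have := en_ge0 x; lra.
  split=> [|[i' j] _ /=]; first exact: L0.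
  rewrite ord1; case/mxvec_indexP: j => i j; rewrite mxvecE mxE; exact: fpt.
pose rho := d / (k.+1%:R * 2).
have rho0 : 0 < rho by rewrite divr_gt0 // mulr_gt0.
have pick r : 0 < r -> exists f, [/\ Gam f, f <> id, en (f x - x) < r & en (v f - w) < rho].
  move=> r0; have Fr : F (v @` [set f | [/\ Gam f, f <> id & en (f x - x) < r]]) by exists r.
  have [_ [[f [Gf fid fr] <-] fw]] := wF _ _ Fr (near_en w rho0).
  by exists f.
have [f1 [Gf1 f1id _ f1w]] := pick _ ltr01.
(* The second element is chosen to displace [x] less than [f1] does, which is possible as [f1] has
   no fixed point. Its frame is also near [w], so it must be [f1]. *)
have r1 : 0 < en (f1 x - x).
  by rewrite en_gt0 // subr_eq0; apply/eqP; exact: fG.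
have [f2 [Gf2 _ f2r f2w]] := pick _ r1.
have e : f1 = f2.
  apply: close => // i; apply: le_lt_trans (vE f1 f2 i) _.
  have -> : d = k.+1%:R * (rho * 2) by rewrite /rho; field; rewrite addrC natr1.
  rewrite ltr_pM2l //; have := en_triangleB w (v f1) (v f2).
  by rewrite [en (w - _)]enB; lra.
by rewrite e ltxx in f2r.
Qed.

End bieberbach_free.

(** * Quotients by free actions *)

Section orbit_spaces.
Variable Gam : set (E -> E).
Hypothesis FG : free_action Gam.
Local Notation pi := (orbit_proj Gam).

Lemma free_iso f : Gam f -> affine_isometry f.
Proof. by case: FG => -[h _ _ _] _; exact: h. Qed.

Lemma free_inv f : Gam f -> exists g, [/\ Gam g, cancel f g & cancel g f].
Proof. by case: FG => -[_ _ _ h] _; exact: h. Qed.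

Lemma free_comp f g : Gam f -> Gam g -> Gam (f \o g).
Proof. by case: FG => -[_ _ h _] _; exact: h. Qed.

Lemma free_id : Gam id.
Proof. by case: FG => -[]. Qed.

Lemma piP x y : pi x = pi y <-> exists2 f, Gam f & y = f x.
Proof.
split=> [/eqmodP/asboolP e|[f Gf ->]].
  have : orbit_of Gam y y by exists id => //; exact: free_id.
  by rewrite -e => -[f Gf <-]; exists f.
apply/eqmodP/asboolP/seteqP; split=> _ [g Gg <-].
  have [h [Gh fh _]] := free_inv Gf; exists (g \o h); first exact: free_comp.
  by rewrite /= fh.
by exists (g \o f) => //; exact: free_comp.
Qed.

Lemma pi_Gam f x : Gam f -> pi (f x) = pi x.
Proof. by move=> Gf; apply/esym/piP; exists f. Qed.

Lemma pi_surj q : exists x, pi x = q.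
Proof. by exists (repr q); exact: reprK. Qed.

Lemma pi_cont : continuous pi.
Proof. exact: pi_continuous. Qed.

Lemma pi_open W : open W -> open (pi @` W).
Proof.
move=> oW; suff : open (pi @^-1` (pi @` W)) by [].
rewrite openE => y [w Ww] /piP[f Gf ->]; have [g [Gg fg gf]] := free_inv Gf.
have : nbhs (g (f w)) W by rewrite fg; exact: open_nbhs_nbhs.
move/(affine_isometry_near (free_iso Gg)); apply: filterS => z Wz.
by exists (g z) => //; exact: pi_Gam.
Qed.

Lemma pi_nbhs x N : nbhs x N -> nbhs (pi x) (pi @` N).
Proof.
move=> nN; apply: (@filterS _ _ _ (pi @` N^°)).
  by apply: image_subset; exact: interior_subset.
by apply: open_nbhs_nbhs; split; [apply: pi_open; exact: open_interior|exists x].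
Qed.

Lemma pi_inj_ball x : exists2 r, 0 < r & forall y z,
  en (y - x) < r -> en (z - x) < r -> pi y = pi z -> y = z.
Proof.
have [r r0 hr] := FG.2 x; exists (r / 3); first by rewrite divr_gt0.
move=> y z yx zx /piP[f Gf zE]; have [fid|/(hr _ Gf) h] := pselect (f = id).
  by rewrite zE fid.
have := en_triangleB (f y) (f x) x.
by rewrite (affine_isometry_en _ _ (free_iso Gf)) -zE [en (x - y)]enB => ?; exfalso; lra.
Qed.

(** Two points of the orbit within [r / 2] of [y] would be less than [r] apart, hence equal. So
    either no orbit point comes that close, or exactly one does, and its distance to [y] is the
    bound. *)
Lemma orbit_separated x y : pi x <> pi y ->
  exists2 r, 0 < r & forall f, Gam f -> r <= en (f x - y).
Proof.
move=> xy; have [r r0 hr] := FG.2 x.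
have [[f0 Gf0 h0]|h] := pselect (exists2 f, Gam f & en (f x - y) < r / 2); last first.
  exists (r / 2); first by rewrite divr_gt0.
  by move=> f Gf; rewrite leNgt; apply/negP => fr; apply: h; exists f.
exists (en (f0 x - y)).
  by rewrite en_gt0 // subr_eq0; apply/eqP => e; apply: xy; rewrite -e pi_Gam.
move=> f Gf; rewrite leNgt; apply/negP => fr.
have [g [Gg gf fg]] := free_inv Gf0.
have [gid|/(hr _ (free_comp Gg Gf))] := pselect (g \o f = id).
  have : f x = f0 x by have := congr1 (fun h => f0 (h x)) gid; rewrite /= fg.
  by move=> e; rewrite e ltxx in fr.
rewrite /= -{2}(gf x) (affine_isometry_en _ _ (free_iso Gg)).
have := en_triangleB y (f x) (f0 x); rewrite [en (y - _)]enB; lra.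
Qed.

Lemma orbit_space_hausdorff : hausdorff_space (orbit_space Gam).
Proof.
move=> p q; have [x <-] := pi_surj p; have [y <-] := pi_surj q => h.
apply: contrapT => /orbit_separated[r r0 hr].
have r2 : 0 < r / 2 by rewrite divr_gt0.
have [_ [[x' x'x <-] [y' /= y'y /esym/piP[f Gf yE]]]] :=
  h _ _ (pi_nbhs (near_en x r2)) (pi_nbhs (near_en y r2)).
have := hr f Gf; have := en_triangleB (f x') (f x) y.
rewrite (affine_isometry_en _ _ (free_iso Gf)) -yE [en (x - x')]enB; move: x'x y'y => /=; lra.
Qed.

Definition orbit_patches : set (@patch R (orbit_space Gam) k) :=
  [set p | [/\ pmap p = pi, pnor p = 0, poff p <= 0 &
    forall y z, pdom p y -> pdom p z -> pi y = pi z -> y = z]].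

Lemma orbit_flat_space : flat_space orbit_patches set0.
Proof.
have pdomE p y : orbit_patches p -> (pdom p y <-> en (y - pcen p) < prad p).
  by move=> [_ n0 o0 _]; rewrite /pdom n0 /= dotp0r; split=> [[]|].
have opdom p y : orbit_patches p -> pdom p y -> nbhs y (pdom p).
  move=> Pp /(pdomE _ _ Pp) h; apply/nbhs_enP.
  exists (prad p - en (y - pcen p)); first by rewrite subr_gt0.
  move=> z zy; apply/(pdomE _ _ Pp).
  by have := en_triangleB y z (pcen p); lra.
split.
- exact: orbit_space_hausdorff.
- move=> q; have [x <-] := pi_surj q; have [r r0 hr] := pi_inj_ball x.
  exists (Patch x r 0 0 pi); split=> //; last by split; rewrite /= ?subrr ?en0 ?dotp0r.
  split=> //= y z [/= yx _] [/= zx _]; exact: hr.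
- move=> p c r Pp cd r0 cr; have [-> -> o0 inj] := Pp; split=> //= y z [/= yc y0] [/= zc z0].
  apply: inj; apply/(pdomE _ _ Pp).
    by have := en_triangleB c y (pcen p); lra.
  by have := en_triangleB c z (pcen p); lra.
- by move=> p y y' [-> _ _ inj] /inj h /h.
- move=> p y N [-> _ _ _] _ /pi_cont h; near=> z => _; near: z; exact: h.
- move=> p y N Pp py nN; have [-> _ _ _] := Pp; apply: pi_nbhs.
  by apply: filterI => //; exact: opdom.
- move=> p p' y y' Pp Pp' py py'; have [-> _ _ _] := Pp; have [-> _ _ _] := Pp'.
  move=> /piP[f Gf yE]; exists f; split; [exact: free_iso|by []|].
  have := affine_isometry_near (free_iso Gf); rewrite yE in py'.
  move=> /(_ _ _ (opdom _ _ Pp' py')); apply: filterS => z pz _; split=> //.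
  by rewrite pi_Gam.
- by move=> p y [_ -> _ _] _; split=> //; rewrite eqxx => -[].
- by move=> p [_ -> _ _]; rewrite eqxx.
Unshelve. all: by end_near. Qed.

Lemma pi_loc_iso x : loc_iso (P := orbit_patches) setT pi x.
Proof.
have [r r0 hr] := pi_inj_ball x; exists (Patch x r 0 0 pi), id; split.
- by split=> //= y z [/= yx _] [/= zx _]; exact: hr.
- exact: affine_isometry_id.
- move: (near_en x r0); apply: filterS => y yx _; split=> //.
  by split; rewrite //= dotp0r.
Qed.

(** Some [f] in the group agrees with [d] at 0. Near 0 both maps take values in a ball on which the
    projection is injective, so they agree there and by rigidity everywhere. *)
Lemma deck_in_group d : affine_isometry d -> (forall x, pi (d x) = pi x) -> Gam d.
Proof.
move=> di dpi; have /piP[f Gf fE] := esym (dpi 0).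
suff -> : d = f by [].
have [r r0 hr] := pi_inj_ball (d 0).
apply: (affine_isometry_eq (z := 0)) => //; first exact: free_iso.
move: (near_en (0 : E) r0); apply: filterS => y; rewrite subr0 => y0.
apply: hr; last by rewrite dpi pi_Gam.
  by rewrite affine_isometry_en // subr0.
by rewrite fE affine_isometry_en ?subr0 //; exact: free_iso.
Qed.

(** The images of the balls of integer radius exhaust the compact quotient, so one of them is
    everything. *)
Lemma fundamental_compact : compact [set: orbit_space Gam] ->
  exists2 K : set E, compact K & forall x, exists2 f, Gam f & K (f x).
Proof.
move=> /compact_near_coveringP cN.
have : \forall n \near \oo, [set: orbit_space Gam] `<=`
    [set q | exists2 x, pi x = q & en x <= n%:R].
  apply: cN => q _; have [x <-] := pi_surj q.
  have := pi_nbhs (near_en x ltr01) => nx.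
  exists (pi @` [set y | en (y - x) < 1], [set n : nat | en x + 1 <= n%:R]).
    split=> //=; exists (Num.truncn (en x + 1)).+1 => // n /= hn.
    apply: le_trans (ltW (truncnS_gt _)) _; by rewrite ler_nat.
  move=> [_ n] /= [[y yx <-] xn]; exists y => //.
  by have := en_triangleB x y 0; rewrite !subr0; lra.
move=> [n _ /(_ n (leqnn n)) hn].
exists [set x | en x <= n%:R]; first exact: compact_en_ball.
move=> x; have [y /esym/piP[f Gf ->] yn] := hn (pi x) I.
by exists f.
Qed.

End orbit_spaces.

End free_actions.

(** * Differential calculus *)

Section differential_calculus.
Context {R : realType}.

Section scalar_functions.
Context {k : nat}.
Local Notation E := 'rV[R]_k.
Implicit Types (x y v w : E) (f g : E -> R).

Lemma nbhs_enI x (P Q : set E) : nbhs x P -> nbhs x Q ->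
  exists2 r, 0 < r & forall y, en (y - x) < r -> P y /\ Q y.
Proof. by move=> nP nQ; apply/nbhs_enP; exact: filterI. Qed.

Lemma addrKl x w : x + w - x = w.
Proof. by rewrite addrAC subrr add0r. Qed.

Lemma derive_lin f x a v w : differentiable f x ->
  'D_(a *: v + w) f x = a * 'D_v f x + 'D_w f x.
Proof. by move=> df; rewrite !deriveE // linearP. Qed.

Lemma deriveN_dir f x v : differentiable f x -> 'D_(- v) f x = - 'D_v f x.
Proof. by move=> df; rewrite !deriveE // linearN. Qed.

Lemma deriveZ_dir f x a v : differentiable f x -> 'D_(a *: v) f x = a * 'D_v f x.
Proof. by move=> df; rewrite !deriveE // linearZ. Qed.

Lemma derive_coordE f x v : differentiable f x ->
  'D_v f x = \sum_i v 0 i * 'D_'e_i f x.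
Proof.
move=> df; rewrite {1}(row_sum_delta v) deriveE // linear_sum.
by apply: eq_bigr => i _; rewrite linearZ deriveE.
Qed.

Lemma derive_first_order f x e : differentiable f x -> 0 < e ->
  \forall y \near x, `|f y - f x - 'D_(y - x) f x| <= e * en (y - x).
Proof.
move=> df e0; have /diff_locallyP[_ /eqaddoP/(_ _ e0)/nbhs_enP[r r0 hr]] := df.
apply/nbhs_enP; exists r => // y yx; have := hr (y - x); rewrite subr0 => /(_ yx).
rewrite !fctE /= subrK => h; rewrite -addrA -opprD deriveE //.
apply: le_trans h _.
by apply: ler_wpM2l; [exact: ltW|exact: normr_le_en].
Qed.

Lemma is_derive_line f x v s : differentiable f (x + s *: v) ->
  is_derive s (1 : R) (fun t : R => f (x + t *: v)) ('D_v f (x + s *: v)).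
Proof.
move=> df; have dfv : derivable f (x + s *: v) v by exact: diff_derivable.
have e : (fun h : R => h^-1 *: (((fun t => f (x + t *: v)) \o shift s) (h *: (1 : R)) -
    f (x + s *: v))) = (fun h => h^-1 *: ((f \o shift (x + s *: v)) (h *: v) - f (x + s *: v))).
  apply/funext => h; congr (_ *: (f _ - _)); rewrite /= [h *: 1]mulr1 scalerDl.
  by rewrite addrCA.
by split; rewrite /derivable /derive e.
Qed.

Lemma mean_value_line2 f x x' v t : 0 < t ->
  (forall s, 0 <= s <= t -> differentiable f (x + s *: v)) ->
  (forall s, 0 <= s <= t -> differentiable f (x' + s *: v)) ->
  exists2 s, 0 < s < t & (f (x' + t *: v) - f x') - (f (x + t *: v) - f x) =
    t * ('D_v f (x' + s *: v) - 'D_v f (x + s *: v)).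
Proof.
move=> t0 df df'.
pose phi u := f (x' + u *: v) - f (x + u *: v).
have dphi s : 0 <= s <= t ->
    is_derive s (1 : R) phi ('D_v f (x' + s *: v) - 'D_v f (x + s *: v)).
  move=> st; have h := is_derive_line (df _ st); have h' := is_derive_line (df' _ st).
  exact: is_deriveB.
have [|||s st e] := @MVT R phi (fun s => 'D_v f (x' + s *: v) - 'D_v f (x + s *: v)) 0 t.
- by [].
- by move=> s; rewrite in_itv /= => /andP[s0 st]; apply: dphi; rewrite !ltW.
- apply: continuous_in_subspaceT => s; rewrite inE /= in_itv /= => s0t.
  have [dl _] := dphi _ s0t.
  exact: (differentiable_continuous (iffLR (derivable1_diffP _ _) dl)).
exists s; first by move: st; rewrite in_itv.
by move: e; rewrite /phi !scale0r !addr0 subr0 mulrC => <-; ring.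
Qed.

Lemma mean_value_line f x v t : 0 < t ->
  (forall s, 0 <= s <= t -> differentiable f (x + s *: v)) ->
  exists2 s, 0 < s < t & f (x + t *: v) - f x = t * 'D_v f (x + s *: v).
Proof.
move=> t0 df.
have [|||s st e] := @MVT R (fun u => f (x + u *: v)) (fun s => 'D_v f (x + s *: v)) 0 t.
- by [].
- move=> s; rewrite in_itv /= => /andP[s0 st]; apply: is_derive_line; apply: df.
  by rewrite !ltW.
- apply: continuous_in_subspaceT => s; rewrite inE /= in_itv /= => s0t.
  have [dl _] := is_derive_line (df _ s0t).
  exact: (differentiable_continuous (iffLR (derivable1_diffP _ _) dl)).
exists s; first by move: st; rewrite in_itv.
by move: e; rewrite /= scale0r addr0 subr0 mulrC.
Qed.

(** Of each direction and its opposite, one points into [S], and derivatives are odd in the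
    direction. At points of a half-space, derivatives therefore do not depend on the chosen smooth
    extension. *)
Lemma derive_eq_side (S : set E) f g x : differentiable f x -> differentiable g x ->
  (forall v, exists2 s : R, s ^+ 2 = 1 & \forall t \near (0 : R)^'+, S (x + (t * s) *: v)) ->
  S x -> (\forall y \near x, S y -> f y = g y) -> forall v, 'D_v f x = 'D_v g x.
Proof.
move=> df dg hS Sx fg v.
have fgx := nbhs_singleton fg Sx.
have dh : differentiable (f - g) x by exact: differentiableB.
suff : 'D_v (f - g) x = 0.
  rewrite (deriveE v dh) (diffB df dg) /= (deriveE v df) (deriveE v dg) => /eqP.
  by rewrite subr_eq0 => /eqP.
apply/eqP; rewrite -normr_le0; apply/ler_addgt0Pl => e e0; rewrite addr0.
have L0 := en_ge0 v.
have e' : 0 < e / (en v + 1) by rewrite divr_gt0 // ltr_wpDl.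
have [s s1 hs] := hS v.
have sn : `|s| = 1 by apply/eqP; rewrite -(@eqrXn2 _ 2) // real_normK ?num_real // s1 expr1n.
have [r r0 hr] := nbhs_enI (derive_first_order dh e') fg.
near (0 : R)^'+ => t.
have t0 : 0 < t by near: t; exact: nbhs_right_gt.
have tr : t < r / (en v + 1).
  by near: t; apply: nbhs_right_lt; rewrite divr_gt0 // ltr_wpDl.
have St : S (x + (t * s) *: v) by near: t.
have nts : `|t * s| = t by rewrite normrM sn mulr1 gtr0_norm.
have [|h1 h2] := hr (x + (t * s) *: v).
  rewrite addrAC subrr add0r enZ nts.
  move: tr; rewrite ltr_pdivlMr ?ltr_wpDl // mulrDr mulr1; lra.
move: h1; rewrite !fctE /= h2 // fgx !subrr sub0r normrN addrAC subrr add0r.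
rewrite deriveZ_dir // normrM nts enZ nts mulrCA ler_pM2l // => h.
apply: le_trans h _; rewrite mulrAC ler_pdivrMr ?ltr_wpDl // ler_wpM2l ?ltW //; lra.
Unshelve. all: by end_near. Qed.

Lemma norm_combine (a b c d g e1 e2 : R) : `|d - a - (b + c)| <= e1 ->
  `|g - a - c| <= e2 -> `|d - g - b| <= e1 + e2.
Proof.
move=> h1 h2; have -> : d - g - b = (d - a - (b + c)) - (g - a - c) by ring.
by apply: le_trans (ler_normB _ _) _; exact: lerD.
Qed.

(** The mean value theorem in direction [u] turns the second difference into a first difference of
    ['D_u f], which the expansion at [x] evaluates. *)
Lemma second_difference f x (u v : E) e : 0 < e ->
  (\forall y \near x, differentiable f y) -> differentiable ('D_u f) x ->
  \forall t \near (0 : R)^'+,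
   `|f (x + t *: v + t *: u) - f (x + t *: v) - (f (x + t *: u) - f x)
     - t * (t * 'D_v ('D_u f) x)| <= t * (t * e).
Proof.
(* The two points of evaluation are within [t (|u| + |v|)] and [t |u|] of [x]; [M] bounds the sum of
   these factors, and the 1 makes it positive. *)
move=> e0 df dg; pose M := 2 * en u + en v + 1.
have Lu := en_ge0 u; have Lv := en_ge0 v.
have M0 : 0 < M by rewrite /M; lra.
have e' : 0 < e / M by rewrite divr_gt0.
have [r r0 hr] := nbhs_enI df (derive_first_order dg e').
near=> t.
have t0 : 0 < t by near: t; exact: nbhs_right_gt.
have tr : t < r / M by near: t; apply: nbhs_right_lt; rewrite divr_gt0.
have {tr}tr : t * M < r by rewrite -ltr_pdivlMr.
have small a b : 0 <= a <= t -> 0 <= b <= t -> en (a *: v + b *: u) <= t * (en u + en v).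
  move=> /andP[a0 at_] /andP[b0 bt].
  apply: le_trans (en_triangle _ _) _; rewrite !enZ !ger0_norm //; nra.
have near_uv a b : 0 <= a <= t -> 0 <= b <= t -> en (x + a *: v + b *: u - x) < r.
  move=> ha hb; rewrite -(addrA x) addrKl.
  by apply: le_lt_trans (small _ _ ha hb) _; move: tr; rewrite /M; nra.
have t00 : 0 <= (0 : R) <= t by rewrite lexx ltW.
have ttt : 0 <= t <= t by rewrite lexx ltW.
have [||s /andP[s0 st] ->] := @mean_value_line2 f x (x + t *: v) u t t0.
- move=> s hs; have := (hr _ (near_uv 0 s t00 hs)).1.
  by rewrite scale0r addr0.
- by move=> s hs; exact: (hr _ (near_uv t s ttt hs)).1.
have hs : 0 <= s <= t by rewrite !ltW.
have h1 := (hr _ (near_uv t s ttt hs)).2.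
have := (hr _ (near_uv 0 s t00 hs)).2; rewrite scale0r addr0 => h2.
have e1 : x + t *: v + s *: u - x = t *: v + s *: u by rewrite -(addrA x) addrKl.
have e2 : x + s *: u - x = s *: u by rewrite addrKl.
rewrite e1 derive_lin // in h1; rewrite e2 in h2.
have n1 := small _ _ ttt hs; have := small _ _ t00 hs; rewrite scale0r add0r => n2.
rewrite -mulrBr normrM gtr0_norm // ler_pM2l //.
apply: le_trans (norm_combine h1 h2) _.
have n3 : en (s *: u) <= t * en u by rewrite enZ gtr0_norm // ler_wpM2r // ltW.
have -> : t * e = e / M * (t * M) by field; rewrite gt_eqF.
rewrite -mulrDr ler_pM2l // /M; nra.
Unshelve. all: by end_near. Qed.

(* Young's theorem: both iterated derivatives are the limit of the same
   second difference quotient. *)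
Lemma derive_sym f x u v : (\forall y \near x, differentiable f y) ->
  differentiable ('D_u f) x -> differentiable ('D_v f) x ->
  'D_v ('D_u f) x = 'D_u ('D_v f) x.
Proof.
move=> df du dv; apply/eqP; rewrite -subr_eq0 -normr_le0.
apply/ler_addgt0Pl => e e0; rewrite addr0.
have e2 : 0 < e / 2 by rewrite divr_gt0.
have H1 := @second_difference f x u v _ e2 df du.
have H2 := @second_difference f x v u _ e2 df dv.
have [t [t0 [h1 h2]]] := filter_ex (filterI (nbhs_right_gt (0 : R)) (filterI H1 H2)).
move: h2; rewrite [x + t *: u + _]addrAC => h2.
have tt0 : 0 < t * t by rewrite mulr_gt0.
rewrite -(ler_pM2l tt0) -{1}(gtr0_norm tt0) -normrM.
have aux (a b c d p q E1 E2 : R) : `|a - b - (c - d) - t * (t * p)| <= E1 ->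
    `|a - c - (b - d) - t * (t * q)| <= E2 -> `|t * t * (p - q)| <= E1 + E2.
  move=> k1 k2; have -> : t * t * (p - q) =
    (a - c - (b - d) - t * (t * q)) - (a - b - (c - d) - t * (t * p)) by ring.
  by apply: le_trans (ler_normB _ _) _; rewrite [leRHS]addrC; exact: lerD.
apply: le_trans (aux _ _ _ _ _ _ _ _ h1 h2) _.
by rewrite -!mulrA -mulrDr -mulrDr -splitr.
Qed.

Lemma differentiable_bigsum (I : Type) (s : seq I) (F : I -> E -> R) x :
  (forall i, differentiable (F i) x) ->
  differentiable (fun y => \sum_(i <- s) F i y) x.
Proof.
move=> dF; elim: s => [|i s IH].
  by rewrite (_ : (fun _ => _) = cst 0) //; apply/funext => y; rewrite big_nil.
rewrite (_ : (fun _ => _) = F i + (fun y => \sum_(i <- s) F i y)).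
  exact: differentiableD.
by apply/funext => y; rewrite big_cons.
Qed.

Lemma differentiable_bigprod (I : Type) (s : seq I) (F : I -> E -> R) x :
  (forall i, differentiable (F i) x) ->
  differentiable (fun y => \prod_(i <- s) F i y) x.
Proof.
move=> dF; elim: s => [|i s IH].
  by rewrite (_ : (fun _ => _) = cst 1) //; apply/funext => y; rewrite big_nil.
rewrite (_ : (fun _ => _) = F i * (fun y => \prod_(i <- s) F i y)).
  exact: differentiableM.
by apply/funext => y; rewrite big_cons.
Qed.

Lemma differentiable_det n (M : E -> 'M[R]_n) x :
  (forall i j, differentiable (fun y => M y i j) x) ->
  differentiable (fun y => \det (M y)) x.
Proof.
move=> dM; apply: differentiable_bigsum => s; apply: differentiableM => //.
exact: differentiable_bigprod.
Qed.

Lemma derive_sum_mul n (F G : 'I_n -> E -> R) x v :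
  (forall i, differentiable (F i) x) -> (forall i, differentiable (G i) x) ->
  'D_v (fun y => \sum_i F i y * G i y) x =
  \sum_i ('D_v (F i) x * G i x + F i x * 'D_v (G i) x).
Proof.
move=> dF dG; rewrite (_ : (fun _ => _) = \sum_i (F i * G i)); last first.
  by apply/funext => y; rewrite fct_sumE.
rewrite derive_sum => [|i]; last by apply: diff_derivable; exact: differentiableM.
apply: eq_bigr => i _; rewrite deriveM; [|exact: diff_derivable..].
by rewrite addrC; congr (_ + _); rewrite /GRing.scale /= mulrC.
Qed.

Lemma derive_min_ge0 f x v : differentiable f x ->
  (\forall t \near (0 : R)^'+, f x <= f (x + t *: v)) -> 0 <= 'D_v f x.
Proof.
move=> df fmin; apply/ler_addgt0Pr => e e0.
have L0 := en_ge0 v.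
have e' : 0 < e / (en v + 1) by rewrite divr_gt0 // ltr_wpDl.
have /nbhs_enP[r r0 hr] := derive_first_order df e'.
near (0 : R)^'+ => t.
have t0 : 0 < t by near: t; exact: nbhs_right_gt.
have tr : t < r / (en v + 1).
  by near: t; apply: nbhs_right_lt; rewrite divr_gt0 // ltr_wpDl.
have ft : f x <= f (x + t *: v) by near: t.
have /hr : en (x + t *: v - x) < r.
  rewrite addrKl enZ gtr0_norm //.
  move: tr; rewrite ltr_pdivlMr ?ltr_wpDl // mulrDr mulr1; lra.
rewrite addrKl deriveZ_dir // enZ (gtr0_norm t0).
rewrite ler_norml => /andP[_]; rewrite mulrCA => h.
have h' : e / (en v + 1) * en v <= e.
  by rewrite mulrAC ler_pdivrMr ?ltr_wpDl // ler_wpM2l ?ltW //; lra.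
rewrite -(ler_pM2l t0) mulr0 mulrDr; nra.
Unshelve. all: by end_near. Qed.

End scalar_functions.

(** * First-order expansions of vector-valued maps *)

Section vector_functions.
Context {k l : nat}.
Implicit Types (x y v w : 'rV[R]_k) (F : 'rV[R]_k -> 'rV[R]_l).

Definition coordinate F (j : 'I_l) : 'rV[R]_k -> R := fun y => F y 0 j.

Definition Jm F x : 'M[R]_(k, l) := \matrix_(i, j) 'D_'e_i (coordinate F j) x.

(** A relation rather than the function [jacobian]: it depends only on the germ of [F] and composes
    directly. *)
Definition has_jac F x (J : 'M[R]_(k, l)) := forall e, 0 < e ->
  \forall y \near x, en (F y - F x - (y - x) *m J) <= e * en (y - x).

Lemma jacobianE F x : (forall j, differentiable (coordinate F j) x) ->
  jacobian F x = Jm F x.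
Proof.
move=> dF; have dFx : differentiable F x.
  have -> : F = \sum_j (fun y => coordinate F j y *: 'e_j).
    by apply/funext => y; rewrite fct_sumE -row_sum_delta.
  by apply: differentiable_sum => j; exact: differentiableZl.
apply/matrixP => i j; rewrite /jacobian /lin1_mx !mxE -deriveE //.
by rewrite derive_mx ?mxE //; exact: diff_derivable.
Qed.

Lemma derive_mulJm F x v j : differentiable (coordinate F j) x ->
  'D_v (coordinate F j) x = (v *m Jm F x) 0 j.
Proof.
move=> dF; rewrite derive_coordE // mxE.
by apply: eq_bigr => i _; rewrite mxE.
Qed.

Lemma Jm_first_order F x : (forall j, differentiable (coordinate F j) x) ->
  has_jac F x (Jm F x).
Proof.
move=> dF e e0; have e' : 0 < e / l.+1%:R by rewrite divr_gt0.
have : \forall y \near x, forall j,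
    `|coordinate F j y - coordinate F j x - 'D_(y - x) (coordinate F j) x|
      <= e / l.+1%:R * en (y - x).
  pose P (j : 'I_l) (y : 'rV[R]_k) : Prop := `|coordinate F j y - coordinate F j x - 'D_(y - x) (coordinate F j) x|
      <= e / l.+1%:R * en (y - x).
  exact: (@filter_forall _ _ P (nbhs x) _ (fun j => derive_first_order (dF j) e')).
apply: filterS => y hy; apply: le_trans (en_le_normr _) _.
have -> : e * en (y - x) = l.+1%:R * (e / l.+1%:R * en (y - x)).
  by field; rewrite addrC natr1.
rewrite ler_pM2l //; rewrite [leLHS]mx_normrE; apply/bigmax_leP; split.
  by rewrite mulr_ge0 ?en_ge0 // ltW.
by move=> [i j] _ /=; rewrite ord1; have := hy j; rewrite derive_mulJm // /coordinate !mxE.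
Qed.

End vector_functions.

Lemma mulmx_bound k l (B : 'M[R]_(k, l)) : exists2 C, 0 < C &
  forall w, en (w *m B) <= C * en w.
Proof.
pose M := \sum_j en (col j B)^T.
have M0 : 0 <= M by apply: sumr_ge0 => j _; exact: en_ge0.
exists (l.+1%:R * (M + 1)) => [|w]; first by rewrite mulr_gt0 // ltr_wpDl.
apply: le_trans (en_le_normr _) _; rewrite -mulrA ler_pM2l //.
rewrite [leLHS]mx_normrE; apply/bigmax_leP; split.
  by rewrite mulr_ge0 ?en_ge0 // addr_ge0.
move=> [i j] _ /=; rewrite ord1.
have e s : s * (w *m B) 0 j = dotp (s *: w) (col j B)^T.
  by rewrite dotpZl mxE; congr (_ * _); apply: eq_bigr => a _; rewrite !mxE.
have colM : en (col j B)^T <= M + 1.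
  rewrite /M (bigD1 j) //= -addrA lerDl addr_ge0 //.
  by apply: sumr_ge0 => a _; exact: en_ge0.
have h s : `|s| = 1 -> s * (w *m B) 0 j <= (M + 1) * en w.
  move=> s1; rewrite e; apply: le_trans (le_dotp_en _ _) _.
  by rewrite enZ s1 mul1r mulrC ler_wpM2r // en_ge0.
rewrite ler_norml -lerN2 opprK.
have := h 1; rewrite normr1 mul1r => -> //; rewrite andbT.
by have := h (- 1); rewrite normrN1 mulN1r => ->.
Qed.

Lemma has_jac_lipschitz k l (F : 'rV[R]_k -> 'rV[R]_l) x J : has_jac F x J ->
  exists2 C, 0 < C & \forall y \near x, en (F y - F x) <= C * en (y - x).
Proof.
move=> dF; have [C C0 hC] := mulmx_bound J.
exists (C + 1); first by rewrite addr_gt0.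
move: (dF 1 ltr01); apply: filterS => y h.
have := en_le_add (F y - F x) ((y - x) *m J).
by have := hC (y - x); lra.
Qed.

Lemma has_jac_comp k l n (F : 'rV[R]_k -> 'rV[R]_l) (G : 'rV[R]_l -> 'rV[R]_n) x J K :
  has_jac F x J -> has_jac G (F x) K -> has_jac (G \o F) x (J *m K).
Proof.
move=> dF dG e e0; have [C C0 hF] := has_jac_lipschitz dF.
have [D D0 hK] := mulmx_bound K.
have e1 : 0 < e / 2 / C by rewrite !divr_gt0.
have e2 : 0 < e / 2 / D by rewrite !divr_gt0.
have /nbhs_enP[r r0 hr] := dG _ e1.
have rC : 0 < r / C by rewrite divr_gt0.
move: hF (dF _ e2) (near_en x rC); apply: filterS3 => y h1 h2 h3.
have {}hr : en (G (F y) - G (F x) - (F y - F x) *m K) <= e / 2 / C * en (F y - F x).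
  apply: hr; apply: (le_lt_trans h1).
  by move: h3; rewrite ltr_pdivlMr // mulrC.
have -> : (G \o F) y - (G \o F) x - (y - x) *m (J *m K) =
   (G (F y) - G (F x) - (F y - F x) *m K) + (F y - F x - (y - x) *m J) *m K.
  by rewrite (mulmxBl (F y - F x) _ K) mulmxA addrA subrK.
apply: le_trans (en_triangle _ _) _.
have k1 : e / 2 / C * en (F y - F x) <= e / 2 * en (y - x).
  by rewrite -mulrA ler_pM2l ?divr_gt0 // mulrC ler_pdivrMr // mulrC.
have k2 : en ((F y - F x - (y - x) *m J) *m K) <= e / 2 * en (y - x).
  apply: le_trans (hK _) _; rewrite -ler_pdivlMl // mulrA.
  by rewrite [D^-1 * _]mulrC.
by apply: le_trans (lerD (le_trans hr k1) k2) _; rewrite -mulrDl -splitr.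
Qed.

Lemma has_jac_lin k l (A : 'M[R]_(k, l)) (b : 'rV[R]_l) x :
  has_jac (fun y => y *m A + b) x A.
Proof.
move=> e e0; near=> y.
rewrite opprD addrACA subrr addr0 -mulmxBl subrr en0 mulr_ge0 ?en_ge0 //.
exact: ltW.
Unshelve. all: by end_near. Qed.

Lemma posdef_unit k (G : 'M[R]_k) : (forall v, v != 0 -> 0 < dotp (v *m G) v) ->
  G \in unitmx.
Proof.
move=> h; rewrite -row_free_unit; apply/inj_row_free => v vG.
by apply/eqP/negPn/negP => /h; rewrite vG dotp0l ltxx.
Qed.

(** Equal pullback metrics mean that [v *m J] and [v *m J'] have the same length. As [G] is
    invertible, [v] is bounded by a multiple of that length, so the first-order errors are
    relatively small. *)
Lemma metric_comparison k l l' (F : 'rV[R]_k -> 'rV[R]_l) (F' : 'rV[R]_k -> 'rV[R]_l')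
    J J' G x e :
  has_jac F x J -> has_jac F' x J' -> J *m J^T = G -> J' *m J'^T = G ->
  G \in unitmx -> 0 < e ->
  \forall y \near x, en (F' y - F' x) <= (1 + e) * en (F y - F x).
Proof.
move=> dF dF' FG FG' Gu e0.
have [C C0 hC] := mulmx_bound (J^T *m invmx G).
(* With q = e / (2 + e) one has (1 + q) / (1 - q) = 1 + e. *)
pose d := e / (2 + e) / C.
have d0 : 0 < d by rewrite !divr_gt0 // addr_gt0.
move: (dF _ d0) (dF' _ d0); apply: filterS2 => y; set v := y - x => h1 h2.
have Jv : en (v *m J') = en (v *m J).
  by rewrite /en !dotp_mulmx -!mulmxA FG FG'.
have vC : en v <= C * en (v *m J).
  by have := hC (v *m J); rewrite -mulmxA [X in v *m X]mulmxA FG mulmxV // mulmx1.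
have k1 := en_le_add (F' y - F' x) (v *m J'); rewrite Jv in k1.
have := en_le_add (v *m J) (F y - F x); rewrite [en (v *m _ - _)]enB => k2.
set a := en (v *m J) in vC k1 k2.
have a0 : 0 <= a by exact: en_ge0.
have dv : d * en v <= e / (2 + e) * a.
  have -> : e / (2 + e) * a = d * (C * a).
    by rewrite /d; field; rewrite !gt_eqF //; lra.
  by rewrite ler_pM2l.
have : (1 + e / (2 + e)) * a <= (1 + e) * ((1 - e / (2 + e)) * a).
  rewrite mulrA ler_wpM2r // le_eqVlt; apply/orP; left; apply/eqP; field.
  by rewrite gt_eqF //; lra.
set q := e / (2 + e) in dv *; move: h1 h2 k1 k2 dv.
move: (en (F' y - F' x)) (en (F y - F x)) (d * en v) => A B D.
move=> h1 h2 k1 k2 dv h.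
have k3 : A <= (1 + q) * a by lra.
have k4 : (1 - q) * a <= B by lra.
by apply: (le_trans k3); apply: (le_trans h); rewrite ler_pM2l //; lra.
Qed.

End differential_calculus.

(** * Images of half-balls *)

Section immersions.
Context {R : realType}.

Lemma dotp_row k l (A : 'M[R]_(k, l)) i w : dotp (row i A) w = (A *m w^T) i 0.
Proof. by rewrite mxE; apply: eq_bigr => a _; rewrite !mxE. Qed.

Lemma row_kernel k (A : 'M[R]_k) w : A \in unitmx ->
  (forall i, dotp (row i A) w = 0) -> w = 0.
Proof.
move=> Au h; apply: trmx_inj; rewrite trmx0 -[w^T](mulKmx Au).
rewrite (_ : A *m w^T = 0) ?mulmx0 //.
by apply/matrixP => i j; rewrite ord1 -dotp_row h mxE.
Qed.

Lemma dotp_mulrow k l (A : 'M[R]_(k, l)) v w :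
  dotp (v *m A) w = \sum_i v 0 i * dotp (row i A) w.
Proof.
rewrite dotp_mulmx; apply: eq_bigr => i _; congr (_ * _).
by rewrite dotp_row !mxE; apply: eq_bigr => a _; rewrite !mxE mulrC.
Qed.

Lemma near_right_itv (d : R) : 0 < d -> \forall t \near (0 : R)^'+, 0 < t < d.
Proof.
move=> d0; near=> t; apply/andP; split; first by near: t; exact: nbhs_right_gt.
by near: t; exact: nbhs_right_lt.
Unshelve. all: by end_near. Qed.

Lemma differentiable_near_en k l (F : 'rV[R]_k -> 'rV[R]_l) x e :
  (forall j, differentiable (coordinate F j) x) -> 0 < e ->
  \forall y \near x, en (F y - F x) < e.
Proof.
move=> dF e0; have [C C0 hC] := has_jac_lipschitz (Jm_first_order dF).
have d0 : 0 < e / C by rewrite divr_gt0.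
move: hC (near_en x d0); apply: filterS2 => y h1.
by rewrite ltr_pdivlMr // mulrC; exact: le_lt_trans.
Qed.

Lemma compact_separated k l (F : 'rV[R]_k -> 'rV[R]_l) (C : set 'rV[R]_k) y :
  compact C -> (forall x, C x -> forall j, differentiable (coordinate F j) x) ->
  (forall x, C x -> F x <> y) -> exists2 d, 0 < d & forall x, C x -> d <= en (F x - y).
Proof.
move=> cC dF Fy; have [[c0 Cc0]|nC] := pselect (C !=set0); last first.
  by exists 1 => // x Cx; case: nC; exists x.
have [||c cC' cmin] := @compact_EVT_min _ R (fun x => en (F x - y)) C _ cC.
- by exists c0.
- apply: continuous_in_subspaceT => x /set_mem Cx.
  move=> Q /nbhs_ballP[e /= e0 hQ].
  move: (differentiable_near_en (dF _ Cx) e0); apply: filterS => z h.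
  apply: hQ; rewrite /ball /=; apply: le_lt_trans h; rewrite ler_norml; apply/andP; split.
    by have := en_triangleB (F x) (F z) y; lra.
  by have := en_triangleB (F z) (F x) y; rewrite [en (F x - F z)]enB; lra.
exists (en (F c - y)).
  by rewrite en_gt0 // subr_eq0; apply/eqP/Fy/set_mem.
by move=> x Cx; apply: cmin; exact/mem_set.
Qed.

Section local_image.
Context {m : nat}.
Local Notation E := 'rV[R]_m.+1.
Implicit Types (x y z v w n : E) (F : E -> E).

(** Half-space or whole space, so that boundary and interior charts are treated together. *)
Definition side (b : bool) : set E := [set x | b -> 0 <= ht x].

Lemma compact_side_ball b x0 r : compact [set x | en (x - x0) <= r /\ side b x].
Proof.
apply: bounded_closed_compact.
  exists (r + en x0); split; first exact: num_real.
  move=> N rN x [xr _]; apply: le_trans (normr_le_en x) _; apply: le_trans (ltW rN).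
  by have := en_le_add x x0; lra.
rewrite -[X in closed X]setCK; apply: open_closedC; rewrite openE => x /= h.
have [xr|rx] := leP (en (x - x0)) r.
  have /not_implyP[bt /negP] : ~ side b x by move=> sx; apply: h.
  rewrite -ltNge => /near_coord_lt; apply: filterS => y y0 [_ /(_ bt)].
  by rewrite leNgt y0.
have d0 : 0 < en (x - x0) - r by rewrite subr_gt0.
move: (near_en x d0); apply: filterS => y yx [yr _].
by have := en_triangleB y x x0; rewrite [en (x - y)]enB; lra.
Qed.

(** A minimum [z] of the distance from [F z] to [y] on a half-ball gives [F z = y] by the
    first-order conditions. At a point free to move in all directions, [w = F z - y] is orthogonal
    to every row of the invertible Jacobian. On the face it is orthogonal to the tangential rows
    only, so it is a nonnegative multiple of [n]; as [y] lies on the positive side of the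
    hyperplane, the multiple is 0. *)
Lemma image_nbhs (b : bool) F x0 r n : 0 < r ->
  (forall x, en (x - x0) < r -> side b x -> forall a, differentiable (coordinate F a) x) ->
  (forall x, en (x - x0) < r -> side b x -> Jm F x \in unitmx) ->
  (forall x y, en (x - x0) < r -> side b x -> en (y - x0) < r -> side b y ->
     F x = F y -> x = y) ->
  side b x0 ->
  (b -> forall x, en (x - x0) < r -> ht x = 0 ->
     [/\ dotp (F x - F x0) n = 0, 0 < dotp (row ord0 (Jm F x)) n &
       forall i, i != ord0 -> dotp (row i (Jm F x)) n = 0]) ->
  exists2 d, 0 < d & forall y, en (y - F x0) < d -> 0 <= dotp (y - F x0) n ->
    exists x, [/\ side b x, en (x - x0) < r & F x = y].
Proof.
move=> r0 dF uF iF sx0 hb.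
have r20 : 0 < r / 2 by rewrite divr_gt0.
have r2r : r / 2 < r by lra.
pose K := [set x | en (x - x0) <= r / 2 /\ side b x].
have cK : compact K by exact: compact_side_ball.
(* On the outer shell [F] keeps a distance [d] from [F x0], so for [y] within [d / 2] of [F x0] the
   minimum is attained off the shell. *)
pose K' := K `&` [set x | r / 2 <= en (x - x0)].
have cK' : compact K'.
  apply: compact_closedI => //.
  rewrite -[X in closed X]setCK; apply: open_closedC; rewrite openE => x /= /negP.
  by rewrite -ltNge => /near_ball; apply: filterS => y yx; apply/negP; rewrite -ltNge.
have Kr x : K x -> en (x - x0) < r by move=> [xr _]; apply: le_lt_trans r2r.
have x0r : en (x0 - x0) < r by rewrite subrr en0.
have [||d d0 hd] := @compact_separated _ _ F K' (F x0) cK'.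
- by move=> x [Kx _]; apply: dF; [exact: Kr|exact: Kx.2].
- move=> x [Kx /= rx] /(iF _ _ (Kr _ Kx) Kx.2 x0r sx0) e.
  by move: rx; rewrite e subrr en0; lra.
exists (d / 2) => [|y yd yn]; first by rewrite divr_gt0.
pose D z := \sum_a (F z 0 a - y 0 a) * (F z 0 a - y 0 a).
have DE z : D z = en (F z - y) ^+ 2.
  by rewrite en_sqr; apply: eq_bigr => a _; rewrite !mxE.
have dFy z : K z -> forall a, differentiable (fun z => F z 0 a - y 0 a) z.
  move=> Kz a; apply: (@differentiableB _ _ _ (coordinate F a) (cst (y 0 a))) => //.
  exact: dF (Kr _ Kz) Kz.2 a.
have dD z : K z -> differentiable D z.
  move=> Kz; apply: differentiable_bigsum => a.
  by apply: (@differentiableM _ _ (fun z => F z 0 a - y 0 a)); exact: dFy.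
have [||z /set_mem Kz zmin] := @compact_EVT_min _ R D K _ cK.
- by exists x0; split; rewrite ?subrr ?en0 ?ltW.
- apply: continuous_in_subspaceT => z /set_mem Kz.
  exact: differentiable_continuous (dD _ Kz).
have {zmin}zmin x : K x -> D z <= D x by move=> Kx; apply: zmin; exact/mem_set.
have zy : en (F z - y) < d / 2.
  rewrite -(@ltr_pXn2r _ 2) ?nnegrE ?en_ge0 //; last by rewrite ltW ?divr_gt0.
  rewrite -DE; apply: le_lt_trans (zmin x0 _) _.
    by split; rewrite ?subrr ?en0 ?ltW.
  rewrite DE ltr_pXn2r ?nnegrE ?en_ge0 //; first by rewrite enB.
  by rewrite ltW ?divr_gt0.
have zr : en (z - x0) < r / 2.
  rewrite ltNge; apply/negP => rz.
  have /hd : K' z by [].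
  by have := en_triangleB y (F z) (F x0); lra.
exists z; split; [exact: Kz.2|exact: Kr|].
set w := F z - y.
have grad v : (\forall t \near (0 : R)^'+, side b (z + t *: v)) ->
    0 <= dotp (v *m Jm F z) w.
  move=> hv; have : 0 <= 'D_v D z.
    apply: derive_min_ge0; first exact: dD.
    have /near_line[e e0 he] : nbhs (z + 0 *: v) [set x | en (x - x0) < r / 2].
      by rewrite scale0r addr0; exact: near_ball.
    move: hv (near_right_itv e0); apply: filterS2 => t st /andP[t0 te].
    by apply: zmin; split=> //; apply/ltW/he; rewrite subr0 gtr0_norm.
  rewrite /D (derive_sum_mul _ (dFy _ Kz) (dFy _ Kz)).
  have dE a : 'D_v (fun z => F z 0 a - y 0 a) z = (v *m Jm F z) 0 a.
    have dFa := dF _ (Kr _ Kz) Kz.2 a.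
    rewrite -derive_mulJm // [LHS](_ : _ = 'D_v (coordinate F a - cst (y 0 a)) z) //.
    have dfv : derivable (coordinate F a) z v by exact: diff_derivable.
    by rewrite (deriveB dfv (derivable_cst _ _ _)) derive_cst subr0.
  under eq_bigr do rewrite dE [X in _ + X]mulrC.
  have -> : \sum_(i < m.+1) ((v *m Jm F z) 0 i * (F z 0 i - y 0 i) +
     (v *m Jm F z) 0 i * (F z 0 i - y 0 i)) = 2 * dotp (v *m Jm F z) w.
    by rewrite mulr_sumr; apply: eq_bigr => i _; rewrite !mxE; ring.
  by rewrite pmulr_rge0.
have Ju := uF _ (Kr _ Kz) Kz.2.
have rowE i : 'e_i *m Jm F z = row i (Jm F z) by rewrite rowE.
apply/eqP; rewrite -subr_eq0 -/w; apply/eqP.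
have [int|/existsNP[v nint]] :=
    pselect (forall v, \forall t \near (0 : R)^'+, side b (z + t *: v)).
  apply: (row_kernel Ju) => i; apply/eqP; rewrite eq_le -{2}rowE grad // andbT.
  by have := grad _ (int (- 'e_i)); rewrite mulNmx dotpNl rowE oppr_ge0.
have [bt z0] : b /\ ht z = 0.
  have [bt|nb] := boolP b; last by case: nint; near=> t => bt; rewrite bt in nb.
  split=> //; apply/eqP; rewrite eq_le (Kz.2 bt) andbT leNgt; apply/negP => z0.
  apply: nint; have /near_line[e e0 he] : nbhs (z + 0 *: v) [set x | 0 < ht x].
    by rewrite scale0r addr0; exact: near_coord_gt.
  move: (near_right_itv e0); apply: filterS => t /andP[t0 te] _.
  by apply/ltW/he; rewrite subr0 gtr0_norm.
have [zn n0 ni] := hb bt z (Kr _ Kz) z0.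
have side_t v' t : 0 <= t * ht v' -> side b (z + t *: v').
  by move=> h _; rewrite ht_line z0 add0r.
have w0 : 0 <= dotp (row ord0 (Jm F z)) w.
  rewrite -rowE; apply: grad; near=> t; apply: side_t.
  by rewrite ht_e0 mulr1; near: t; exact: nbhs_right_ge.
have wi i : i != ord0 -> dotp (row i (Jm F z)) w = 0.
  move=> i0; have hi : ht ('e_i : E) = 0 by rewrite /ht mxE eq_sym (negbTE i0).
  apply/eqP; rewrite eq_le -{2}rowE; apply/andP; split; last first.
    by apply: grad; near=> t; apply: side_t; rewrite hi mulr0.
  rewrite -oppr_ge0 -dotpNl -rowE -mulNmx; apply: grad; near=> t; apply: side_t.
  by rewrite -scaleN1r htZ hi !mulr0.
(* The multiplier is found by testing against row 0; the other rows are orthogonal to both [w] and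
   [n]. *)
pose mu := dotp (row ord0 (Jm F z)) w / dotp (row ord0 (Jm F z)) n.
have wE : w - mu *: n = 0.
  apply: (row_kernel Ju) => i; rewrite dotpDr dotpNr dotpZr.
  have [->|i0] := eqVneq i ord0; first by rewrite /mu divfK ?subrr ?gt_eqF.
  by rewrite wi // ni // mulr0 subrr.
have mu0 : 0 <= mu by rewrite divr_ge0 // ltW.
have wn : dotp w n <= 0.
  have -> : w = (F z - F x0) - (y - F x0) by rewrite opprB addrA subrK.
  by rewrite dotpDl dotpNl zn add0r oppr_le0.
have nn : 0 < dotp n n.
  by apply: dotp_gt0; apply/eqP => e; rewrite e dotp0r ltxx in n0.
move/eqP: wE; rewrite subr_eq0 => /eqP wE; move: wn; rewrite wE dotpZl => wn.
have -> : mu = 0 by apply/eqP; rewrite eq_le mu0 andbT -(pmulr_lle0 _ nn).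
by rewrite scale0r.
Unshelve. all: by end_near. Qed.

(** Column 0 of the adjugate is the generalized cross product of the other rows. It serves as normal
    field [N] below, being polynomial in the derivatives and so differentiable. *)
Lemma mul_adj_col0 (A : 'M[R]_m.+1) i :
  dotp (row i A) (\row_a \adj A a ord0) = \det A *+ (i == ord0).
Proof.
rewrite dotp_row (_ : _^T = col ord0 (\adj A)); last first.
  by apply/matrixP => a j; rewrite !mxE.
have -> : (A *m col ord0 (\adj A)) i 0 = (A *m \adj A) i ord0.
  by rewrite !mxE; apply: eq_bigr => a _; rewrite mxE.
by rewrite mul_mx_adj mxE.
Qed.

(** * The image of a totally geodesic boundary lies in a hyperplane *)

Section totally_geodesic_image.
Variables (F : E -> E) (V : set E) (x0 : E) (r : R).
Hypothesis oV : open V.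
Hypothesis sF : forall a, smooth_on V (coordinate F a).
Hypothesis r0 : 0 < r.
Hypothesis rV : forall x, en (x - x0) < r -> V x.
Hypothesis x00 : ht x0 = 0.
Hypothesis uF : forall x, en (x - x0) < r -> 0 <= ht x -> Jm F x \in unitmx.

Let N x : E := \row_a \adj (Jm F x) a ord0.

(** The second fundamental form of the image of the face, up to the length of [N]. *)
Hypothesis tg : forall x, en (x - x0) < r -> ht x = 0 ->
  forall i j, i != ord0 -> j != ord0 ->
  \sum_a 'D_'e_i ('D_'e_j (coordinate F a)) x * N x 0 a = 0.

Let dF x a : V x -> differentiable (coordinate F a) x.
Proof. by move=> Vx; exact: (sF a [::] Vx). Qed.

Let dDF x a i : V x -> differentiable ('D_'e_i (coordinate F a)) x.
Proof. by move=> Vx; exact: (sF a [:: i] Vx). Qed.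

Let dN x a : V x -> differentiable (fun y => N y 0 a) x.
Proof.
move=> Vx; pose M y := row' ord0 (col' a (Jm F y)).
have -> : (fun y => N y 0 a) = (fun y => (-1) ^+ ((ord0 : 'I_m.+1) + a) * \det (M y)).
  by apply/funext => y; rewrite !mxE /cofactor.
apply: differentiableM; first exact: differentiable_cst.
apply: differentiable_det => i j; rewrite /M.
rewrite (_ : (fun y => _) = 'D_'e_(lift ord0 i) (coordinate F (lift a j))); first exact: dDF.
by apply/funext => y; rewrite !mxE.
Qed.

Let rowN x i : dotp (row i (Jm F x)) (N x) = \det (Jm F x) *+ (i == ord0).
Proof. exact: mul_adj_col0. Qed.

Let det0 x : en (x - x0) < r -> 0 <= ht x -> \det (Jm F x) != 0.
Proof. by move=> xr x1; have := uF xr x1; rewrite unitmxE unitfE. Qed.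

Let N_neq0 x : en (x - x0) < r -> 0 <= ht x -> N x != 0.
Proof.
move=> xr x1; apply/eqP => e; have := rowN x ord0.
by rewrite e dotp0r eqxx => /esym/eqP; rewrite (negbTE (det0 xr x1)).
Qed.

(** Differentiating the orthogonality of [N] to the tangential rows and using [tg] shows that
    tangential derivatives of [N] are again orthogonal to these rows, hence multiples of [N]. *)
Let derive_N x v : en (x - x0) < r -> ht x = 0 -> ht v = 0 ->
  exists la, forall a, 'D_v (fun y => N y 0 a) x = la * N x 0 a.
Proof.
move=> xr hx hv; have Vx := rV xr; have hx' : 0 <= ht x by rewrite hx.
pose u : E := \row_a 'D_v (fun y => N y 0 a) x.
have hu j : j != ord0 -> dotp (row j (Jm F x)) u = 0.
  move=> j0; have hi i : i != ord0 ->
      \sum_a 'D_'e_j (coordinate F a) x * 'D_'e_i (fun y => N y 0 a) x = 0.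
    move=> i0; have : 'D_'e_i (fun y => \sum_a 'D_'e_j (coordinate F a) y * N y 0 a) x = 0.
      rewrite (_ : (fun y => _) = cst 0) ?derive_cst //; apply/funext => y.
      have e := rowN y j; rewrite (negbTE j0) mulr0n in e.
      transitivity (dotp (row j (Jm F y)) (N y)); last by rewrite e.
      by apply: eq_bigr => a _; rewrite !mxE.
    rewrite derive_sum_mul; [|by move=> a; exact: dDF|by move=> a; exact: dN].
    by rewrite big_split /= tg // add0r.
  rewrite /dotp; under eq_bigr => a _ do
    rewrite !mxE (derive_coordE _ (dN _ Vx)) mulr_sumr.
  rewrite exchange_big big1 // => i _.
  have [->|i0] := eqVneq i ord0.
    by apply: big1 => a _; rewrite -[v 0 ord0]/(ht v) hv mul0r mulr0.
  by under eq_bigr do rewrite mulrCA; rewrite -mulr_sumr hi // mulr0.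
pose la := dotp (row ord0 (Jm F x)) u / \det (Jm F x).
exists la => a; suff : u - la *: N x = 0.
  move/eqP; rewrite subr_eq0 => /eqP e.
  have h : u 0 a = (la *: N x) 0 a by rewrite e.
  by rewrite [LHS]mxE [RHS]mxE in h.
apply: (row_kernel (uF xr hx')) => j; rewrite dotpDr dotpNr dotpZr rowN.
have [->|j0] := eqVneq j ord0; first by rewrite /la mulr1n divfK ?subrr // det0.
by rewrite hu // mulr0 subrr.
Qed.

(* The orthogonal projection onto the normal line is constant along the
   boundary, where the logarithmic derivative of the normal field is scalar. *)
Let projection_const x a b : en (x - x0) < r -> ht x = 0 ->
  N x 0 a * N x 0 b / dotp (N x) (N x) = N x0 0 a * N x0 0 b / dotp (N x0) (N x0).
Proof.
move=> xr hx; pose S y := \sum_c N y 0 c * N y 0 c.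
pose q y := N y 0 a * N y 0 b * (S y)^-1.
suff : q (x0 + 1 *: (x - x0)) - q x0 = 0.
  by rewrite scale1r subrKC => /eqP; rewrite subr_eq0 => /eqP.
pose z s := x0 + s *: (x - x0).
have zr s : 0 <= s <= 1 -> en (z s - x0) < r /\ ht (z s) = 0.
  move=> s01; split; last by rewrite ht_line htB hx x00 subrr mulr0 addr0.
  by apply: cvx_en => //; rewrite subrr en0.
have S0 s : 0 <= s <= 1 -> S (z s) != 0.
  move=> /zr[zr1 z0]; rewrite -/(dotp (N (z s)) (N (z s))) dotp_eq0.
  by apply: N_neq0; rewrite ?z0.
have dS y : V y -> differentiable S y.
  by move=> Vy; apply: differentiable_bigsum => c; apply: (@differentiableM _ _ (fun y => N y 0 c)); exact: dN.
have dNN y : V y -> differentiable (fun y => N y 0 a * N y 0 b) y.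
  by move=> Vy; apply: (@differentiableM _ _ (fun y => N y 0 a)); exact: dN.
have dq s : 0 <= s <= 1 -> differentiable q (z s).
  move=> s01; have Vz := rV (zr _ s01).1.
  apply: (@differentiableM _ _ (fun y => N y 0 a * N y 0 b)); first exact: dNN.
  apply: (@differentiable_comp _ _ _ _ S (GRing.inv : R -> R)); first exact: dS.
  exact/differentiable_Rinv/S0.
have [s /andP[s0 s1] ->] := mean_value_line ltr01 dq.
rewrite mul1r; have s01 : 0 <= s <= 1 by rewrite !ltW.
have [zr1 z0] := zr _ s01; have Vz := rV zr1.
have hv : ht (x - x0) = 0 by rewrite htB hx x00 subrr.
have [la hla] := derive_N zr1 z0 hv.
set v := x - x0 in hv hla *; rewrite -/(z s).
have dmul (f g : E -> R) : differentiable f (z s) -> differentiable g (z s) ->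
    'D_v (fun y => f y * g y) (z s) = 'D_v f (z s) * g (z s) + f (z s) * 'D_v g (z s).
  move=> df dg; have := @derive_sum_mul R m.+1 1 (fun=> f) (fun=> g) (z s) v.
  rewrite big_ord1 => <- //; congr ('D_v _ _).
  by apply/funext => y; rewrite big_ord1.
have DS : 'D_v S (z s) = 2 * la * S (z s).
  rewrite /S derive_sum_mul; [|by move=> c; exact: dN..].
  by rewrite mulr_sumr; apply: eq_bigr => c _; rewrite hla; ring.
have DNN : 'D_v (fun y => N y 0 a * N y 0 b) (z s) = 2 * la * (N (z s) 0 a * N (z s) 0 b).
  by rewrite dmul; [rewrite !hla; ring|exact: dN..].
(* The product rule for [q * S], the numerator of [q], gives the derivative of [q] without
   differentiating an inverse: [S] and the numerator have the same logarithmic derivative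
   [2 * la]. *)
have : 'D_v (fun y => q y * S y) (z s) = 'D_v (fun y => N y 0 a * N y 0 b) (z s).
  apply: (@derive_eq_side R m.+1 setT).
  - by apply: (@differentiableM _ _ q); [exact: dq|exact: dS].
  - exact: dNN.
  - by move=> w; exists 1; [exact: expr1n|near=> t].
  - by [].
  - have : \forall y \near z s, S y != 0.
      have := differentiable_continuous (dS _ Vz) => cS.
      exact: (cS _ (open_nbhs_nbhs (conj (@open_neq R 0) (S0 _ s01)))).
    by apply: filterS => y Sy _; rewrite /q divfK.
rewrite dmul ?DNN ?DS; [|exact: dq|exact: dS].
have -> : N (z s) 0 a * N (z s) 0 b = q (z s) * S (z s) by rewrite /q divfK ?S0.
rewrite [X in _ = X](_ : _ = q (z s) * (2 * la * S (z s))); last by ring.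
move/eqP; rewrite -subr_eq0 addrK mulf_eq0 (negbTE (S0 _ s01)) orbF.
by move/eqP.
Unshelve. all: by end_near. Qed.

(** The tangential row at [x] is killed by the projection onto the line of [N x], which is also the
    projection onto the line of [N x0]. *)
Let row_N0 x i : en (x - x0) < r -> ht x = 0 -> i != ord0 ->
  dotp (row i (Jm F x)) (N x0) = 0.
Proof.
move=> xr hx i0; have hx' : 0 <= ht x by rewrite hx.
have x0r : en (x0 - x0) < r by rewrite subrr en0.
have hx0 : 0 <= ht x0 by rewrite x00.
set u := row i (Jm F x).
have S0 := dotp_gt0 (N_neq0 x0r hx0).
apply/eqP; rewrite -(mulIr_eq0 _ (mulIf (lt0r_neq0 S0))); apply/eqP.
have : \sum_b (\sum_a u 0 a * (N x0 0 a * N x0 0 b / dotp (N x0) (N x0))) * N x0 0 b = 0.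
  apply: big1 => b _; under eq_bigr do rewrite -(projection_const _ _ xr hx).
  rewrite (_ : \sum_a _ = dotp u (N x) * (N x 0 b / dotp (N x) (N x))).
    by rewrite rowN (negbTE i0) mulr0n !mul0r.
  by rewrite mulr_suml; apply: eq_bigr => a _; rewrite !mulrA.
rewrite (_ : \sum_b _ = dotp u (N x0)).
  by move=> ->; rewrite mul0r.
transitivity (dotp u (N x0) * (dotp (N x0) (N x0) / dotp (N x0) (N x0))); last first.
  by rewrite divff ?mulr1 // lt0r_neq0.
rewrite mulrA [X in X / _]mulr_sumr mulr_suml; apply: eq_bigr => b _.
rewrite mulr_suml /dotp mulr_suml !mulr_suml; apply: eq_bigr => a _.
by rewrite !mulrA; ring.
Qed.

(** The function [f], the component of [F] along [n], has zero derivative along the face and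
    positive derivative in the direction [e_0]. *)
Lemma half_space_image : exists n d, [/\ en n = 1, 0 < d, d <= r &
  forall x, en (x - x0) < d -> 0 <= ht x ->
   [/\ 0 <= dotp (F x - F x0) n, dotp (F x - F x0) n = 0 <-> ht x = 0,
       0 < dotp (row ord0 (Jm F x)) n &
       ht x = 0 -> forall i, i != ord0 -> dotp (row i (Jm F x)) n = 0]].
Proof.
have x0r : en (x0 - x0) < r by rewrite subrr en0.
have hx0 : 0 <= ht x0 by rewrite x00.
have N0 := N_neq0 x0r hx0; have eN := en_gt0 N0.
pose de := \det (Jm F x0).
have de0 : de != 0 by exact: det0.
(* The product of row 0 with [N x0] is the determinant, so its sign makes [n] point inwards. *)
pose n := (Num.sg de / en (N x0)) *: N x0.
have n1 : en n = 1.
  by rewrite enZ normrM normr_sg de0 mul1r normfV gtr0_norm // mulVf // gt_eqF.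
have n0 : 0 < dotp (row ord0 (Jm F x0)) n.
  rewrite dotpZr rowN eqxx mulr1n -/de mulrAC -normrEsg divr_gt0 // normr_gt0 //.
have [d [d0 dr hd]] : exists d, [/\ 0 < d, d <= r &
    forall x, en (x - x0) < d -> 0 < dotp (row ord0 (Jm F x)) n].
  pose h y := \sum_a 'D_'e_ord0 (coordinate F a) y * n 0 a.
  have dh : differentiable h x0.
    apply: differentiable_bigsum => a; apply: (@differentiableM _ _ ('D_'e_ord0 (coordinate F a)) (cst (n 0 a))) => //.
    by apply: dDF; exact: rV.
  have hE y : h y = dotp (row ord0 (Jm F y)) n.
    by apply: eq_bigr => a _; rewrite !mxE.
  have h0 : 0 < h x0 by rewrite hE.
  have /nbhs_enP[d d0 hd] := differentiable_continuous dh (open_nbhs_nbhs (conj (@open_gt R 0) h0)).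
  exists (Num.min d r); split; rewrite ?lt_min ?d0 ?ge_min ?lexx ?orbT //.
  by move=> x; rewrite lt_min => /andP[/hd]; rewrite /= hE.
have rown x i : en (x - x0) < r -> ht x = 0 -> i != ord0 -> dotp (row i (Jm F x)) n = 0.
  by move=> xr hx i0; rewrite dotpZr row_N0 // mulr0.
pose f y := \sum_a coordinate F a y * n 0 a.
have fE x y : f x - f y = dotp (F x - F y) n.
  by rewrite /f -sumrB; apply: eq_bigr => a _; rewrite !mxE mulrBl.
have df x : V x -> differentiable f x.
  move=> Vx; apply: differentiable_bigsum => a.
  by apply: (@differentiableM _ _ (coordinate F a) (cst (n 0 a))) => //; exact: dF.
have Df x v : V x -> 'D_v f x = dotp (v *m Jm F x) n.
  move=> Vx; rewrite /f (@derive_sum_mul R m.+1 m.+1 (coordinate F) (fun a => cst (n 0 a))) //.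
    by apply: eq_bigr => a _; rewrite derive_cst mulr0 addr0 derive_mulJm //; exact: dF.
  by move=> a; exact: dF.
have bd x : en (x - x0) < d -> ht x = 0 -> dotp (F x - F x0) n = 0.
  move=> xd hx; have xr : en (x - x0) < r by exact: lt_le_trans dr.
  have zr s : 0 <= s <= 1 -> en (x0 + s *: (x - x0) - x0) < r by move=> s01; exact: cvx_en.
  have [|s /andP[s0 s1]] := @mean_value_line R m.+1 f x0 (x - x0) 1 ltr01.
    by move=> s s01; apply: df; exact/rV/zr.
  rewrite scale1r subrKC fE mul1r => ->.
  have s01 : 0 <= s <= 1 by rewrite !ltW.
  rewrite Df; last exact/rV/zr.
  rewrite dotp_mulrow big1 // => i _; have [->|i0] := eqVneq i ord0.
    by rewrite -[_ 0 ord0]/(ht (x - x0)) htB hx x00 subrr mul0r.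
  rewrite rown ?mulr0 //; first exact: zr.
  by rewrite ht_line htB hx x00 subrr mulr0 addr0.
exists n, d; split=> // x xd hx.
have up : 0 < ht x -> 0 < dotp (F x - F x0) n.
  (* The vertical segment from the foot point of [x] stays in the ball, because the centre [x0] has
     height 0. *)
  move=> x1; pose b := cat 0 (tl x).
  have bx : b + ht x *: 'e_ord0 = x.
    by apply: eq_cat; rewrite ?ht_line ?ht_e0 ?cat0E ?mulr1 ?add0r // tlD tlZ tl_e0 scaler0 addr0 tl_cat.
  have xb : en (b - x0) <= en (x - x0).
    rewrite -(@ler_pXn2r _ 2) ?nnegrE ?en_ge0 // !en_split tlB tl_cat -tlB !htB cat0E x00.
    by rewrite !subr0 expr0n add0r lerDr sqr_ge0.
  have zr s : 0 <= s <= ht x -> en (b + s *: 'e_ord0 - x0) < d.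
    move=> /andP[s0 sx]; apply: le_lt_trans xd.
    rewrite -(@ler_pXn2r _ 2) ?nnegrE ?en_ge0 // !en_split !tlB tlD tlZ tl_e0 scaler0 addr0 tl_cat.
    rewrite !htB ht_line ht_e0 cat0E x00 !subr0 mulr1 add0r lerD2r.
    by rewrite ler_pXn2r ?nnegrE // ltW.
  have [|s /andP[s0 s1]] := @mean_value_line R m.+1 f b 'e_ord0 (ht x) x1.
    by move=> s hs; apply: df; apply: rV; apply: lt_le_trans dr; exact: zr.
  have zs : en (b + s *: 'e_ord0 - x0) < d by apply: zr; rewrite !ltW.
  rewrite bx Df; last by apply: rV; exact: lt_le_trans dr.
  have b0 := bd b (le_lt_trans xb xd) (cat0E _ _).
  have -> : f x - f b = dotp (F x - F x0) n.
    by rewrite -fE; have := fE b x0; rewrite b0; lra.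
  by move=> ->; rewrite mulr_gt0 // -rowE; exact: hd.
have hx_cases : ht x = 0 \/ 0 < ht x.
  by move: hx; rewrite le_eqVlt => /predU1P[<-|]; [left|right].
split.
- by case: hx_cases => [x1|/up/ltW //]; rewrite bd.
- split=> [e|]; last exact: bd.
  by case: hx_cases => // /up; rewrite e ltxx.
- exact: hd.
- by move=> x1 i i0; apply: rown => //; exact: lt_le_trans dr.
Qed.

End totally_geodesic_image.
End local_image.
End immersions.

(** * Developing maps of a flat manifold *)

Section christoffel_symbols.
Context {R : realType} {m : nat}.
Local Notation E := 'rV[R]_m.+1.

Lemma side_dir b (x v : E) : side b x ->
  exists2 s : R, s ^+ 2 = 1 & \forall t \near (0 : R)^'+, side b (x + (t * s) *: v).
Proof.
move=> sx; have [v0|/ltW v0] := leP 0 (ht v).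
  exists 1; first exact: expr1n.
  near=> t; have t0 : 0 <= t by near: t; exact: nbhs_right_ge.
  by move=> /sx x0; rewrite ht_line mulr1 addr_ge0 // mulr_ge0.
exists (- 1); first by rewrite sqrrN expr1n.
near=> t; have t0 : 0 <= t by near: t; exact: nbhs_right_ge.
by move=> /sx x0; rewrite ht_line mulrN1 addr_ge0 // mulNr -mulrN mulr_ge0 ?oppr_ge0.
Unshelve. all: by end_near. Qed.

Lemma Jm_eq_side b (F F' : E -> E) x :
  (forall a, differentiable (coordinate F a) x) ->
  (forall a, differentiable (coordinate F' a) x) -> side b x ->
  (\forall y \near x, side b y -> F y = F' y) -> Jm F x = Jm F' x.
Proof.
move=> dF dF' sx FF'; apply/matrixP => i j; rewrite !mxE.
apply: (derive_eq_side (S := side b)) => //; first by move=> v; exact: side_dir.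
by move: FF'; apply: filterS => y h /h; rewrite /coordinate => ->.
Qed.

(** One summand of the Christoffel symbol of the first kind of a Gram matrix, after the symmetry of
    second derivatives has been used. *)
Lemma first_kind_identity (p a q b r c : R) :
  p * a + b * q + (p * a + c * r) - (q * b + c * r) = 2 * (a * p).
Proof. by ring. Qed.

(* In a flat manifold the metric is [J J^T] for a developing map [F], and the
   Christoffel symbols express the second derivatives of [F] in the basis of
   the first derivatives. *)
Lemma christoffel_dev b (F : E -> E) V (G : E -> 'M[R]_m.+1) x i j : open V -> V x ->
  (forall a, smooth_on V (coordinate F a)) ->
  (forall i j, differentiable (fun y => G y i j) x) ->
  Jm F x \in unitmx -> side b x ->
  (\forall y \near x, side b y -> G y = Jm F y *m (Jm F y)^T) ->
  christoffel G ord0 i j x = 0 ->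
  \sum_a 'D_'e_i ('D_'e_j (coordinate F a)) x * \adj (Jm F x) a ord0 = 0.
Proof.
move=> oV Vx sF dG Ju sx GE ch.
have dD a k : differentiable ('D_'e_k (coordinate F a)) x by exact: (sF a [:: k]).
have sym a k l : 'D_'e_k ('D_'e_l (coordinate F a)) x = 'D_'e_l ('D_'e_k (coordinate F a)) x.
  apply: derive_sym => //.
  have : \forall y \near x, V y by exact: open_nbhs_nbhs.
  by apply: filterS => y Vy; exact: (sF a [::]).
have DG u p q : 'D_u (fun y => G y p q) x = \sum_a
    ('D_u ('D_'e_p (coordinate F a)) x * 'D_'e_q (coordinate F a) x +
     'D_'e_p (coordinate F a) x * 'D_u ('D_'e_q (coordinate F a)) x).
  rewrite -derive_sum_mul //.
  apply: (derive_eq_side (S := side b)) => //.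
  - by apply: differentiable_bigsum => a; apply: (@differentiableM _ _ ('D_'e_p (coordinate F a))).
  - by move=> v; exact: side_dir.
  - move: GE; apply: filterS => y h /h ->; rewrite mxE; apply: eq_bigr => a _.
    by rewrite !mxE.
pose u : E := \row_a 'D_'e_i ('D_'e_j (coordinate F a)) x.
have JE k a : Jm F x k a = 'D_'e_k (coordinate F a) x by rewrite mxE.
have uE a : u^T a 0 = 'D_'e_i ('D_'e_j (coordinate F a)) x by rewrite !mxE.
have DE l : 'D_'e_i (fun y => G y j l) x + 'D_'e_j (fun y => G y i l) x
    - 'D_'e_l (fun y => G y i j) x = 2 * (Jm F x *m u^T) l 0.
  have [d1 d1E] : exists d1 : 'I_m.+1 -> 'I_m.+1 -> R,
      forall k a, d1 k a = 'D_'e_k (coordinate F a) x.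
    by exists (fun k a => 'D_'e_k (coordinate F a) x).
  have [d2 d2E] : exists d2 : 'I_m.+1 -> 'I_m.+1 -> 'I_m.+1 -> R,
      forall k l a, d2 k l a = 'D_'e_k ('D_'e_l (coordinate F a)) x.
    exists (fun k l a => 'D_'e_k ('D_'e_l (coordinate F a)) x); reflexivity.
  have d2C k l' a : d2 k l' a = d2 l' k a by rewrite !d2E; exact: sym.
  have {}DG k p q : 'D_'e_k (fun y => G y p q) x =
      \sum_a (d2 k p a * d1 q a + d1 p a * d2 k q a).
    by rewrite DG; apply: eq_bigr => a _; rewrite !d1E !d2E.
  have {}JE a : Jm F x l a * u^T a 0 = d1 l a * d2 i j a by rewrite JE uE d1E d2E.
  rewrite !DG -big_split -sumrB mxE mulr_sumr; apply: eq_bigr => a _ /=.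
  by rewrite JE (d2C j l) (d2C l i) (d2C j i) first_kind_identity.
move: ch; rewrite /christoffel; under eq_bigr do rewrite DE mulrCA.
rewrite -mulr_sumr mulrA mulVf // mul1r.
rewrite (_ : \sum_l _ = (invmx (G x) *m (Jm F x *m u^T)) ord0 0); last first.
  by rewrite [RHS]mxE.
have Gx : G x = Jm F x *m (Jm F x)^T by exact: (nbhs_singleton GE).
have Gu : G x \in unitmx by rewrite Gx unitmx_mul Ju unitmx_tr.
(* Since G = J J^T, raising the index gives the coefficients of the second derivative in the basis
   of rows of J; the one of index 0 is, up to the determinant, its product with column 0 of the
   adjugate. *)
have -> : invmx (G x) *m (Jm F x *m u^T) = (invmx (Jm F x))^T *m u^T.
  rewrite mulmxA; congr (_ *m _); rewrite trmx_inv.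
  apply: (can_inj (mulmxK (_ : (Jm F x)^T \in unitmx))); first by rewrite unitmx_tr.
  by rewrite -mulmxA -Gx mulVmx // mulVmx // unitmx_tr.
move=> h; have -> : \adj (Jm F x) = \det (Jm F x) *: invmx (Jm F x).
  by rewrite /invmx Ju scalerA divff ?scale1r //; move: Ju; rewrite unitmxE unitfE.
transitivity (\det (Jm F x) * ((invmx (Jm F x))^T *m u^T) ord0 0); last by rewrite h mulr0.
rewrite mxE mulr_sumr; apply: eq_bigr => a _; rewrite mxE [in RHS]mxE uE mulrCA; congr (_ * _); exact: mulrC.
Qed.

End christoffel_symbols.

(** * Charts, boundary points and half-ball patches *)

Section flat_manifolds.
Context {R : realType} {m : nat} {T : topologicalType}.
Variable A : set (rchart R T m.+1).
Hypothesis RM : riemannian_manifold A.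
Local Notation E := 'rV[R]_m.+1.
Local Notation bdry := (boundary A).
Implicit Types (c : rchart R T m.+1) (p q : T) (U : set T) (f : T -> E).

Lemma chart_of_point p : exists2 c, A c & rdom c p.
Proof. by case: RM. Qed.

Lemma rmetric_unit c p : A c -> rdom c p -> rmetric c p \in unitmx.
Proof.
case: RM => _ _ _ h _ /h[_ /(_ p)cm] /cm[_ _ pos].
by apply: posdef_unit => v /pos; rewrite dotpE.
Qed.

Lemma rdom_nbhs c p : A c -> rdom c p -> nbhs p (rdom c).
Proof. by case: RM => _ _ _ h _ /h[[oc _ _ _] _] cp; exact: open_nbhs_nbhs. Qed.

Lemma rcoord_inj c p q : A c -> rdom c p -> rdom c q -> rcoord c p = rcoord c q -> p = q.
Proof.
by case: RM => _ _ _ h _ /h[[_ ic _ _] _] cp cq; apply: ic; exact/mem_set.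
Qed.

Lemma rcoord_near c p N : A c -> rdom c p -> nbhs (rcoord c p) N ->
  \forall q \near p, N (rcoord c q).
Proof. by case: RM => _ _ _ h _ /h[[_ _ cc _] _] /cc; exact. Qed.

(** Openness of the chart at [p], relative to a half-space if [b]. As the preimages are found in any
    given [W], it includes continuity of the inverse. *)
Definition covers (b : bool) c p := forall W, nbhs p W -> exists2 r, 0 < r &
  forall x, en (x - rcoord c p) < r -> side b x ->
    exists q, [/\ W q, rdom c q & rcoord c q = x].

Lemma half_chart_covers c p : A c -> half_chart c -> rdom c p -> covers true c p.
Proof.
move=> Ac hc cp W nW.
have [|V oV VE] := hc (W^° `&` rdom c) _ (@subIsetr _ _ _).
  by apply: openI; [exact: open_interior|case: RM => _ _ _ h _; have [[]] := h _ Ac].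
have : V (rcoord c p).
  have : (rcoord c @` (W^° `&` rdom c)) (rcoord c p) by exists p.
  by rewrite VE => -[].
move=> Vp; have /nbhs_enP[r r0 hr] : nbhs (rcoord c p) V by exact: open_nbhs_nbhs.
exists r => // x /hr Vx /(_ isT) x0.
have : (V `&` @half_space R m) x by [].
by rewrite -VE => -[q [Wq cq] qx]; exists q; split=> //; exact: interior_subset.
Qed.

Lemma half_chart_ge0 c p : A c -> half_chart c -> rdom c p -> 0 <= ht (rcoord c p).
Proof.
move=> Ac hc cp; have [|V oV VE] := hc (rdom c) _ (@subset_refl _ _).
  by case: RM => _ _ _ h _; have [[]] := h _ Ac.
have : (rcoord c @` rdom c) (rcoord c p) by exists p.
by rewrite VE => -[].
Qed.

Lemma interior_chart_covers c p : A c -> interior_chart c -> rdom c p -> covers false c p.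
Proof.
move=> Ac ic cp W nW.
have oV : open (rcoord c @` (W^° `&` rdom c)).
  apply: ic (@subIsetr _ _ _); apply: openI; first exact: open_interior.
  by case: RM => _ _ _ h _; have [[]] := h _ Ac.
have /nbhs_enP[r r0 hr] : nbhs (rcoord c p) (rcoord c @` (W^° `&` rdom c)).
  by apply: open_nbhs_nbhs; split=> //; exists p.
exists r => // x /hr[q [Wq cq] qx] _; exists q; split=> //; exact: interior_subset.
Qed.

Lemma covers_interior c p : covers true c p -> 0 < ht (rcoord c p) -> covers false c p.
Proof.
move=> cv p0 W /cv[r r0 hr]; have /nbhs_enP[d d0 hd] := near_coord_gt p0.
exists (Num.min r d); first by rewrite lt_min r0.
by move=> x; rewrite lt_min => /andP[xr /hd/ltW x0] _; exact: hr.
Qed.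

(** The height coordinate of a half-chart, read in [c], would have an interior minimum at [p]; its
    gradient would vanish there, although the coordinate change has an invertible Jacobian. *)
Lemma covers_not_boundary c p : A c -> rdom c p -> covers false c p -> ~ bdry p.
Proof.
move=> Ac cp cv [c' [Ac' hc' c'p p0]].
have [V [F [oV Vp sF FE mE]]] : isometric_at c c' id p.
  by case: RM => _ _ _ _; apply.
pose x0 := rcoord c p.
have dF a : differentiable (coordinate F a) x0 by exact: (sF a [::]).
have F0 : ht (F x0) = 0 by rewrite -FE.
have nV : nbhs x0 V by exact: open_nbhs_nbhs.
have [r r0 hr] := cv _ (filterI (rcoord_near Ac cp nV) (rdom_nbhs Ac' c'p)).
have Fge x : en (x - x0) < r -> 0 <= coordinate F ord0 x.
  move=> xr; have [//|q [[Vq c'q] cq <-]] := hr x xr.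
  rewrite /coordinate -FE //; exact: half_chart_ge0.
have grad v : 0 <= 'D_v (coordinate F ord0) x0.
  apply: derive_min_ge0 => //.
  have /near_line[d d0 hd] : nbhs (x0 + 0 *: v) [set x | en (x - x0) < r].
    by rewrite scale0r addr0; exact: near_en.
  move: (near_right_itv d0); apply: filterS => t /andP[t0 td].
  have -> : coordinate F ord0 x0 = 0 by exact: F0.
  by apply/Fge/hd; rewrite subr0 gtr0_norm.
have Dz v : 'D_v (coordinate F ord0) x0 = 0.
  by apply/eqP; rewrite eq_le grad andbT -oppr_ge0 -deriveN_dir.
have : (Jm F x0) \in unitmx.
  have := rmetric_unit Ac cp; rewrite mE jacobianE //.
  by rewrite !unitmx_mul => /andP[/andP[]].
move=> Ju; have e0 : ('e_ord0 : E) = 0.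
  by apply: (row_kernel Ju) => i; rewrite dotp_delta !mxE Dz.
have := @ht_e0 R m; rewrite e0 /ht mxE => /esym/eqP; by rewrite oner_eq0.
Qed.

(** A half-chart may also contain [p] at positive height; near such a point it behaves like an
    interior chart and counts as [b = false]. *)
Lemma good_chart p : exists c (b : bool), [/\ A c, rdom c p,
  b -> half_chart c /\ ht (rcoord c p) = 0 &
  \forall q \near p, rdom c q -> [/\ covers b c q, side b (rcoord c q) &
     bdry q <-> b /\ ht (rcoord c q) = 0]].
Proof.
have [[c [Ac hc cp p0]]|nb] := pselect (bdry p).
  exists c, true; split=> //; near=> q => cq; split.
  - exact: half_chart_covers.
  - by move=> _; exact: half_chart_ge0.
  - split=> [bq|[_ q0]]; last by exists c.
    split=> //; apply/eqP; rewrite eq_le half_chart_ge0 // andbT leNgt; apply/negP => q0.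
    exact: (covers_not_boundary Ac cq (covers_interior (half_chart_covers Ac hc cq) q0)).
have [c Ac cp] := chart_of_point p; exists c, false; split=> //.
suff : \forall q \near p, rdom c q -> covers false c q.
  apply: filterS => q cv cq; split=> //; first exact: cv.
  by split=> [/(covers_not_boundary Ac cq (cv cq))|[]].
have [ic|hc] : interior_chart c \/ half_chart c.
  by case: RM => _ _ _ h _; have [[]] := h _ Ac.
  by near=> q; exact: interior_chart_covers.
have p0 : 0 < ht (rcoord c p).
  rewrite lt_neqAle half_chart_ge0 // andbT eq_sym; apply/eqP => p0.
  by apply: nb; exists c.
move: (rcoord_near Ac cp (near_coord_gt p0)); apply: filterS => q q0 cq.
by apply: covers_interior => //; exact: half_chart_covers.
Unshelve. all: by end_near. Qed.

Definition flat_dev U f := [/\ open U, {in U &, injective f} &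
  local_isometry A [set euclidean_chart] U f].

Lemma dev_local U f c p : flat_dev U f -> A c -> U p -> rdom c p ->
  exists V F, [/\ open V, V (rcoord c p), forall a, smooth_on V (coordinate F a),
    forall q, rdom c q -> V (rcoord c q) -> f q = F (rcoord c q) &
    rmetric c p = Jm F (rcoord c p) *m (Jm F (rcoord c p))^T].
Proof.
move=> [oU _ lf] Ac Up cp.
have [V [F [oV Vp sF FE mE]]] := lf c euclidean_chart p Ac erefl Up cp I.
exists V, F; split=> //; first by move=> q cq Vq; exact: FE.
by rewrite mE mulmx1 jacobianE // => j; exact: (sF j [::]).
Qed.

Lemma dev_inj U f p q : flat_dev U f -> U p -> U q -> f p = f q -> p = q.
Proof. by move=> [_ fi _] Up Uq; apply: fi; exact/mem_set. Qed.

Lemma dev_near U f p N : flat_dev U f -> U p -> nbhs (f p) N ->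
  \forall q \near p, N (f q).
Proof.
move=> df Up /nbhs_enP[r r0 hr]; have [c Ac cp] := chart_of_point p.
have [V [F [oV Vp sF FE _]]] := dev_local df Ac Up cp.
have dF a : differentiable (coordinate F a) (rcoord c p) by exact: (sF a [::]).
have nV : nbhs (rcoord c p) V by exact: open_nbhs_nbhs.
move: (rcoord_near Ac cp (differentiable_near_en dF r0)) (rcoord_near Ac cp nV) (rdom_nbhs Ac cp).
apply: filterS3 => q h Vq cq; apply: hr; by rewrite !FE.
Qed.

Lemma dev_comparison U f U' f' p e : flat_dev U f -> flat_dev U' f' -> U p -> U' p ->
  0 < e -> \forall q \near p, en (f' q - f' p) <= (1 + e) * en (f q - f p).
Proof.
move=> df df' Up Up' e0; have [c Ac cp] := chart_of_point p.
have [V [F [oV Vp sF FE mE]]] := dev_local df Ac Up cp.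
have [V' [F' [oV' Vp' sF' FE' mE']]] := dev_local df' Ac Up' cp.
have dF a : differentiable (coordinate F a) (rcoord c p) by exact: (sF a [::]).
have dF' a : differentiable (coordinate F' a) (rcoord c p) by exact: (sF' a [::]).
have nV : nbhs (rcoord c p) (V `&` V') by apply: filterI; exact: open_nbhs_nbhs.
have h := metric_comparison (Jm_first_order dF) (Jm_first_order dF') (esym mE) (esym mE')
  (rmetric_unit Ac cp) e0.
move: (rcoord_near Ac cp h) (rcoord_near Ac cp nV) (rdom_nbhs Ac cp).
by apply: filterS3 => q {}h [Vq Vq'] cq; rewrite !FE // !FE'.
Qed.

Definition flat_patches : set (@patch R T m.+1) :=
  [set P | exists U f, [/\ flat_dev U f, pnor P != 0 -> en (pnor P) = 1,
    forall y, pdom P y -> [/\ U (pmap P y), f (pmap P y) = y &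
      bdry (pmap P y) <-> pnor P != 0 /\ dotp y (pnor P) = poff P],
    forall y N, pdom P y -> nbhs (pmap P y) N -> \forall z \near y, pdom P z -> N (pmap P z) &
    forall y, pdom P y -> \forall q \near pmap P y, U q /\ poff P <= dotp (f q) (pnor P)]].

Hypothesis FA : flat A.
Hypothesis TG : totally_geodesic_boundary A.

(** The patch inverts the expression [F] of the developing map in a good chart: [half_space_image]
    straightens the face and [image_nbhs] provides a half-ball in the image. *)
Lemma flat_patch_exists p : exists P,
  [/\ flat_patches P, pdom P (pcen P) & pmap P (pcen P) = p].
Proof.
have [U [f [oU Up fi lf]]] := FA p; have df : flat_dev U f by [].
have [c [b [Ac cp bc near_p]]] := good_chart p.
have [V [F [oV Vp sF FE _]]] := dev_local df Ac Up cp.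
pose x0 := rcoord c p.
have nV : nbhs x0 V by exact: open_nbhs_nbhs.
have nU : nbhs p U by exact: open_nbhs_nbhs.
have [cv sx0 _] := nbhs_singleton near_p cp.
have [r1 r10 hr1] := cv _ (filterI near_p (filterI nU (rcoord_near Ac cp nV))).
have /nbhs_enP[r2 r20 hr2] := nV.
pose r := Num.min r1 r2.
have r0 : 0 < r by rewrite lt_min r10.
have rV x : en (x - x0) < r -> V x by rewrite lt_min => /andP[_ /hr2].
have pre x : en (x - x0) < r -> side b x -> exists q, [/\ rdom c q, rcoord c q = x, U q,
    covers b c q & bdry q <-> b /\ ht x = 0].
  rewrite lt_min => /andP[/hr1 h _] /h[q [[/(_ _) nq [Uq Vq]] cq qx]].
  by exists q; have [cvq sq bq] := nq cq; split=> //; rewrite -qx.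
have dF x a : V x -> differentiable (coordinate F a) x by exact: (sF a [::]).
have fF q : rdom c q -> en (rcoord c q - x0) < r -> f q = F (rcoord c q).
  by move=> cq qr; apply: FE => //; exact: rV.
(* At each point [q] the metric is first expressed by a local representative [F'] of [f]; on the
   covered side it coincides with [F], and so do the derivatives. *)
have metE x : en (x - x0) < r -> side b x -> forall q, rdom c q -> rcoord c q = x -> U q ->
    rmetric c q = Jm F x *m (Jm F x)^T.
  move=> xr sx q cq qx Uq; have [V' [F' [oV' Vq' sF' FE' ->]]] := dev_local df Ac Uq cq.
  suff -> : Jm F' (rcoord c q) = Jm F x by [].
  rewrite qx in Vq' *; apply: (Jm_eq_side (b := b)) => //.
  - by move=> a; exact: (sF' a [::]).
  - by move=> a; apply: dF; exact: rV.
  have nV' : nbhs x V' by exact: open_nbhs_nbhs.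
  move: (near_ball xr) nV'; apply: filterS2 => y yr Vy sy.
  have [q' [cq' q'y _ _ _]] := pre y yr sy.
  by move: Vy yr; rewrite -q'y => Vy yr; rewrite -FE' // -fF.
have uF x : en (x - x0) < r -> side b x -> Jm F x \in unitmx.
  move=> xr sx; have [q [cq qx Uq _ _]] := pre x xr sx.
  have := rmetric_unit Ac cq; rewrite (metE x xr sx q cq qx Uq).
  by rewrite unitmx_mul => /andP[].
have iF x y : en (x - x0) < r -> side b x -> en (y - x0) < r -> side b y -> F x = F y -> x = y.
  move=> xr sx yr sy; have [q [cq qx Uq _ _]] := pre x xr sx.
  have [q' [cq' q'y Uq' _ _]] := pre y yr sy; subst x y.
  by rewrite -!fF // => /(dev_inj df Uq Uq') ->.
(* Away from the boundary [n = 0] makes the half-space condition void. *)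
have [n [d [n1 d0 dr hn]]] : exists n d, [/\ b -> en n = 1, 0 < d, d <= r &
   (~~ b -> n = 0) /\ (b -> forall x, en (x - x0) < d -> 0 <= ht x ->
   [/\ 0 <= dotp (F x - F x0) n, dotp (F x - F x0) n = 0 <-> ht x = 0,
       0 < dotp (row ord0 (Jm F x)) n &
       ht x = 0 -> forall i, i != ord0 -> dotp (row i (Jm F x)) n = 0])].
  have [bt|nb] := boolP b; last by exists 0, r; split.
  have [hc hx0] := bc bt.
  have side_t x : 0 <= ht x -> side b x by move=> hx _.
  have [||n [d [n1 d0 dr hn]]] := @half_space_image R m F V x0 r sF r0 rV hx0.
  - by move=> x xr hx; apply: uF => //; exact: side_t.
  - move=> x xr hx i j i0 j0.
    have sx : side b x by apply: side_t; rewrite hx.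
    have [q [cq qx Uq _ _]] := pre x xr sx.
    have [|V' [G [[oV' Vq' sG GE] ch]]] := TG Ac hc cq; first by rewrite qx.
    rewrite qx in Vq' ch.
    have := christoffel_dev (b := b) (i := i) (j := j) oV (rV _ xr) sF _ (uF _ xr sx) sx _ (ch i j i0 j0).
    move=> h; transitivity (\sum_a 'D_'e_i ('D_'e_j (coordinate F a)) x * \adj (Jm F x) a ord0).
      by apply: eq_bigr => a _; rewrite [in LHS]mxE.
    apply: h; first by move=> i' j'; exact: (sG i' j' [::]).
    have nV' : nbhs x V' by exact: open_nbhs_nbhs.
    move: (near_ball xr) nV'; apply: filterS2 => y yr Vy sy.
    have [q' [cq' q'y Uq' _ _]] := pre y yr sy.
    by rewrite -(metE y yr sy q' cq' q'y Uq') GE ?q'y.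
  - by exists n, d; split=> //; split.
have [nb0 {}hn] := hn.
have d20 : 0 < d / 2 by rewrite divr_gt0.
have d2d : d / 2 < d by lra.
have drl x : en (x - x0) < d / 2 -> en (x - x0) < d by move=> h; exact: lt_trans d2d.
have drr x : en (x - x0) < d -> en (x - x0) < r by move=> h; exact: lt_le_trans dr.
have Fn x : en (x - x0) < d -> side b x -> 0 <= dotp (F x - F x0) n.
  move=> xd sx; have [bt|/nb0 ->] := boolP b; last by rewrite dotp0r.
  by have [] := hn bt x xd (sx bt).
have [|||||dl dl0 hdl] := @image_nbhs R m b F x0 (d / 2) n d20.
- by move=> x /drl/drr xr sx a; apply: dF; exact: rV.
- by move=> x /drl/drr xr sx; exact: uF.
- by move=> x y /drl/drr xr sx /drl/drr yr sy; exact: iF.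
- exact: sx0.
- move=> bt x /drl xd hx; have [|_ [_ h] h' h''] := hn bt x xd; first by rewrite hx.
  by split; [exact: h|exact: h'|exact: h''].
have /choice[pm hpm] : forall y, exists q, en (y - F x0) < dl -> 0 <= dotp (y - F x0) n ->
    [/\ rdom c q, side b (rcoord c q), en (rcoord c q - x0) < d / 2, U q &
      F (rcoord c q) = y].
  move=> y; have [yd|nyd] := pselect (en (y - F x0) < dl); last by exists p.
  have [yn|nyn] := pselect (0 <= dotp (y - F x0) n); last by exists p.
  have [x [sx xd Fx]] := hdl y yd yn; have [q [cq qx Uq _ _]] := pre x (drr _ (drl _ xd)) sx.
  by exists q; rewrite qx.
pose P := Patch (F x0) dl n (dotp (F x0) n) pm.
have pdomE y : pdom P y <-> en (y - F x0) < dl /\ 0 <= dotp (y - F x0) n.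
  by rewrite /pdom /P /= dotpDl dotpNl subr_ge0.
have bq q : rdom c q -> en (rcoord c q - x0) < d -> side b (rcoord c q) ->
    bdry q <-> b /\ ht (rcoord c q) = 0.
  move=> cq qd sq; have [q' [cq' q'q _ _ bq']] := pre _ (drr _ qd) sq.
  by move: bq'; rewrite (rcoord_inj Ac cq' cq q'q).
have pF : f p = F x0 by apply: fF => //; rewrite subrr en0.
have pP : pdom P (pcen P) by apply/pdomE; rewrite subrr en0 dotp0l.
have pmp : pm (F x0) = p.
  have [||cq sq qd Uq Fq] := hpm (F x0); rewrite ?subrr ?en0 ?dotp0l //.
  apply: (rcoord_inj Ac) => //; apply: iF => //; first exact/drr/drl.
  by rewrite subrr en0.
exists P; split=> //; exists U, f; split=> //.
- move=> n0; apply: n1; apply/negPn/negP => /nb0 e; by rewrite /= e eqxx in n0.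
- move=> y /pdomE[yd yn]; have [cq sq qd Uq Fq] := hpm y yd yn.
  have fq : f (pm y) = y by rewrite fF //; exact/drr/drl.
  split=> //; rewrite (bq _ cq (drl _ qd) sq) /=.
  have [bt|nb] := boolP b; last by rewrite (nb0 nb) eqxx; split=> -[].
  have [_ hF _ _] := hn bt _ (drl _ qd) (sq bt).
  have n0 : n != 0 by rewrite -en_eq0 n1 // oner_neq0.
  rewrite n0 -hF Fq dotpDl dotpNl; split=> -[_ h]; split=> //.
    by apply/eqP; rewrite -subr_eq0; apply/eqP.
  by rewrite h subrr.
- move=> y N /pdomE[yd yn] nN; have [cq sq qd Uq Fq] := hpm y yd yn.
  set q := pm y in nN cq sq qd Uq Fq *; set x := rcoord c q in sq qd Fq *.
  have [q2 [cq2 q2x _ cv2 _]] := pre x (drr _ (drl _ qd)) sq.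
  have q2E : q2 = q by exact: (rcoord_inj Ac).
  rewrite q2E in cv2; have [e e0 he] := cv2 N nN; rewrite -/x in he.
  (* Continuity of the inverse by compactness: the points of the half-ball at distance at least [e]
     from [x] have images at a positive distance from [y]. *)
  pose C := [set x' | en (x' - x0) <= d / 2 /\ side b x'] `&` [set x' | e <= en (x' - x)].
  have cC : compact C.
    apply: compact_closedI; first exact: compact_side_ball.
    rewrite -[X in closed X]setCK; apply: open_closedC; rewrite openE => x' /= /negP.
    by rewrite -ltNge => /near_ball; apply: filterS => z zx; apply/negP; rewrite -ltNge.
  have Cr x' : C x' -> en (x' - x0) < r by move=> [[h _] _]; apply: drr; lra.
  have [||g g0 hg] := @compact_separated _ _ _ F C y cC.
  - by move=> x' Cx' a; apply: dF; apply: rV; exact: Cr.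
  - move=> x' Cx'; rewrite -Fq => /(iF _ _ (Cr _ Cx') Cx'.1.2 (drr _ (drl _ qd)) sq) e'.
    by move: Cx'.2; rewrite /= e' subrr en0; lra.
  move: (near_en y g0); apply: filterS => z zy /pdomE[zd zn].
  have [cz sz zd' Uz Fz] := hpm z zd zn.
  have [|q' [Nq' cq' q'z]] := he (rcoord c (pm z)) _ sz.
    rewrite ltNge; apply/negP => ez.
    have /hg : C (rcoord c (pm z)) by split=> //; split=> //; exact: ltW.
    by rewrite Fz enB leNgt enB zy.
  by rewrite /= -(rcoord_inj Ac cq' cz q'z).
- move=> y /pdomE[yd yn]; have [cq sq qd Uq Fq] := hpm y yd yn.
  have nUq : nbhs (pm y) U by exact: open_nbhs_nbhs.
  move: (rcoord_near Ac cq (near_ball qd)) (rdom_nbhs Ac cq) nUq.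
  apply: filterS3 => q qd' cq' Uq'; split=> //=.
  have sq' : side b (rcoord c q) by move=> bt; apply: half_chart_ge0 => //; have [] := bc bt.
  rewrite -subr_ge0 -dotpNl -dotpDl fF //; last exact/drr/drl.
  by apply: Fn => //; exact: drl.
Qed.

End flat_manifolds.

(** * Transition maps between patches *)

Section flat_manifold_space.
Context {R : realType} {m : nat} {T : topologicalType}.
Variable A : set (rchart R T m.+1).
Hypothesis RM : riemannian_manifold A.
Hypothesis FA : flat A.
Hypothesis TG : totally_geodesic_boundary A.
Local Notation E := 'rV[R]_m.+1.
Local Notation bdry := (boundary A).
Implicit Types (P : @patch R T m.+1) (y z : E).

Lemma cvx_pdom P : cvx (pdom P).
Proof.
move=> x y t [xr xn] [yr yn] t01; split; first exact: cvx_en.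
case/andP: t01 => t0 t1; rewrite !dotpB; nra.
Qed.

Lemma fat_pdom_ball P c r : (pnor P != 0 -> en (pnor P) = 1) ->
  fat (pdom P `&` [set z | en (z - c) < r]).
Proof.
move=> n1 z N [[zr zn] zc] nN; have [n0|n0] := eqVneq (pnor P) 0.
  exists z; first exact: nbhs_singleton.
  apply: filterI; last exact: near_ball.
  move: (near_ball zr); apply: filterS => w wr; split=> //.
  by move: zn; rewrite n0 !dotp0r.
have : nbhs (z + 0 *: pnor P) (N `&` [set w | en (w - pcen P) < prad P /\ en (w - c) < r]).
  rewrite scale0r addr0; apply: filterI => //.
  by apply: filterI; exact: near_ball.
move=> /near_line[d d0 hd]; have [|Nz [zr' zc']] := hd (d / 2).
  by rewrite subr0 gtr0_norm; lra.
have nn : dotp (pnor P) (pnor P) = 1 by rewrite -en_sqr n1 // expr1n.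
exists (z + (d / 2) *: pnor P) => //; apply: filterI; last exact: near_ball.
have : poff P < dotp (z + (d / 2) *: pnor P) (pnor P) by rewrite !dotpB nn; lra.
move=> /near_dotp_gt; move: (near_ball zr'); apply: filterS2 => w wr wn.
by split=> //; exact: ltW.
Qed.

(** The map [u] compares two developing maps of the same metric, so it is infinitesimally short,
    hence distance-nonincreasing on a convex set. The opposite inequality comes from exchanging the
    patches. *)
Lemma flat_transition P P' y y' : flat_patches A P -> flat_patches A P' ->
  pdom P y -> pdom P' y' -> pmap P y = pmap P' y' ->
  exists u : E -> E, exists2 r, 0 < r & u y = y' /\
    forall z, pdom P z -> en (z - y) < r ->
    [/\ pdom P' (u z), pmap P z = pmap P' (u z) &
        forall z', pdom P z' -> en (z' - y) < r -> en (u z - u z') <= en (z - z')].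
Proof.
move=> [U [f [df n1 hp hc hb]]] [U' [f' [df' n1' hp' hc' hb']]] yP yP' yy.
have [Uy' fy' _] := hp' y' yP'.
have [Uy fy _] := hp y yP.
pose u z := f' (pmap P z); have uy : u y = y' by rewrite /u yy.
have nW : \forall q \near pmap P y,
    (U q /\ U' q) /\ (poff P' <= dotp (f' q) (pnor P') /\ en (f' q - pcen P') < prad P').
  rewrite yy; apply: filterI.
    apply: filterI; last by move: (hb' y' yP'); apply: filterS => q [].
    by rewrite -yy; move: (hb y yP); apply: filterS => q [].
  apply: filterI; first by move: (hb' y' yP'); apply: filterS => q [].
  apply: (dev_near (N := [set w | en (w - pcen P') < prad P']) RM df' Uy'); rewrite fy'; apply: near_ball; by case: yP'.
have /nbhs_enP[r r0 hr] := hc y _ yP nW.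
exists u, r => //; split=> // z zP zr; have [[Uz Uz'] [zn zr']] := hr z zr zP.
have uP : pdom P' (u z) by [].
have [Uu fu _] := hp' _ uP.
split=> //; first by apply/esym/(dev_inj df').
move=> z' zP' zr2.
apply: (@infinitesimally_short_lip R _ _ (pdom P `&` [set w | en (w - y) < r]) u) => //.
  by move=> a b t [aP ar] [bP br] t01; split; [exact: cvx_pdom|exact: cvx_en].
move=> a [aP ar] e e0; have [[Ua Ua'] _] := hr a ar aP.
have := hc a _ aP (dev_comparison RM df df' Ua Ua' e0).
apply: filterS => b hb2 [bP br]; have := hb2 bP.
by have [_ -> _] := hp b bP; have [_ -> _] := hp a aP.
Qed.

Theorem flat_manifold_space : flat_space (flat_patches A) bdry.
Proof.
apply: FlatSpace.
- by case: RM.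
- exact: flat_patch_exists.
- move=> P c r [U [f [df n1 hp hc hb]]] cP r0 cr.
  have sub y : pdom (Patch c r (pnor P) (poff P) (pmap P)) y -> pdom P y.
    move=> [/= yr yn]; split=> //; have := en_triangleB c y (pcen P); lra.
  exists U, f; split=> //.
  + by move=> y /sub; exact: hp.
  + move=> y N /sub yP nN; move: (hc y N yP nN).
    by apply: filterS => z h /sub; exact: h.
  + by move=> y /sub; exact: hb.
- move=> P y y' [U [f [_ _ hp _ _]]] /hp[_ fy _] /hp[_ fy' _] e.
  by rewrite -fy e.
- by move=> P y N [U [f [_ _ _ hc _]]]; exact: hc.
- move=> P y N [U [f [df n1 hp hc hb]]] yP nN; have [Uy fy _] := hp y yP.
  have nN' : nbhs (f (pmap P y)) (N `&` [set z | en (z - pcen P) < prad P]).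
    by rewrite fy; apply: filterI => //; apply: near_ball; case: yP.
  move: (hb y yP) (dev_near RM df Uy nN'); apply: filterS2 => q [Uq qn] [Nq qr].
  have qP : pdom P (f q) by [].
  exists (f q) => //; have [Uf ff _] := hp _ qP.
  exact: (dev_inj df).
- move=> P P' y y' hP hP' yP yP' yy.
  (* Both transition maps are distance-nonincreasing and mutually inverse near [y], so [u] is
     isometric. An interior point [p] of its domain leaves room for the frame needed to extend it
     affinely. *)
  have [u [r r0 [uy hu]]] := flat_transition hP hP' yP yP' yy.
  have [v [s s0 [_ hv]]] := flat_transition hP' hP yP' yP (esym yy).
  pose t := Num.min r s; have t0 : 0 < t by rewrite lt_min r0.
  pose D := pdom P `&` [set z | en (z - y) < t].
  have Dr z : D z -> en (z - y) < r by move=> [_]; rewrite /= lt_min => /andP[].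
  have us z : D z -> en (u z - y') < s.
    move=> Dz; have [_ _ /(_ y)] := hu z Dz.1 (Dr z Dz); rewrite uy subrr en0 => /(_ yP r0).
    by move=> h; apply: (le_lt_trans h); case: Dz => _; rewrite /= lt_min => /andP[].
  have vu z : D z -> v (u z) = z.
    move=> Dz; have [uP ue _] := hu z Dz.1 (Dr z Dz).
    have [vP ve _] := hv _ uP (us z Dz).
    case: hP => U [f [_ _ hp _ _]]; have [_ e1 _] := hp _ Dz.1; have [_ e2 _] := hp _ vP.
    by rewrite -e2 -ve -ue e1.
  have iso z w : D z -> D w -> en (u z - u w) = en (z - w).
    move=> Dz Dw; apply/eqP; rewrite eq_le; apply/andP; split.
      by have [_ _] := hu z Dz.1 (Dr z Dz); apply; [exact: Dw.1|exact: Dr].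
    have [uz _ _] := hu z Dz.1 (Dr z Dz); have [uw _ _] := hu w Dw.1 (Dr w Dw).
    have [_ _ /(_ _ uw (us w Dw))] := hv _ uz (us z Dz).
    by rewrite !vu.
  have n1 : pnor P != 0 -> en (pnor P) = 1 by case: hP => U [f []].
  have Dy : D y by split=> //=; rewrite subrr en0.
  have [p _ /nbhs_enP[e e0 he]] := fat_pdom_ball n1 Dy filterT.
  have [|||g ig ug] := @affine_isometry_ext R _ D u p (e / 2) _ _ _ iso.
  + by apply: lt0r_neq0; lra.
  + by apply: he; rewrite subrr en0.
  + by move=> i; apply: he; rewrite addrKl enZ en_delta mulr1 gtr0_norm; lra.
  exists g; split=> //; first by rewrite -ug.
  move: (near_en y t0); apply: filterS => z zt zP.
  have Dz : D z by [].
  by rewrite -ug //; have [] := hu z zP (Dr z Dz).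
- by move=> P y [U [f [_ _ hp _ _]]] /hp[].
- by move=> P [U [f []]].
Qed.

End flat_manifold_space.

(** * The boundary of a flat manifold *)

Section boundary_parametrization.
Context {R : realType} {m : nat} {T : topologicalType}.
Variable A : set (rchart R T m.+1).
Hypothesis RM : riemannian_manifold A.
Hypothesis FA : flat A.
Hypothesis TG : totally_geodesic_boundary A.
Variable iota : 'rV[R]_m -> T.
Hypothesis iota_bd : forall x, boundary A (iota x).
Hypothesis iota_cont : forall x N, nbhs (iota x) N -> \forall y \near x, N (iota y).
Hypothesis iota_open : forall x r, 0 < r -> \forall q \near iota x, boundary A q ->
  exists2 y, en (y - x) < r & iota y = q.
Hypothesis iota_inj : forall x, exists2 r, 0 < r & forall y z,
  en (y - x) < r -> en (z - x) < r -> iota y = iota z -> y = z.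
Hypothesis iota_jac : forall x U f, flat_dev A U f -> U (iota x) ->
  exists2 J : 'M[R]_(m, m.+1), has_jac (f \o iota) x J & J *m J^T = 1%:M.
Let FS := flat_manifold_space RM FA TG.

Lemma has_jac_id k (x : 'rV[R]_k) : has_jac id x 1%:M.
Proof. by move=> e e0; near=> y; rewrite mulmx1 subrr en0 mulr_ge0 ?en_ge0 ?ltW.
Unshelve. all: by end_near. Qed.

Lemma parametrization_comparison x U f e : flat_dev A U f -> U (iota x) -> 0 < e ->
  \forall y \near x, en (f (iota y) - f (iota x)) <= (1 + e) * en (y - x) /\
    en (y - x) <= (1 + e) * en (f (iota y) - f (iota x)).
Proof.
move=> df Ux e0; have [J hJ JJ] := iota_jac df Ux.
have I1 : (1%:M : 'M[R]_m) *m 1%:M^T = 1%:M by rewrite trmx1 mulmx1.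
have := metric_comparison (has_jac_id x) hJ I1 JJ (unitmx1 _ _) e0.
have := metric_comparison hJ (has_jac_id x) JJ I1 (unitmx1 _ _) e0.
by apply: filterS2 => y; split.
Qed.

(** The developed parametrization [h] and its local inverse [k] are both infinitesimally short, and
    both have convex domains: a ball in R^m and a flat disc in the face of the patch. *)
Lemma parametrization_isometric x P y : flat_patches A P -> pdom P y ->
  pmap P y = iota x -> exists2 r, 0 < r & exists h, [/\ h x = y,
    forall x', en (x' - x) < r -> [/\ pdom P (h x'), pmap P (h x') = iota x' &
       dotp (h x') (pnor P) = poff P] &
    forall x' x'', en (x' - x) < r -> en (x'' - x) < r ->
      en (h x' - h x'') = en (x' - x'')].
Proof.
move=> hP yP yx; have [U [f [df n1 hp hc hb]]] := hP.
have [Uy fy by_] := hp y yP.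
have [n0 yn] : pnor P != 0 /\ dotp y (pnor P) = poff P by apply/by_; rewrite yx.
pose h x' := f (iota x').
have hx : h x = y by rewrite /h -yx.
have [ri ri0 hri] := iota_inj x.
have [s s0 hs] : exists2 s, 0 < s & forall z, en (z - y) < s -> pdom P z ->
    (boundary A (pmap P z) -> exists2 x', en (x' - x) < ri & iota x' = pmap P z).
  have no := iota_open x ri0; rewrite -yx in no.
  by have /nbhs_enP[s s0 hs] := hc y _ yP no; exists s.
pose D := [set z | [/\ en (z - y) < s, pdom P z & dotp z (pnor P) = poff P]].
have cD : cvx D.
  move=> a b t [ar aP an] [br bP bn] t01; split; [exact: cvx_en|exact: cvx_pdom|].
  by rewrite !dotpB an bn; ring.
have Dbd z : D z -> boundary A (pmap P z).
  by move=> [_ zP zn]; have [_ _ ->] := hp z zP.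
have /choice[k hk] : forall z, exists x', D z -> en (x' - x) < ri /\ iota x' = pmap P z.
  move=> z; have [Dz|nDz] := pselect (D z); last by exists x.
  have [zs zP _] := Dz; have [x' x'r x'z] := hs z zs zP (Dbd z Dz).
  by exists x'.
have hk_id z : D z -> h (k z) = z.
  by move=> Dz; have [_ e] := hk z Dz; rewrite /h e; have [_ zP _] := Dz; have [] := hp z zP.
have kshort z w : D z -> D w -> en (k w - k z) <= en (w - z).
  apply: infinitesimally_short_lip => // {z w} z Dz e e0.
  have [zr ez] := hk z Dz; have [zs zP zn] := Dz.
  have Uz : U (iota (k z)) by rewrite ez; have [] := hp z zP.
  have /nbhs_enP[d d0 hd] := parametrization_comparison df Uz e0.
  pose d' := Num.min d (ri - en (k z - x)).
  have d'0 : 0 < d' by rewrite lt_min d0 subr_gt0.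
  have no := iota_open (k z) d'0; rewrite ez in no.
  move: (hc z _ zP no); apply: filterS => w hw Dw; have [ws wP wn] := Dw.
  have [x' x'd x'w] := hw wP (Dbd w Dw).
  move: x'd; rewrite lt_min => /andP[/hd[_ h2] x'r].
  have [kwr kw] := hk w Dw.
  have x'k : x' = k w.
    apply: hri => //; last by rewrite kw.
    by have := en_triangleB (k z) x' x; lra.
  by rewrite x'k -/(h (k w)) -/(h (k z)) !hk_id // in h2.
have nx : \forall x' \near x, [/\ U (iota x'), en (h x' - y) < s, pdom P (h x') & en (x' - x) < ri].
  have Ux : U (iota x) by rewrite -yx.
  have fx : f (iota x) = y by rewrite -yx.
  have n2 : nbhs (iota x) [set q | U q /\ poff P <= dotp (f q) (pnor P)].
    by rewrite -yx; exact: hb.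
  have n3 : nbhs (iota x) [set q | en (f q - y) < s /\ en (f q - pcen P) < prad P].
    apply: (dev_near (N := [set w | en (w - y) < s /\ en (w - pcen P) < prad P]) RM df Ux).
    rewrite fx; apply: filterI; first exact: near_en.
    by apply: near_ball; case: yP.
  move: (near_en x ri0) (iota_cont n2) (iota_cont n3).
  by apply: filterS3 => x' x'r [Ux' x'n] [x's x'p]; split.
have /nbhs_enP[r r0 hr] := nx.
have hPr x' : en (x' - x) < r -> [/\ pdom P (h x'), pmap P (h x') = iota x' &
       dotp (h x') (pnor P) = poff P].
  move=> /hr[Ux' x's hx'P x'r]; have [Uh fh bh] := hp _ hx'P.
  have e : pmap P (h x') = iota x' by exact: (dev_inj df).
  by split=> //; have [] : pnor P != 0 /\ dotp (h x') (pnor P) = poff P by rewrite -bh e.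
have Dh x' : en (x' - x) < r -> D (h x').
  by move=> x'r; have [? ? ?] := hPr x' x'r; split=> //; have [] := hr x' x'r.
have kh x' : en (x' - x) < r -> k (h x') = x'.
  move=> x'r; have [kr ke] := hk _ (Dh x' x'r); apply: hri => //; first by have [] := hr x' x'r.
  by rewrite ke; have [] := hPr x' x'r.
exists r => //; exists h; split=> //.
move=> x' x'' x'r x''r; apply/eqP; rewrite eq_le; apply/andP; split; last first.
  by have := kshort _ _ (Dh _ x''r) (Dh _ x'r); rewrite !kh.
apply: (@infinitesimally_short_lip R _ _ [set w | en (w - x) < r] h) => //.
  by move=> a b t ar br t01; exact: cvx_en.
move=> z zr e e0; have Uz : U (iota z) by have [] := hr z zr.
by move: (parametrization_comparison df Uz e0); apply: filterS => w [].
Qed.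

(** Moving [h] along the normal of the patch extends it to a map [H] of a full neighbourhood,
    isometric by Pythagoras because [h] stays in a hyperplane. *)
Lemma parametrization_iso x P y : flat_patches A P -> pdom P y -> pmap P y = iota x ->
  exists g, [/\ affine_isometry g, g (cat 0 x) = y,
    forall z, dotp (g z) (pnor P) - poff P = ht z &
    \forall x' \near x, iota x' = pmap P (g (cat 0 x'))].
Proof.
move=> hP yP yx; have [r r0 [h [hx hr hi]]] := parametrization_isometric hP yP yx.
have n0 : pnor P != 0.
  by have [] : pnor P != 0 /\ dotp y (pnor P) = poff P by apply/(fs_bd FS hP yP); rewrite yx.
have n1 : dotp (pnor P) (pnor P) = 1.
  by rewrite -en_sqr (fs_unit FS hP n0) expr1n.
pose S := [set z : 'rV[R]_m.+1 | en (tl z - x) < r].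
pose H z := h (tl z) + ht z *: pnor P.
have Si z w : S z -> S w -> en (H z - H w) = en (z - w).
  move=> Sz Sw; have [_ _ zn] := hr _ Sz; have [_ _ wn] := hr _ Sw.
  apply/eqP; rewrite -(@eqrXn2 _ 2) ?en_ge0 // [X in _ == X]en_split tlB -hi // htB !en_sqr; apply/eqP.
  have -> : H z - H w = (h (tl z) - h (tl w)) + (ht z - ht w) *: pnor P.
    by apply/rowP => i; rewrite !mxE; ring.
  have dn : dotp (h (tl z) - h (tl w)) (pnor P) = 0 by rewrite !dotpB zn wn subrr.
  move: (h (tl z) - h (tl w)) dn => d dn.
  rewrite !(dotpDl, dotpDr, dotpZl, dotpZr) n1 [dotp (pnor P) d]dotpC dn; ring.
have [|||g ig gH] := @affine_isometry_ext R _ S H (cat 0 x) (r / 2) _ _ _ Si.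
- by apply: lt0r_neq0; lra.
- by rewrite /S /= tl_cat subrr en0.
- move=> i; rewrite /S /= tlD tl_cat addrKl tlZ enZ.
  have := en_tl_le ('e_i : 'rV[R]_m.+1); rewrite en_delta gtr0_norm; last lra.
  have := en_ge0 (tl ('e_i : 'rV[R]_m.+1)); nra.
have gcat x' : en (x' - x) < r -> g (cat 0 x') = h x'.
  by move=> x'r; rewrite -gH /S /= /H ?tl_cat // cat0E scale0r addr0.
have gx : g (cat 0 x) = y by rewrite gcat ?hx // subrr en0.
have yn : dotp y (pnor P) = poff P.
  by have [] := hr x; rewrite ?subrr ?en0 // hx.
exists g; split=> //; last first.
  move: (near_en x r0); apply: filterS => x' x'r.
  by rewrite gcat //; have [_ -> _] := hr x' x'r.
(* The height formula holds for [H] near [cat 0 x] and spreads to every [z] along the line through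
   it, on which both sides are affine. *)
move=> z; pose w := z - cat 0 x.
have nS : nbhs (cat 0 x + 0 *: w) S.
  rewrite scale0r addr0; apply: (near_tl (N := [set w | en (w - x) < r])).
  by rewrite tl_cat; exact: near_en.
have [d d0 hd] := near_line nS.
have /hd Sd : `|d / 2 - 0| < d by rewrite subr0 gtr0_norm; lra.
have gl := affine_isometry_line (cat 0 x) w (d / 2) ig.
have xw : cat 0 x + w = z by rewrite addrC subrK.
rewrite xw gx in gl; have e := gH _ Sd; rewrite gl in e.
 have [_ _] := hr _ Sd; move: (e) => /(congr1 (fun v => dotp v (pnor P))).
rewrite /H !(dotpDl, dotpZl, dotpNl) n1 yn ht_line htB !cat0E => e' e''.
rewrite e'' in e'; have d20 : d / 2 != 0 by apply: lt0r_neq0; lra.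
by apply: (mulfI d20); lra.
Qed.

End boundary_parametrization.

Section orbit_charts.
Context {R : realType} {k : nat}.
Variable Gam : set ('rV[R]_k -> 'rV[R]_k).
Hypothesis FG : free_action Gam.
Local Notation pi := (orbit_proj Gam).

Lemma orbit_chart x : exists c, orbit_atlas Gam c /\ exists2 r, 0 < r &
  [/\ forall y z, en (y - x) < r -> en (z - x) < r -> pi y = pi z -> y = z,
      rdom c = pi @` [set y | en (y - x) < r] &
      forall y, en (y - x) < r -> [/\ rdom c (pi y), rcoord c (pi y) = y & rmetric c (pi y) = 1%:M]].
Proof.
have [r r0 hr] := pi_inj_ball FG x; pose W := [set y | en (y - x) < r].
have /choice[s hs] : forall q, exists y, (pi @` W) q -> W y /\ pi y = q.
  move=> q; have [[y Wy yq]|nq] := pselect ((pi @` W) q); first by exists y.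
  by exists x.
have sW y : W y -> s (pi y) = y.
  move=> Wy; have [Ws e] := hs (pi y) (imageP _ Wy); exact: hr.
pose c : rchart R (orbit_space Gam) k := RChart (pi @` W) s (fun=> 1%:M).
exists c; split; last first.
  by exists r => //; split=> // y yr; split=> //=; [by exists y|exact: sW].
exists W; split=> //.
- by rewrite openE => y yr; exact: near_ball.
- by move=> y z /set_mem Wy /set_mem Wz; exact: hr.
Qed.

End orbit_charts.

Section boundary_isometry.
Context {R : realType} {m : nat} {T : topologicalType}.
Variable A : set (rchart R T m.+1).
Hypothesis RM : riemannian_manifold A.
Variable Gam : set ('rV[R]_m -> 'rV[R]_m).
Hypothesis FG : free_action Gam.
Local Notation pi := (orbit_proj Gam).
Variables (phi : boundary A -> orbit_space Gam) (psi : orbit_space Gam -> boundary A).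
Hypothesis phiK : cancel phi psi.
Hypothesis psiK : cancel psi phi.
Hypothesis phi_cont : continuous phi.
Hypothesis psi_cont : continuous psi.
Hypothesis psi_iso : local_isometry (orbit_atlas Gam) (boundary_atlas A) setT psi.

(** The covering of the orbit space followed by the inverse isometry onto the boundary; it plays the
    role of [iota]. *)
Definition bparam x : T := set_val (psi (pi x)).

Lemma bparam_bd x : boundary A (bparam x).
Proof. exact: set_valP. Qed.

Lemma bparam_surj q : boundary A q -> exists x, bparam x = q.
Proof.
move=> bq; pose q' : boundary A := SigSub (mem_set bq).
have [x xq] := pi_surj (phi q'); exists x.
by rewrite /bparam xq phiK.
Qed.

Lemma bparam_pi x y : bparam x = bparam y -> pi x = pi y.
Proof. by move=> /val_inj/(can_inj psiK). Qed.

Lemma bparam_inj x : exists2 r, 0 < r & forall y z,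
  en (y - x) < r -> en (z - x) < r -> bparam y = bparam z -> y = z.
Proof.
have [r r0 hr] := pi_inj_ball FG x; exists r => // y z yr zr /bparam_pi; exact: hr.
Qed.

Lemma bparam_cont x N : nbhs (bparam x) N -> \forall y \near x, N (bparam y).
Proof.
move=> nN; have /psi_cont h : nbhs (psi (pi x)) (set_val @^-1` N).
  by apply: initial_continuous.
exact: (pi_cont h).
Qed.

Lemma bparam_open x r : 0 < r -> \forall q \near bparam x, boundary A q ->
  exists2 y, en (y - x) < r & bparam y = q.
Proof.
move=> r0; have h : nbhs (phi (psi (pi x))) (pi @` [set y | en (y - x) < r]).
  by rewrite psiK; apply: (pi_nbhs FG); exact: near_en.
have [B [[V oV <-] Vx] hB] := phi_cont h.
have : nbhs (bparam x) V by exact: open_nbhs_nbhs.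
apply: filterS => q Vq bq; pose q' : boundary A := SigSub (mem_set bq).
have [|y yr yq] := hB q'; first exact: Vq.
by exists y => //; rewrite /bparam yq phiK.
Qed.

Lemma boundary_coord0 c q : A c -> half_chart c -> rdom c q -> boundary A q ->
  ht (rcoord c q) = 0.
Proof.
move=> Ac hc cq bq; apply/eqP; rewrite eq_le (half_chart_ge0 RM Ac hc cq) andbT leNgt; apply/negP => q0.
exact: (covers_not_boundary RM Ac cq (covers_interior (half_chart_covers RM Ac hc cq) q0)).
Qed.

(** The matrix of the inclusion of R^m as the hyperplane of height 0. *)
Let B : 'M[R]_(m, m.+1) := rowsub (lift ord0) 1%:M.

Lemma cat0_lin (x : 'rV[R]_m) : cat 0 x = x *m B + 0.
Proof.
rewrite addr0; apply/rowP => j; rewrite !mxE; case: unliftP => [i ->|->].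
  rewrite (bigD1 i) //= !mxE eqxx mulr1 big1 ?addr0 // => i' ii'.
  by rewrite !mxE (inj_eq lift_inj) (negPf ii') mulr0.
by rewrite big1 // => i _; rewrite /B !mxE eq_sym eq_liftF mulr0.
Qed.

Lemma has_jac_near k l (F F' : 'rV[R]_k -> 'rV[R]_l) x J :
  (\forall y \near x, F y = F' y) -> has_jac F x J -> has_jac F' x J.
Proof.
move=> FF' h e e0; rewrite -(nbhs_singleton FF').
by move: FF' (h e e0); apply: filterS2 => y ->.
Qed.

(** In charts the map is [psi], then the inclusion of the face, then the developing map. The last
    pulls the Euclidean metric back to that of the manifold, the inclusion gives the induced metric,
    and [psi] returns to the identity matrix. *)
Lemma bparam_jac x U f : flat_dev A U f -> U (bparam x) ->
  exists2 J : 'M[R]_(m, m.+1), has_jac (f \o bparam) x J & J *m J^T = 1%:M.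
Proof.
move=> df Ux; have [c [Ac hc cx x0]] := bparam_bd x.
have [co [oco [r r0 [_ cod coE]]]] := orbit_chart FG x.
have [cox cox' gx] : [/\ rdom co (pi x), rcoord co (pi x) = x & rmetric co (pi x) = 1%:M].
  by apply: coE; rewrite subrr en0.
have [V [K [oV Vx sK KE mK]]] : isometric_at co (restrict_chart A c) psi (pi x).
  by apply: psi_iso => //; exists c.
have [V' [F [oV' Vx' sF FE mF]]] := dev_local df Ac Ux cx.
rewrite cox' in Vx mK.
have dK a : differentiable (coordinate K a) x by exact: (sK a [::]).
have KxE y : V y -> en (y - x) < r -> rdom c (bparam y) ->
    rcoord c (bparam y) = cat 0 (K y).
  move=> Vy yr cy; have [coy coy' _] := coE y yr.
  have e := KE (pi y) coy; rewrite coy' in e; rewrite -(e Vy cy).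
  apply: eq_cat; first by rewrite cat0E boundary_coord0 //; exact: bparam_bd.
  by rewrite tl_cat.
have xr : en (x - x) < r by rewrite subrr en0.
have dF a : differentiable (coordinate F a) (cat 0 (K x)).
  by rewrite -KxE //; exact: (sF a [::]).
have hJ := has_jac_comp (Jm_first_order dK)
  (has_jac_comp (@has_jac_lin _ _ _ B 0 (K x)) (_ : has_jac F _ (Jm F (cat 0 (K x))))).
exists (Jm K x *m (B *m Jm F (cat 0 (K x)))).
  apply: has_jac_near (hJ _); last by rewrite -cat0_lin; exact: Jm_first_order.
  have nV : nbhs x V by exact: open_nbhs_nbhs.
  have nW : nbhs (bparam x) [set q | rdom c q /\ V' (rcoord c q)].
    have nV' : nbhs (rcoord c (bparam x)) V' by exact: open_nbhs_nbhs.
    by apply: filterI; [exact: (rdom_nbhs RM Ac cx)|exact: (rcoord_near RM Ac cx nV')].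
  move: (near_en x r0) nV (bparam_cont nW); apply: filterS3 => y yr Vy [cy Vy'] /=.
  by rewrite -cat0_lin FE // KxE.
have GE : B *m rmetric c (bparam x) *m B^T = rmetric (restrict_chart A c) (psi (pi x)).
  rewrite /B mul_rowsub_mx mul1mx trmx_mxsub trmx1 mulmx_colsub mulmx1.
  by apply/matrixP => i j; rewrite !mxE.
rewrite gx jacobianE // -GE mF KxE // in mK.
by rewrite [RHS]mK !trmx_mul !mulmxA.
Qed.

End boundary_isometry.

Section boundary_to_flip.
Context {R : realType} {m : nat}.
Implicit Types Gam : set ('rV[R]_m -> 'rV[R]_m).

Definition has_flip Gam := exists al, [/\ affine_isometry al,
  forall f x, Gam f -> orbit_proj Gam (al (f x)) = orbit_proj Gam (al x),
  forall x, orbit_proj Gam (al (al x)) = orbit_proj Gam x &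
  forall x, orbit_proj Gam (al x) <> orbit_proj Gam x].

Lemma bieberbach_free Gam : bieberbach_group Gam -> free_action Gam.
Proof. by move=> [GI dG _ fr]; exact: discrete_free_action. Qed.

Theorem boundary_has_flip Gam : bieberbach_group Gam ->
  realized_as_totally_geodesic_boundary Gam -> has_flip Gam.
Proof.
move=> BG [T [A [RM _ cT [FA TG [phi [psi [[phiK psiK cphi cpsi] [_ ipsi]]]]]]]].
have FG := bieberbach_free BG; have [_ _ cG _] := BG.
have FS := flat_manifold_space RM FA TG.
have [||||al [ial Gal al2 al0]] :=
    @boundary_flip R m T (flat_patches A) (boundary A) FS Gam (bparam psi) _ _ _ _
    (fundamental_compact FG cG) cT.
- move=> q; split=> [|[x <-]]; last exact: bparam_bd.
  exact: bparam_surj phiK q.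
- move=> x P y hP yP yx; apply: (parametrization_iso RM FA TG) => //.
  + exact: bparam_bd.
  + by move=> x' N; exact: bparam_cont.
  + by move=> x' r; exact: (bparam_open FG phiK psiK cphi).
  + by move=> x'; exact: (bparam_inj FG psiK).
  + by move=> x' U f; exact: (bparam_jac RM FG).
- exact: free_iso.
- by move=> f x Gf; rewrite /bparam (pi_Gam FG x Gf).
exists al; split=> //.
- by move=> f x Gf; apply: (bparam_pi psiK); exact: Gal.
- by move=> x; apply: (bparam_pi psiK); exact: al2.
- by move=> x e; apply: (al0 x); rewrite /bparam e.
Qed.

End boundary_to_flip.

(** * Flips, involutions and double extensions *)

Section affine_maps.
Context {R : realType}.

Lemma derive_affine k (a : 'rV[R]_k) c x v : 'D_v (fun y => dotp y a + c) x = dotp v a.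
Proof.
rewrite /derive; apply: cvg_lim => //; apply: cvg_near_cst; near=> h.
have h0 : h != 0 by near: h; exact: nbhs_dnbhs_neq.
rewrite /= !dotpB; set u := dotp x a; set w := dotp v a.
have -> : h * w + u + c - (u + c) = h * w by ring.
by rewrite /GRing.scale /= mulKf.
Unshelve. all: by end_near. Qed.

Lemma differentiable_affine k (a : 'rV[R]_k) c x : differentiable (fun y => dotp y a + c) x.
Proof.
apply: differentiableD => //; apply: differentiable_bigsum => i.
apply: differentiableM => //; exact: differentiable_coord.
Qed.

Lemma partials_affine k (h : 'rV[R]_k -> R) s : (exists a c, h = fun y => dotp y a + c) ->
  exists a c, partials s h = fun y => dotp y a + c.
Proof.
move=> hE; elim: s => [//|i s [a [c IH]]] /=; exists 0, (dotp 'e_i a).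
by apply: funext => x; rewrite IH derive_affine dotp0r add0r.
Qed.

Lemma smooth_affine k V (h : 'rV[R]_k -> R) : (exists a c, h = fun y => dotp y a + c) ->
  smooth_on V h.
Proof.
by move=> hE s x _; have [a [c ->]] := partials_affine s hE; exact: differentiable_affine.
Qed.

Lemma coordinate_affine k l (A : 'M[R]_(k, l)) b j :
  coordinate (fun x => x *m A + b) j = fun y => dotp y (col j A)^T + b 0 j.
Proof.
apply: funext => y; rewrite /coordinate mxE dotpE trmxK; congr (_ + _).
by rewrite !mxE; apply: eq_bigr => i _; rewrite !mxE.
Qed.

Lemma jacobian_affine k l (A : 'M[R]_(k, l)) b x : jacobian (fun x => x *m A + b) x = A.
Proof.
rewrite jacobianE => [|j]; last by rewrite coordinate_affine; exact: differentiable_affine.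
apply/matrixP => i j; rewrite mxE coordinate_affine derive_affine dotpC dotp_delta.
by rewrite !mxE.
Qed.

Lemma affine_isometric_at (T T' : Type) k (c : rchart R T k) (c' : rchart R T' k)
    (f : T -> T') p V F : affine_isometry F -> open V -> V (rcoord c p) ->
  (forall q, rdom c q -> V (rcoord c q) -> rdom c' (f q) -> rcoord c' (f q) = F (rcoord c q)) ->
  rmetric c p = 1%:M -> rmetric c' (f p) = 1%:M -> isometric_at c c' f p.
Proof.
move=> /affine_isometryP[A [b [AA FE]]] oV Vp h g1 g2.
have FA : F = fun x => x *m A + b by exact: funext.
subst F; exists V, (fun x => x *m A + b); split=> //.
  by move=> j; apply: smooth_affine; exists (col j A)^T, (b 0 j); exact: coordinate_affine.
by rewrite jacobian_affine g1 g2 mulmx1 AA.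
Qed.

End affine_maps.

(** * Lifting isometries of the orbit space *)

Section flips.
Context {R : realType} {k : nat}.
Variable Gam : set ('rV[R]_k -> 'rV[R]_k).
Hypothesis FG : free_action Gam.
Local Notation E := 'rV[R]_k.
Local Notation pi := (orbit_proj Gam).
Local Notation M := (orbit_space Gam).

(** In the charts of the orbit space the metric is the identity matrix, so the lift has isometric
    derivatives and is infinitesimally short on a ball. *)
Lemma local_lift s x x' : continuous s ->
  local_isometry (orbit_atlas Gam) (orbit_atlas Gam) setT s -> pi x' = s (pi x) ->
  exists u : E -> E, exists2 r, 0 < r & u x = x' /\
    forall y, en (y - x) < r -> pi (u y) = s (pi y) /\
      forall z, en (z - x) < r -> en (u y - u z) <= en (y - z).
Proof.
move=> cs ls e.
have [c [oc [r r0 [_ cd cE]]]] := orbit_chart FG x.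
have [c' [oc' [r' r'0 [inj' cd' cE']]]] := orbit_chart FG x'.
have ns : nbhs (s (pi x)) (pi @` [set y | en (y - x') < r']).
  by rewrite -e; apply: (pi_nbhs FG); exact: near_en.
have /nbhs_enP[r2 r20 hr2] : \forall y \near x, (pi @` [set y | en (y - x') < r']) (s (pi y)).
  exact: (pi_cont (cs _ _ ns)).
pose t := Num.min r r2; have t0 : 0 < t by rewrite lt_min r0.
pose u y := rcoord c' (s (pi y)).
have uE y : en (y - x) < t -> pi (u y) = s (pi y) /\ rdom c' (s (pi y)).
  rewrite lt_min => /andP[_ /hr2[z zr zy]]; have [? zE _] := cE' z zr.
  by rewrite /u -zy zE.
exists u, t => //; split.
  by rewrite /u -e; have [|_ -> _] := cE' x'; rewrite ?subrr ?en0.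
move=> y yt; split; first by have [] := uE y yt.
move=> z zt; apply: (@infinitesimally_short_lip R _ _ [set w | en (w - x) < t] u) => //.
  by move=> a b l ar br l01; exact: cvx_en.
move=> {yt} {}z {}zt d d0.
have [zr zr2] : en (z - x) < r /\ en (z - x) < r2.
  by move: zt; rewrite /= lt_min => /andP[].
have [cz cz' gz] := cE z zr; have [_ dz] := uE z zt.
have [V [F [oV Vz sF FE mF]]] := ls c c' (pi z) oc oc' I cz dz.
have gz' : rmetric c' (s (pi z)) = 1%:M.
  by have [w wr <-] := hr2 z zr2; have [_ _ ->] := cE' w wr.
rewrite gz gz' mulmx1 cz' in mF; rewrite cz' in Vz.
have dF a : differentiable (coordinate F a) z by exact: (sF a [::]).
rewrite jacobianE // in mF.
have nV : nbhs z V by exact: open_nbhs_nbhs.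
have FuE : \forall w \near z, F w = u w.
  move: nV (near_ball zr) (near_ball zt); apply: filterS3 => w Vw wr wt.
  have [cw cw' _] := cE w wr; have [_ dw] := uE w wt.
  by have := FE (pi w) cw; rewrite cw' => /(_ Vw dw) <-.
have hu := has_jac_near FuE (Jm_first_order dF).
have I1 : (1%:M : 'M[R]_k) *m 1%:M^T = 1%:M by rewrite trmx1 mulmx1.
have := metric_comparison (has_jac_id z) hu I1 (esym mF) (unitmx1 _ _) d0.
by apply: filterS => w h _.
Qed.

(** The lifts of [s] and of its inverse are distance-nonincreasing and the second undoes the first
    near [x]. *)
Lemma isometry_lift s (x : E) : is_isometry (orbit_atlas Gam) (orbit_atlas Gam) s ->
  exists2 g : E -> E, affine_isometry g & \forall y \near x, s (pi y) = pi (g y).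
Proof.
move=> [v [[sK vK cs cv] [ls lv]]]; have [x' x'E] := pi_surj (s (pi x)).
have [u [r r0 [ux hu]]] := local_lift cs ls x'E.
have vE : pi x = v (pi x') by rewrite x'E sK.
have [w [r' r'0 [wx hw]]] := local_lift cv lv vE.
have [ri ri0 hri] := pi_inj_ball FG x.
pose t := Num.min (Num.min r r') ri; have t0 : 0 < t by rewrite !lt_min r0 r'0.
pose D := [set z | en (z - x) < t].
have Dr z : D z -> [/\ en (z - x) < r, en (z - x) < r' & en (z - x) < ri].
  by rewrite /D /= !lt_min => /andP[/andP[]].
have Dx : D x by rewrite /D /= subrr en0.
have us z : D z -> en (u z - x') < r'.
  move=> /Dr[zr zr' _]; have [_ /(_ x)] := hu z zr; rewrite ux subrr en0.
  by move=> /(_ r0) h; exact: le_lt_trans zr'.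
have [_ r'x'] : True /\ en (x' - x') < r' by rewrite subrr en0.
have wu z : D z -> w (u z) = z.
  move=> Dz; have [zr zr' zi] := Dr z Dz; have [e1 _] := hu z zr.
  have [e2 /(_ x' r'x')] := hw (u z) (us z Dz); rewrite wx => h.
  apply: hri => //; last by rewrite e2 e1 sK.
  apply: (le_lt_trans h); have [_ /(_ x)] := hu z zr; rewrite ux subrr en0 => /(_ r0) h'.
  exact: le_lt_trans zi.
have iso z z' : D z -> D z' -> en (u z - u z') = en (z - z').
  move=> Dz Dz'; have [zr _ _] := Dr z Dz; have [zr' _ _] := Dr z' Dz'.
  apply/eqP; rewrite eq_le; apply/andP; split; first by have [_ /(_ _ zr')] := hu z zr.
  by have [_ /(_ _ (us z' Dz'))] := hw _ (us z Dz); rewrite !wu.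
have [||g ig ug] := @affine_isometry_ext R _ D u x (t / 2) _ Dx _ iso.
- by apply: lt0r_neq0; lra.
- by move=> i; rewrite /D /= addrKl enZ en_delta mulr1 gtr0_norm; lra.
exists g => //; move: (near_en x t0); apply: filterS => y Dy.
by rewrite -ug //; have [yr _ _] := Dr y Dy; have [-> _] := hu y yr.
Qed.

(** Both [s \o pi] and [pi \o al] are local isometries into the flat orbit space, so their agreement
    near 0 spreads to all of R^k. *)
Lemma involution_flip : has_free_isometric_involution Gam -> has_flip Gam.
Proof.
move=> [s [is_ s2 s0]]; have [al ial al0] := isometry_lift 0 is_.
have FS := orbit_flat_space FG.
have sal x : s (pi x) = pi (al x).
  apply: (unique_continuation FS (D := setT) (Phi := s \o pi) (Psi := pi \o al) (z0 := 0)) => //.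
  - by move=> z N _ nN; exists z; [exact: nbhs_singleton|exact: filterT].
  - move=> z _; have [g ig gz] := isometry_lift z is_.
    apply: (loc_iso_sub (loc_iso_comp ig (pi_loc_iso FG (g z)) (D' := setT) _)).
      exact: filterE.
    by move: gz; apply: filterS => y.
  - move=> z _; apply: (loc_iso_comp ial (pi_loc_iso FG (al z))); exact: filterE.
  - by move: al0; apply: filterS => y.
exists al; split=> //.
- by move=> f x Gf; rewrite -!sal (pi_Gam FG).
- by move=> x; rewrite -!sal s2.
- by move=> x; rewrite -sal; exact: s0.
Qed.

Hypothesis HF : has_flip Gam.

Lemma flip_map : exists al (s : M -> M), [/\ affine_isometry al,
  forall x, s (pi x) = pi (al x), involutive s & forall q, s q <> q].
Proof.
have [al [ial Gal al2 al0]] := HF.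
have /choice[h hE] := pi_surj (Gam := Gam).
pose s q := pi (al (h q)).
have sE x : s (pi x) = pi (al x).
  have /(piP FG)[f Gf e] : pi x = pi (h (pi x)) by rewrite hE.
  by rewrite /s e Gal.
exists al, s; split=> // q; rewrite -(hE q) !sE //; exact: al0.
Qed.

Lemma flip_involution : has_free_isometric_involution Gam.
Proof.
have [al [s [ial sE s2 s0]]] := flip_map.
exists s; split=> //.
have cs : continuous s.
  move=> q N; have [x <-] := pi_surj q => nN; rewrite /= sE in nN.
  have h : \forall y \near x, N (pi (al y)).
    exact: (affine_isometry_near ial (pi_cont nN)).
  move: (pi_nbhs FG h); apply: filterS => _ [y Ny <-] /=.
  by rewrite sE.
have ls : local_isometry (orbit_atlas Gam) (orbit_atlas Gam) setT s.
  move=> c c' p [W [oW iW cd cE cg]] [W' [oW' iW' cd' cE' cg']] _ cp cp'.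
  have [x Wx xp] : (pi @` W) p by rewrite -cd.
  have [x' Wx' xp'] : (pi @` W') (s p) by rewrite -cd'.
  (* An element [f] of the group moves [al x] to the representative used by the target chart, so
     [f \o al] expresses [s] in the two charts. *)
  have /(piP FG)[f Gf x'E] : pi (al x) = pi x' by rewrite xp' -sE xp.
  have iF : affine_isometry (f \o al) by apply: affine_isometry_comp => //; exact: (free_iso FG).
  apply: (@affine_isometric_at _ _ _ _ _ _ _ _ (W `&` (f \o al) @^-1` W') _ iF).
  - apply: openI => //; apply: open_comp => // y _; exact: affine_isometry_cont.
  - by rewrite -xp cE //; split=> //=; rewrite -x'E.
  - rewrite cd => _ [y Wy <-]; rewrite cE // => -[_ W'y] _.
    by rewrite sE -(pi_Gam FG _ Gf) cE'.
  - exact: cg.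
  - exact: cg'.
exists s; split; split=> //.
Qed.

End flips.

(** * Flips and extensions by Z/2 *)

Section double_quotient.
Context {R : realType} {k : nat}.
Implicit Types Gam : set ('rV[R]_k -> 'rV[R]_k).
Local Notation E := 'rV[R]_k.

(** Evaluation at 0 isolates [f]: if [g 0] is within [r] of [f 0], then [g] composed with the
    inverse of [f] displaces [f 0] by less than [r] and is the identity. *)
Lemma free_action_discrete Gam : free_action Gam -> discrete_isometries Gam.
Proof.
move=> FG f Gf; split; first exact/mem_set.
have [r r0 hr] := FG.2 (f 0).
pose O := [set y : E | en (y - f 0) < r].
have oO : open O by rewrite openE => y yr; exact: near_ball.
exists [set g : E -> E | g @` [set 0] `<=` O].
  have oV := @compact_open_open E E [set 0] O (@compact_set1 E 0) oO.
  apply: (@open_nbhs_nbhs {compact-open, E -> E}); split; first exact: oV.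
  by move=> _ [_ -> <-]; rewrite /O /= subrr en0.
apply/seteqP; split=> [g [Og Gg]|_ ->]; last first.
  by split=> // _ [_ -> <-]; rewrite /O /= subrr en0.
have [f' [Gf' fK f'K]] := free_inv FG Gf.
have gf : g \o f' = id.
  apply: contrapT => /(hr _ (free_comp FG Gg Gf')); rewrite /= fK leNgt => /negP; apply.
  by apply: Og; exists 0.
by apply: funext => x; rewrite -[in LHS](fK x) -[LHS]/((g \o f') (f x)) gf.
Qed.

(** Any element [al] outside the kernel is a flip. It descends because the kernel is normal, and its
    square lies in the kernel. If it fixed a class, some [f] in [Gam0] would have [al x = f x], and
    freeness would force [al = f]. *)
Lemma extension_flip Gam0 Gam : bieberbach_group Gam0 -> bieberbach_group Gam ->
  exact_over_Z2 Gam0 Gam -> has_flip Gam0.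
Proof.
move=> B0 B1 [sub [chi [chiM chi_surj chiK]]].
have F0 := bieberbach_free B0; have F1 := bieberbach_free B1.
have [al Gal al1] := chi_surj 1; have [al' [Gal' alK al'K]] := free_inv F1 Gal.
have chi_id : chi id = 0 by apply/(chiK _ (free_id F1)); exact: (free_id F0).
exists al; split.
- exact: (free_iso F1).
- move=> f x Gf; pose g := al \o f \o al'.
  have Gf1 := sub _ Gf.
  have g0 : Gam0 g.
    apply/chiK; first by do 2!apply: (free_comp F1) => //.
    have chif : chi f = 0 by exact/chiK.
    rewrite /g (chiM (al \o f) al') ?(chiM al f) //; last exact: (free_comp F1).
    rewrite chif addr0 -(chiM al al') // (_ : al \o al' = id) //; exact: funext.
  by rewrite -(pi_Gam F0 (al x) g0) /g /= alK.
- move=> x; have g0 : Gam0 (al \o al).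
    by apply/chiK; [exact: (free_comp F1)|rewrite (chiM al al) // al1; exact/val_inj].
  exact: (pi_Gam F0 x g0).
- move=> x /esym/(piP F0)[f Gf e].
  have [f' [Gf' fK f'K]] := free_inv F0 Gf.
  have [_ _ _ fr] := B1.
  have e1 : f' \o al = id.
    apply: contrapT => /(fr _ (free_comp F1 (sub _ Gf') Gal))/(_ x); apply.
    by rewrite /= e fK.
  have e2 : al = f by apply: funext => y; rewrite -[LHS]f'K -[f' _]/((f' \o al) y) e1.
  have := (chiK al Gal).2; rewrite e2 => /(_ Gf); rewrite -e2 al1 => /eqP.
  by rewrite oner_eq0.
Qed.

(** The extension consists of all affine lifts of the identity and of the involution [s]; the
    boolean records which of the two is lifted. *)
Lemma flip_extension Gam0 : bieberbach_group Gam0 -> has_flip Gam0 ->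
  exists Gam, bieberbach_group Gam /\ exact_over_Z2 Gam0 Gam.
Proof.
move=> B0 hf; have F0 := bieberbach_free B0.
have [al [s [ial sE s2 s0]]] := flip_map F0 hf.
pose pi := orbit_proj Gam0.
pose sp (b : bool) q := if b then s q else q.
have sp2 b q : sp b (sp b q) = q by case: b => //=; rewrite s2.
pose Gam := [set f : E -> E | affine_isometry f /\ exists b, forall x, pi (f x) = sp b (pi x)].
have G0 f : Gam0 f <-> affine_isometry f /\ forall x, pi (f x) = pi x.
  split=> [Gf|[fi fp]]; last exact: (deck_in_group F0).
  by split; [exact: (free_iso F0)|move=> x; exact: (pi_Gam F0)].
have sub : Gam0 `<=` Gam by move=> f /G0[fi fp]; split=> //; exists false.
have GI : isometry_group Gam.
  split; first by move=> f [].
  - by split; [exact: affine_isometry_id|exists false].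
  - move=> f g [fi [b fb]] [gi [b' gb]]; split; first exact: affine_isometry_comp.
    exists (b (+) b') => x /=; rewrite fb gb.
    by case: b b' {fb gb} => [] [] //=; rewrite s2.
  - move=> f [fi [b fb]]; have [g [gi fK gK]] := affine_isometry_inv fi.
    exists g; split=> //; split=> //; exists b => x.
    by rewrite -[in RHS](gK x) fb sp2.
have F1 : free_action Gam.
  split=> // x; have [r r0 hr] := F0.2 x.
  have alx : pi (al x) <> pi x by rewrite /pi -sE; exact: s0.
  (* Lifts of [s] send [x] into the orbit of [al x], which keeps a positive distance from [x]
     because [s] has no fixed point. *)
  have [r' r'0 hr'] := orbit_separated F0 alx.
  exists (Num.min r r'); first by rewrite lt_min r0.
  move=> f [fi [[] fb]] fid; rewrite ge_min; last by rewrite hr //; exact/G0.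
  have /(piP F0)[g Gg ->] : pi (al x) = pi (f x) by rewrite fb /= sE.
  by rewrite hr' ?orbT.
exists Gam; split.
  split=> //; first exact: free_action_discrete.
  - have [_ _ cG _] := B0; have [K cK hK] := fundamental_compact F0 cG.
    have -> : [set: orbit_space Gam] = orbit_proj Gam @` K.
      apply/seteqP; split=> // q _; have [x <-] := pi_surj q; have [f Gf Kf] := hK x.
      by exists (f x) => //; exact: (pi_Gam F1 x (sub _ Gf)).
    by apply: continuous_compact => //; apply: continuous_subspaceT => x; exact: pi_cont.
  - move=> f Gf fid x fx; have [r r0 hr] := F1.2 x; have := hr f Gf fid.
    by rewrite fx subrr en0 leNgt r0.
split=> //; exists (fun f => if `[< Gam0 f >] then 0 else 1).
have G1 f : Gam f -> ~ Gam0 f -> forall x, pi (f x) = s (pi x).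
  by move=> [fi [[] fb]] nf //; case: nf; exact/G0.
have n1 f : affine_isometry f -> (forall x, pi (f x) = s (pi x)) -> ~ Gam0 f.
  by move=> fi fs /G0[_ /(_ 0)]; rewrite fs => /s0.
have Gal : ~ Gam0 al by apply: n1 => // x; rewrite sE.
split.
- move=> f g Gf Gg; have fi := free_iso F1 Gf; have gi := free_iso F1 Gg.
  have fgi := affine_isometry_comp fi gi.
  case: (asboolP (Gam0 f)) => [/G0[_ f0]|/(G1 f Gf) f1];
    case: (asboolP (Gam0 g)) => [/G0[_ g0]|/(G1 g Gg) g1].
  + by rewrite asboolT ?addr0 //; apply/G0; split=> // x /=; rewrite f0 g0.
  + by rewrite asboolF ?add0r //; apply: n1 => // x /=; rewrite f0 g1.
  + by rewrite asboolF ?addr0 //; apply: n1 => // x /=; rewrite f1 g0.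
  + rewrite asboolT; first exact/val_inj.
    by apply/G0; split=> // x /=; rewrite f1 g1 s2.
- move=> z; have [->|z0] := eqVneq z 0.
    by exists id; [exact: (free_id F1)|rewrite asboolT //; exact: (free_id F0)].
  exists al; first by split=> //; exists true => x; rewrite /= sE.
  by rewrite asboolF //; apply/val_inj; case: z z0 => [] [|[|]].
- by move=> f Gf; case: asboolP => // nf; split=> // /eqP; rewrite oner_eq0.
Qed.

End double_quotient.

(** * Twisted interval bundles *)

Lemma clamp_short (R : realDomainType) (a b : R) :
  `|Num.max (-1) (Num.min 1 a) - Num.max (-1) (Num.min 1 b)| <= `|a - b|.
Proof.
have := ler_norm (b - a); rewrite distrC; have := ler_norm (a - b).
have := normr_ge0 (a - b); move: `|a - b| => N N0 N1 N2.
have h1 : (-1 : R) <= 1 by lra.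
by rewrite ler_norml; case: (leP 1 a) => ?; case: (leP 1 b) => ?; rewrite ?(max_r h1);
  try (case: (leP (-1) a) => ?); try (case: (leP (-1) b) => ?); lra.
Qed.

Section twisted_interval_bundle.
Context {R : realType} {m : nat}.
Local Notation E := 'rV[R]_m.
Local Notation E1 := 'rV[R]_m.+1.
Variables (Gam0 Gam : set (E -> E)) (eps : (E -> E) -> R).
Hypothesis F0 : free_action Gam0.
Hypothesis F1 : free_action Gam.
Hypothesis sub : Gam0 `<=` Gam.
Hypothesis eps2 : forall f, Gam f -> eps f ^+ 2 = 1.
Hypothesis epsM : forall f g, Gam f -> Gam g -> eps (f \o g) = eps f * eps g.
Hypothesis epsK : forall f, Gam f -> (eps f = 1 <-> Gam0 f).
Hypothesis epsN : exists2 f, Gam f & eps f = -1.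
Hypothesis cG : compact [set: orbit_space Gam].

(* [Gam] acts on [R^{m+1}] by reflecting the first coordinate through the
   character [eps]; the manifold is the image of the slab [|ht z| <= 1]. *)
Definition twist (f : E -> E) : E1 -> E1 := fun z => cat (eps f * ht z) (f (tl z)).
Definition twisted : set (E1 -> E1) := twist @` Gam.
Local Notation pi := (orbit_proj twisted).

Lemma twist_iso f : Gam f -> affine_isometry (twist f).
Proof.
move=> Gf; have := affine_isometry_slab 0 (eps2 Gf) (free_iso F1 Gf).
by congr affine_isometry; apply: funext => z; rewrite addr0.
Qed.

Lemma eps_id : eps id = 1.
Proof. by apply/epsK; [exact: (free_id F1)|exact: (free_id F0)]. Qed.

Lemma twist_id : twist id = id.
Proof. by apply: funext => z; rewrite /twist eps_id mul1r cat_tl. Qed.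

Lemma twist_comp f g : Gam f -> Gam g -> twist (f \o g) = twist f \o twist g.
Proof.
by move=> Gf Gg; apply: funext => z; rewrite /twist /= cat0E tl_cat epsM // mulrA.
Qed.

Lemma twisted_free : free_action twisted.
Proof.
split; first split.
- by move=> _ [f Gf <-]; exact: twist_iso.
- by exists id; [exact: (free_id F1)|exact: twist_id].
- move=> _ _ [f Gf <-] [g Gg <-]; rewrite -twist_comp //.
  by exists (f \o g) => //; exact: (free_comp F1).
- move=> _ [f Gf <-]; have [g [Gg fK gK]] := free_inv F1 Gf.
  have fg : f \o g = id by exact: funext.
  have gf : g \o f = id by exact: funext.
  exists (twist g); split; first by exists g.
    by move=> z; rewrite -[LHS]/((twist g \o twist f) z) -twist_comp // gf twist_id.
  by move=> z; rewrite -[LHS]/((twist f \o twist g) z) -twist_comp // fg twist_id.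
- move=> z; have [r r0 hr] := F1.2 (tl z); exists r => // _ [f Gf <-] fid.
  apply: le_trans (hr f Gf _) _; first by move=> fE; apply: fid; rewrite fE twist_id.
  by have := en_tl_le (twist f z - z); rewrite tlB tl_cat.
Qed.

Let FG := twisted_free.

Lemma norm_ht_twist f z : Gam f -> `|ht (twist f z)| = `|ht z|.
Proof.
move=> Gf; rewrite cat0E normrM (_ : `|eps f| = 1) ?mul1r //.
by apply/eqP; rewrite -(@eqrXn2 _ 2) // ?real_normK ?num_real // expr1n eps2.
Qed.

Definition strip : set E1 := [set z | `|ht z| <= 1].
Definition bundle : set (orbit_space twisted) := pi @` strip.
Local Notation M := (set_type bundle).

(** A retraction onto the strip; through it [rho] is total and continuous on R^{m+1}, and no
    subspace of R^{m+1} has to serve as domain. *)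
Definition clamp (z : E1) : E1 := cat (Num.max (-1) (Num.min 1 (ht z))) (tl z).

Lemma clamp_strip z : strip (clamp z).
Proof.
rewrite /strip /= cat0E ler_norml le_max lexx /= ge_max ge_min lexx andbT; lra.
Qed.

Lemma clamp_id z : strip z -> clamp z = z.
Proof.
rewrite /strip /= ler_norml => /andP[z0 z1]; rewrite /clamp min_r // max_r //; exact: cat_tl.
Qed.


Lemma clamp_cont : continuous clamp.
Proof.
move=> z N /nbhs_enP[r r0 hr]; apply/nbhs_enP; exists r => // w wz; apply: hr.
apply: le_lt_trans wz.
have : `|Num.max (-1) (Num.min 1 (ht w)) - Num.max (-1) (Num.min 1 (ht z))| <= `|ht w - ht z|.
  exact: clamp_short.
move=> h; rewrite -(@ler_sqr R) ?nnegrE ?en_ge0 // !en_split !tlB !htB !tl_cat lerD2r !cat0E.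
by rewrite -[leLHS]real_normK ?num_real // -[leRHS]real_normK ?num_real // ler_sqr ?nnegrE.
Qed.

Definition rho (z : E1) : M := SigSub (mem_set (imageP pi (clamp_strip z))).

Lemma rhoE z : strip z -> set_val (rho z) = pi z.
Proof. by move=> sz; rewrite -{2}(clamp_id sz). Qed.

Lemma strip_pi z w : strip z -> pi z = pi w -> strip w.
Proof. by rewrite /strip /= => sz /(piP FG)[_ [f Gf <-] ->]; rewrite norm_ht_twist. Qed.

Lemma rho_val z q : strip z -> pi z = set_val q -> rho z = q.
Proof. by move=> sz zq; apply: val_inj; rewrite -[LHS]/(set_val (rho z)) rhoE. Qed.

Lemma rho_surj q : exists2 z, strip z & rho z = q.
Proof.
have [z sz zq] : bundle (set_val q) by exact: set_valP.
by exists z => //; exact: rho_val.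
Qed.

Lemma rhoP z w : strip z -> strip w -> (rho z = rho w <-> exists2 f, Gam f & w = twist f z).
Proof.
move=> sz sw; split=> [/(congr1 set_val)|[f Gf wz]].
  by rewrite !rhoE // => /(piP FG)[_ [f Gf <-] ->]; exists f.
apply: val_inj; rewrite -[LHS]/(set_val (rho z)) -[RHS]/(set_val (rho w)) !rhoE //.
by apply/(piP FG); exists (twist f) => //; exists f.
Qed.

Lemma rho_twist f z : Gam f -> strip z -> strip (twist f z) /\ rho (twist f z) = rho z.
Proof.
move=> Gf sz; have sf : strip (twist f z) by rewrite /strip /= norm_ht_twist.
by split=> //; apply/esym/rhoP => //; exists f.
Qed.

Lemma rho_cont : continuous rho.
Proof.
move=> z N [B [[V oV <-] Vz] hB]; have nV : nbhs (pi (clamp z)) V by exact: open_nbhs_nbhs.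
have h : \forall w \near z, V (pi (clamp w)) := clamp_cont (pi_cont nV).
by apply: (filterS _ h) => w Vw; exact: hB.
Qed.

Lemma rho_nbhs z N : strip z -> nbhs z N -> nbhs (rho z) (rho @` (strip `&` N)).
Proof.
move=> sz nN; have nV := pi_nbhs FG nN.
have : nbhs (rho z) (set_val @^-1` (pi @` N)).
  by apply: initial_continuous; rewrite rhoE.
apply: filterS => q [w Nw wq]; have [z' sz' z'q] := rho_surj q.
have sw : strip w by apply: (strip_pi sz'); rewrite wq -z'q rhoE.
by exists w => //; exact: rho_val.
Qed.

Lemma rho_inj_ball z : exists2 r, 0 < r & forall x y, strip x -> strip y ->
  en (x - z) < r -> en (y - z) < r -> rho x = rho y -> x = y.
Proof.
have [r r0 hr] := pi_inj_ball FG z; exists r => // x y sx sy xr yr /(congr1 set_val).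
by rewrite !rhoE //; exact: hr.
Qed.

Lemma bundle_hausdorff : hausdorff_space M.
Proof.
move=> p q pq; apply: val_inj; apply: (orbit_space_hausdorff FG) => V W nV nW.
have [||x [Vx Wx]] := pq (set_val @^-1` V) (set_val @^-1` W).
- exact: initial_continuous.
- exact: initial_continuous.
by exists (set_val x).
Qed.

Lemma rational_ball (z : E1) (e : R) : 0 < e ->
  exists (c : 'rV[rat]_m.+1) (r : rat), en (z - map_mx ratr c) < ratr r /\ ratr r < e.
Proof.
move=> e0; have [r] := rat_in_itvoo e0; rewrite in_itv /= => /andP[r0 re].
have /nbhs_ballP[d /= d0 hd] := near_en z r0.
have /choice[c hc] : forall i, exists c : rat, ball (z 0 i) d (ratr c).
  move=> i; have [|c] := @rat_in_itvoo R (z 0 i - d) (z 0 i + d); first lra.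
  rewrite in_itv /= => /andP[h1 h2]; exists c; rewrite /ball /= ltr_norml; lra.
exists (\row_i c i), r; split=> //; rewrite enB; apply: hd; split=> // i j.
by rewrite !mxE ord1; exact: hc.
Qed.

Lemma bundle_second_countable : @second_countable M.
Proof.
pose ob (x : 'rV[rat]_m.+1 * rat) : set E1 :=
  [set z | en (z - map_mx ratr x.1) < ratr x.2].
pose ob' x : set M := set_val @^-1` (pi @` ob x).
exists (range ob').
  exact: sub_countable (card_image_le ob' setT) (countableP _).
split.
  move=> _ [x _ <-]; apply: open_comp; first by move=> q _; exact: initial_continuous.
  by apply: (pi_open FG); rewrite openE => z /near_ball.
move=> q N nN; have [z sz zq] := rho_surj q; rewrite -zq in nN.
have /nbhs_enP[e e0 he] := rho_cont nN.
have e20 : 0 < e / 2 by rewrite divr_gt0.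
have [c [r [zc re]]] := rational_ball z e20.
exists (ob' (c, r)); first by split; [exists (c, r)|exists z => //; rewrite -zq rhoE].
move=> q' [w wc wq']; have [z' sz' z'q] := rho_surj q'.
have sw : strip w by apply: (strip_pi sz'); rewrite wq' -z'q rhoE.
rewrite -(rho_val sw wq').
apply: he; have := en_triangleB (map_mx ratr c) w z; rewrite /ob /= in wc.
rewrite [en (map_mx _ _ - z)]enB; lra.
Qed.

Lemma connected_rV : connected [set: E1].
Proof.
have -> : [set: E1] = \bigcup_(v in setT) ((fun t : R => t *: v) @` [set: R]).
  by apply/seteqP; split=> // v _; exists v => //; exists 1; rewrite ?scale1r.
apply: bigcup_connected; first by exists 0 => v _; exists 0; rewrite ?scale0r.
move=> v _; apply: connected_continuous_connected; first exact/connected_intervalP.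
by apply: continuous_subspaceT => t; exact: scalel_continuous.
Qed.

Lemma rho_range : [set: M] = range rho.
Proof. by apply/seteqP; split=> // q _; have [z _ <-] := rho_surj q; exists z. Qed.

Lemma bundle_connected : connected [set: M].
Proof.
rewrite rho_range; apply: connected_continuous_connected; first exact: connected_rV.
by apply: continuous_subspaceT; exact: rho_cont.
Qed.

Lemma bundle_compact : compact [set: M].
Proof.
have [K cK hK] := fundamental_compact F1 cG.
have [B [_ hB]] := compact_bounded cK.
pose b := m.+1%:R * (`|B| + 1).
have Kb x : K x -> en x <= b.
  move=> Kx; apply: le_trans (en_le_normr x) _; rewrite ler_pM2l //.
  by apply: hB => //; rewrite (le_lt_trans (ler_norm _)) // ltrDl.
pose K1 := [set z : E1 | en z <= 1 + b] `&` [set z | K (tl z) /\ strip z].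
have -> : [set: M] = rho @` K1.
  apply/seteqP; split=> // q _; have [z sz <-] := rho_surj q.
  have [f Gf Kf] := hK (tl z); have [sf fz] := rho_twist Gf sz.
  exists (twist f z) => //; split=> /=; last by rewrite tl_cat.
  have := en_triangle (cat (ht (twist f z)) 0) (cat 0 (tl (twist f z))).
  have -> : cat (ht (twist f z)) 0 + cat 0 (tl (twist f z)) = twist f z.
    by apply: eq_cat; rewrite ?tlD ?tl_cat ?add0r // [LHS]mxE -!/(ht _) !cat0E addr0.
  rewrite en_cat_tl0 en_cat0 tl_cat => h; have := Kb _ Kf; move: sf; rewrite /strip /=; lra.
apply: continuous_compact; first by apply: continuous_subspaceT; exact: rho_cont.
apply: compact_closedI; first exact: compact_en_ball.
have cK' : closed K by apply: compact_closed => //; exact: norm_hausdorff.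
rewrite -[X in closed X]setCK; apply: open_closedC; rewrite openE => z /= /not_andP[nK|ns].
  have nK' : nbhs (tl z) (~` K) by apply: open_nbhs_nbhs; split=> //; exact: closed_openC.
  by move: (near_tl nK'); apply: filterS => w nw [].
have : 1 < `|ht z| by rewrite ltNge; exact/negP.
rewrite -subr_gt0 => /(near_en z); apply: filterS => w wz [_ sw].
have := coord_near z w; rewrite /strip /= in sw.
by have := ler_distD (ht w) (ht z) 0; rewrite !subr0 distrC; lra.
Qed.

Definition kappa (b : bool) (z : E1) : E1 := if b then cat (1 - ht z) (tl z) else z.

Lemma kappa_iso b : affine_isometry (kappa b).
Proof.
case: b; last exact: affine_isometry_id.
have s1 : (-1 : R) ^+ 2 = 1 by rewrite sqrrN expr1n.
have := affine_isometry_slab 1 s1 (@affine_isometry_id R m).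
by congr affine_isometry; apply: funext => z; rewrite mulN1r addrC.
Qed.

Lemma kappaK b : involutive (kappa b).
Proof.
by case: b => // z; rewrite /kappa cat0E tl_cat opprB addrC subrK cat_tl.
Qed.

(** Type [true] stays clear of the lower face, which the twisted action identifies with the upper
    one. *)
Definition chart_range (b : bool) : set E1 :=
  [set z | if b then 0 < ht z else -1 < ht z < 1].

(* Charts of type [true] use the distance to the boundary as first coordinate. *)
Definition bundle_chart b W (c : rchart R M m.+1) := [/\ open W, W `<=` chart_range b,
  rdom c = rho @` (strip `&` W),
  forall z, strip z -> W z -> rcoord c (rho z) = kappa b z &
  forall q, rmetric c q = 1%:M].

Definition bundle_atlas : set (rchart R M m.+1) :=
  [set c | exists b W, bundle_chart b W c].

Lemma open_chart_range b : open (chart_range b).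
Proof.
rewrite openE; case: b => z /=; first exact: near_coord_gt.
move=> /andP[/near_coord_gt z0 /near_coord_lt z1].
by move: z0 z1; apply: filterS2 => w w0 w1; rewrite /chart_range /= w0.
Qed.

Lemma bundle_chart_at b z : strip z -> chart_range b z ->
  exists c W, bundle_chart b W c /\ W z.
Proof.
move=> sz bz; have [r r0 hr] := rho_inj_ball z.
pose W := [set y | en (y - z) < r] `&` chart_range b.
have /choice[h hE] : forall q, exists y, (rho @` (strip `&` W)) q ->
    [/\ strip y, W y & rho y = q].
  move=> q; have [[y [sy Wy] yq]|nq] := pselect ((rho @` (strip `&` W)) q).
    by exists y.
  by exists z.
exists (RChart (rho @` (strip `&` W)) (fun q => kappa b (h q)) (fun=> 1%:M)), W.
split; last by split=> //=; rewrite subrr en0.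
split=> //.
- apply: openI; last exact: open_chart_range.
  by rewrite openE => y /near_ball.
- by move=> y [].
- move=> y sy Wy; rewrite /=; congr kappa.
  have [|sh Wh hy] := hE (rho y); first by exists y.
  by apply: hr => //; [case: Wh|case: Wy].
Qed.

Lemma bundle_atlas_dom b W c p : bundle_chart b W c -> rdom c p ->
  exists z, [/\ strip z, W z, rho z = p & rcoord c p = kappa b z].
Proof. by move=> [_ _ -> cE _] [z [sz Wz] <-]; exists z; rewrite cE. Qed.

Lemma bundle_cover p : exists2 c, bundle_atlas c & rdom c p.
Proof.
have [z sz zp] := rho_surj p.
suff [b [w [sw bw wp]]] : exists b w, [/\ strip w, chart_range b w & rho w = p].
  have [c [W [cW Ww]]] := bundle_chart_at sw bw; exists c; first by exists b, W.
  by case: cW => _ _ -> _ _; exists w.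
have := sz; rewrite /strip /= ler_norml => /andP[z1 z1'].
have [z0|z0] := ltP 0 (ht z); first by exists true, z.
have [z2|z2] := ltP (-1) (ht z).
  by exists false, z; split=> //; rewrite /chart_range /= z2 /=; lra.
(* The remaining points lie on the lower face; an element with character -1 moves them to the upper
   face. *)
have [f Gf fN] := epsN; have [sf fz] := rho_twist Gf sz.
exists true, (twist f z); split=> //=; last by rewrite fz.
by rewrite /chart_range /= cat0E fN; lra.
Qed.

Lemma bundle_chart_open b W c : bundle_chart b W c -> open (rdom c).
Proof.
move=> [oW _ -> _ _]; rewrite openE => _ [z [sz Wz] <-].
have nW : nbhs z W by exact: open_nbhs_nbhs.
exact: (rho_nbhs sz nW).
Qed.

Lemma bundle_chart_image b W c O : bundle_chart b W c -> open O -> O `<=` rdom c ->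
  exists2 V : set E1, open V &
    rcoord c @` O = V `&` [set x | strip (kappa b x)] /\ V `<=` kappa b @^-1` W.
Proof.
move=> cW oO Oc; have [oW Wb _ cE _] := cW.
exists (kappa b @^-1` (W `&` rho @^-1` O)).
  apply: open_comp => [z _|]; first exact: affine_isometry_cont (kappa_iso b) z.
  by apply: openI => //; apply: open_comp => // z _; exact: rho_cont.
split; last by move=> x [].
apply/seteqP; split=> [_ [q Oq <-]|x [[Wx Ox] sx]].
  have [z [sz Wz zq ->]] := bundle_atlas_dom cW (Oc q Oq).
  by rewrite /= kappaK zq.
by exists (rho (kappa b x)) => //; rewrite cE // kappaK.
Qed.

Lemma true_half_chart W c : bundle_chart true W c -> half_chart c.
Proof.
move=> cW O oO Oc; have [_ Wb _ _ _] := cW.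
have [V oV [VE VW]] := bundle_chart_image cW oO Oc; exists V => //.
rewrite VE; apply/seteqP; split=> x [Vx].
  rewrite /strip /= cat0E ler_norml => /andP[x1 x2]; split=> //.
  by rewrite /half_space /= -/(ht x); lra.
rewrite /half_space /= -/(ht x) => x0; split=> //.
have := Wb _ (VW x Vx); rewrite /strip /chart_range /= cat0E ler_norml => x1; lra.
Qed.

Lemma false_interior_chart W c : bundle_chart false W c -> interior_chart c.
Proof.
move=> cW O oO Oc; have [_ Wb _ _ _] := cW.
have [V oV [VE VW]] := bundle_chart_image cW oO Oc.
have -> : rcoord c @` O = V; last by [].
rewrite VE; apply/seteqP; split=> [x []//|x Vx]; split=> //.
have /andP[x1 x2] := Wb _ (VW x Vx).
by rewrite /strip /= ler_norml; lra.
Qed.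

Lemma bundle_is_chart c : bundle_atlas c -> is_chart c.
Proof.
move=> [b [W cW]]; split.
- exact: bundle_chart_open cW.
- move=> p q /set_mem/(bundle_atlas_dom cW)[z [sz Wz <- ->]].
  move=> /set_mem/(bundle_atlas_dom cW)[w [sw Ww <- ->]].
  by move=> /(can_inj (kappaK b)) ->.
- move=> p /(bundle_atlas_dom cW)[z [sz Wz <- e]] N; rewrite e => nN.
  have [oW _ _ cE _] := cW; have nW : nbhs z W by exact: open_nbhs_nbhs.
  have nk := affine_isometry_near (kappa_iso b) nN.
  apply: (filterS _ (rho_nbhs sz (filterI nW nk))) => _ [w [sw [Ww Nw]] <-].
  by rewrite /= cE.
- case: b cW => cW; [right; exact: true_half_chart cW|left; exact: false_interior_chart cW].
Qed.

Lemma bundle_metric c p : bundle_atlas c -> rmetric c p = 1%:M.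
Proof. by move=> [b [W [_ _ _ _]]]. Qed.

Lemma constant_metric c p : bundle_atlas c ->
  metric_extension c p setT (fun=> 1%:M).
Proof.
move=> Ac; split=> //; first exact: openT.
  move=> i j; apply: smooth_affine; exists 0, (1%:M i j).
  by apply: funext => x; rewrite dotp0r add0r.
by move=> q _ _; rewrite bundle_metric.
Qed.

Lemma bundle_is_metric c : bundle_atlas c -> is_metric c.
Proof.
move=> Ac p cp; split.
- by exists setT, (fun=> 1%:M); exact: constant_metric.
- by rewrite bundle_metric // trmx1.
- by move=> v v0; rewrite bundle_metric // mulmx1 -dotpE dotp_gt0.
Qed.

(** The element [f] that relates the two representatives of [p] also relates those of all nearby
    points, so coordinate changes are restrictions of affine isometries. *)
Lemma bundle_transition c c' p : bundle_atlas c -> bundle_atlas c' -> rdom c p -> rdom c' p ->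
  exists V F, [/\ affine_isometry F, open V, V (rcoord c p) &
    forall q, rdom c q -> V (rcoord c q) -> rdom c' q /\ rcoord c' q = F (rcoord c q)].
Proof.
move=> [b [W cW]] [b' [W' cW']] cp cp'.
have [z [sz Wz zp zE]] := bundle_atlas_dom cW cp.
have [w [sw Ww wp wE]] := bundle_atlas_dom cW' cp'.
have [f Gf wz] : exists2 f, Gam f & w = twist f z by apply/rhoP => //; rewrite zp.
have [oW' _ dE' cE' _] := cW'; have ik := kappa_iso b; have it := twist_iso Gf.
exists ((twist f \o kappa b) @^-1` W'), (kappa b' \o (twist f \o kappa b)); split.
- by apply: affine_isometry_comp; [exact: kappa_iso|exact: affine_isometry_comp].
- apply: open_comp => // x _; apply: affine_isometry_cont; exact: affine_isometry_comp.
- by rewrite /= zE kappaK -wz.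
- move=> q /(bundle_atlas_dom cW)[y [sy Wy <- ->]]; rewrite /= kappaK => W'y.
  have [sf fy] := rho_twist Gf sy.
  by rewrite -fy cE' //; split=> //; rewrite dE'; exists (twist f y).
Qed.

Lemma bundle_riemannian : riemannian_manifold bundle_atlas.
Proof.
split.
- exact: bundle_hausdorff.
- exact: bundle_second_countable.
- exact: bundle_cover.
- by move=> c Ac; split; [exact: bundle_is_chart|exact: bundle_is_metric].
- move=> c c' p Ac Ac' _ cp cp'; have [V [F [iF oV Vp h]]] := bundle_transition Ac Ac' cp cp'.
  apply: (affine_isometric_at iF oV Vp); rewrite ?bundle_metric //.
  by move=> q cq Vq _; have [] := h q cq Vq.
Qed.

Lemma bundle_flat : flat bundle_atlas.
Proof.
move=> p; have [c Ac cp] := bundle_cover p.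
have [oc ic _ _] := bundle_is_chart Ac.
exists (rdom c), (rcoord c); split=> // c' _ q Ac' -> cq c'q _.
have [V [F [iF oV Vq h]]] := bundle_transition Ac' Ac c'q cq.
apply: (affine_isometric_at iF oV Vq); rewrite ?bundle_metric //.
by move=> q' cq' Vq' _; have [] := h q' cq' Vq'.
Qed.

Lemma bundle_totally_geodesic : totally_geodesic_boundary bundle_atlas.
Proof.
move=> c p Ac _ _ _; exists setT, (fun=> 1%:M); split; first exact: constant_metric.
move=> i j _ _; rewrite /christoffel big1 ?mulr0 // => l _.
by rewrite !derive_cst addr0 subr0 mulr0.
Qed.

(** Boundary points are defined by any half-chart of the atlas, so one of type [false] has to be
    excluded: below a point of height 0 its range continues to negative heights. *)
Lemma half_chart_true b W c z : bundle_chart b W c -> half_chart c -> strip z -> W z ->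
  rcoord c (rho z) 0 ord0 = 0 -> b /\ ht z = 1.
Proof.
move=> cW hc sz Wz; have [oW Wb dE cE _] := cW; rewrite cE // -/(ht _).
case: b cW Wb cE => cW Wb cE /=; first by rewrite cat0E => /eqP; rewrite subr_eq0 => /eqP.
move=> z0; exfalso.
have [V oV VE] := hc (rdom c) (bundle_chart_open cW) (@subset_refl _ _).
have nW : nbhs (z + 0 *: 'e_ord0) W by rewrite scale0r addr0; exact: open_nbhs_nbhs.
have [d d0 hd] := near_line nW.
have /hd Wd : `|- (d / 2) - 0| < d by rewrite subr0 normrN gtr0_norm; lra.
have /andP[h1 h2] := Wb _ Wd; set y := z + _ in Wd h1 h2.
have sy : strip y by rewrite /strip /= ler_norml !ltW.
have : (V `&` @half_space R m) y.
  by rewrite -VE dE; exists (rho y); [exists y|rewrite cE].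
move=> [_]; rewrite /half_space /= -/(ht y) ht_line z0 ht_e0; lra.
Qed.

Lemma bundle_boundaryP p : boundary bundle_atlas p <-> exists x, p = rho (cat 1 x).
Proof.
have s1 x : strip (cat 1 x) by rewrite /strip /= cat0E normr1.
split=> [[c [[b [W cW]] hc cp p0]]|[x ->]].
  have [z [sz Wz zp _]] := bundle_atlas_dom cW cp; rewrite -zp in p0 *.
  have [_ z1] := half_chart_true cW hc sz Wz p0.
  by exists (tl z); rewrite -z1 cat_tl.
have bx : chart_range true (cat 1 x) by rewrite /chart_range /= cat0E.
have [c [W [cW Wx]]] := bundle_chart_at (s1 x) bx.
have [_ _ dE cE _] := cW.
exists c; split; first by exists true, W.
- exact: true_half_chart cW.
- by rewrite dE; exists (cat 1 x).
- by rewrite cE // -/(ht _) /= cat0E cat0E subrr.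
Qed.

Local Notation pi0 := (orbit_proj Gam0).

Lemma strip_cat1 x : strip (cat 1 x).
Proof. by rewrite /strip /= cat0E normr1. Qed.

Lemma rho1_boundary x : boundary bundle_atlas (rho (cat 1 x)).
Proof. by apply/bundle_boundaryP; exists x. Qed.

Definition bpoint x : boundary bundle_atlas := SigSub (mem_set (rho1_boundary x)).

Lemma bpoint_surj q : exists x, bpoint x = q.
Proof.
have /bundle_boundaryP[x xq] : boundary bundle_atlas (set_val q) by exact: set_valP.
by exists x; apply: val_inj; rewrite -[LHS]/(rho (cat 1 x)) -xq.
Qed.

(** An element that preserves level 1 has character 1, so the identifications on the upper face are
    those of [Gam0]. *)
Lemma bpointP x y : bpoint x = bpoint y <-> pi0 x = pi0 y.
Proof.
split=> [/(congr1 set_val)|].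
  rewrite -[LHS]/(rho (cat 1 x)) -[RHS]/(rho (cat 1 y)).
  move=> /(rhoP (strip_cat1 _) (strip_cat1 _))[f Gf]; rewrite /twist cat0E mulr1 tl_cat => e.
  have ef : eps f = 1 by have := congr1 ht e; rewrite !cat0E.
  have -> : y = f x by have := congr1 tl e; rewrite !tl_cat.
  by rewrite pi_Gam //; exact/epsK.
move=> /(piP F0)[f Gf ->]; apply: val_inj.
rewrite -[LHS]/(rho (cat 1 x)) -[RHS]/(rho (cat 1 (f x))).
apply/(rhoP (strip_cat1 _) (strip_cat1 _)); exists f; first exact: sub.
by rewrite /twist cat0E mulr1 tl_cat; congr cat; apply/esym/epsK => //; exact: sub.
Qed.

Lemma bpoint_Gam f x : Gam0 f -> bpoint (f x) = bpoint x.
Proof. by move=> Gf; apply/bpointP; exact: (pi_Gam F0). Qed.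

Lemma bpoint_cont x N : nbhs (bpoint x) N -> \forall y \near x, N (bpoint y).
Proof.
move=> [B [[V oV <-] Vx] hB]; have nV : nbhs (rho (cat 1 x)) V by exact: open_nbhs_nbhs.
move: (near_cat (rho_cont nV)); apply: filterS => y Vy; exact: hB.
Qed.

Lemma bpoint_nbhs x N : nbhs x N -> \forall q \near bpoint x, exists2 y, N y & bpoint y = q.
Proof.
move=> nN; pose O := [set z : E1 | N (tl z) /\ 0 < ht z].
have nO : nbhs (cat 1 x) O.
  apply: filterI; first by apply: near_tl; rewrite tl_cat.
  by apply: near_coord_gt; rewrite cat0E.
have : nbhs (bpoint x) (set_val @^-1` (rho @` (strip `&` O))).
  by apply: initial_continuous; exact: (rho_nbhs (strip_cat1 x) nO).
apply: filterS => q [z [sz [Nz z0]]]; have [y <-] := bpoint_surj q.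
move=> /(rhoP sz (strip_cat1 y))[f Gf e]; exists (tl z) => //.
have e1 : 1 = eps f * ht z by have := congr1 ht e; rewrite !cat0E.
have e2 : y = f (tl z) by have := congr1 tl e; rewrite !tl_cat.
have fz : eps f = ht z by rewrite -[LHS]mulr1 e1 mulrA -expr2 eps2 // mul1r.
by rewrite e2 bpoint_Gam //; apply/epsK => //; have := eps2 Gf; nra.
Qed.

(** The representative in [W] has height 1 or -1. Charts of type [false] contain neither height and
    those of type [true] only height 1. *)
Lemma boundary_chart_dom b W c x : bundle_chart b W c -> rdom c (rho (cat 1 x)) ->
  b /\ exists2 f, Gam0 f & W (cat 1 (f x)).
Proof.
move=> cW /(bundle_atlas_dom cW)[z [sz Wz /esym/(rhoP (strip_cat1 x) sz)[f Gf zE] _]].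
have e2 := eps2 Gf; have [_ Wb _ _ _] := cW; have := Wb _ Wz.
rewrite zE /twist cat0E tl_cat mulr1 in Wz *; rewrite /chart_range /=.
case: b {cW Wb zE} => /=; rewrite cat0E; last by move=> /andP[h1 h2]; exfalso; nra.
move=> f0; have f1 : eps f = 1 by nra.
by split=> //; exists f; [exact/epsK|rewrite -f1].
Qed.

Lemma boundary_chart_coord W c y : bundle_chart true W c -> W (cat 1 y) ->
  rcoord (restrict_chart bundle_atlas c) (bpoint y) = y.
Proof.
move=> [_ _ _ cE _] Wy; rewrite -[LHS]/(tl (rcoord c (rho (cat 1 y)))).
by rewrite cE ?tl_cat //; exact: strip_cat1.
Qed.

Lemma boundary_chart_metric c q : bundle_atlas c ->
  rmetric (restrict_chart bundle_atlas c) q = 1%:M.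
Proof.
by move=> Ac; apply/matrixP => i j; rewrite mxE bundle_metric // !mxE (inj_eq lift_inj).
Qed.

Lemma bundle_boundary_isometric : isometric (boundary_atlas bundle_atlas) (orbit_atlas Gam0).
Proof.
have /choice[h hE] := bpoint_surj.
have /choice[h0 h0E] := pi_surj (Gam := Gam0).
pose phi q := pi0 (h q); pose psi q := bpoint (h0 q).
have phiE x : phi (bpoint x) = pi0 x by apply/bpointP; rewrite hE.
have psiE x : psi (pi0 x) = bpoint x by apply/bpointP; rewrite h0E.
have iW0 (W : set E1) f : affine_isometry f -> open W -> open [set y | W (cat 1 (f y))].
  move=> fi oW; rewrite openE => y Wy; have nW : nbhs (cat 1 (f y)) W by exact: open_nbhs_nbhs.
  exact: (affine_isometry_near fi (near_cat nW)).
exists phi, psi; split; split.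
- by move=> q; rewrite -(hE q) phiE psiE.
- by move=> q; rewrite -(h0E q) psiE phiE.
- move=> q N; have [x <-] := bpoint_surj q => nN; rewrite /= phiE in nN.
  apply: (filterS _ (bpoint_nbhs (pi_cont nN))) => _ [y Ny <-].
  by rewrite /= phiE.
- move=> q N; have [x <-] := pi_surj q => nN; rewrite /= psiE in nN.
  apply: (filterS _ (pi_nbhs F0 (bpoint_cont nN))) => _ [y Ny <-].
  by rewrite /= psiE.
- move=> _ c' p [c [Ac _] <-] [W0 [oW0 _ dE0 cE0 g0]] _ cp c'p.
  have [b [W cW]] := Ac; have [oW _ _ _ _] := cW.
  have [x Wx xp] : (pi0 @` W0) (phi p) by rewrite -dE0.
  have pE : p = bpoint x by rewrite -(hE p); apply/bpointP; rewrite -[LHS]/(phi p).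
  rewrite pE in cp *; have [bt [f Gf Wf]] := boundary_chart_dom cW cp.
  rewrite bt in cW; have [g [Gg fK gK]] := free_inv F0 Gf.
  have ig := free_iso F0 Gg.
  (* The boundary chart reads [p] as [f x] and the orbit chart as [x], so the coordinate change is
     the inverse [g] of [f]. *)
  apply: (affine_isometric_at (V := g @^-1` W0) ig).
  + by apply: open_comp => // y _; exact: affine_isometry_cont.
  + by rewrite -(bpoint_Gam x Gf) (boundary_chart_coord cW) //= fK.
  + move=> q cq; have [y0 yq] := bpoint_surj q; rewrite -yq in cq *.
    have [_ [f0 Gf0 Wf0]] := boundary_chart_dom cW cq.
    rewrite -(bpoint_Gam y0 Gf0) (boundary_chart_coord cW) // => W0g _.
    by rewrite phiE -(pi_Gam F0 _ Gg) cE0.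
  + exact: boundary_chart_metric.
  + by apply: g0; rewrite -pE.
- move=> c' _ p [W0 [oW0 _ dE0 cE0 g0]] [c [Ac _] <-] _ c'p cp.
  have [b [W cW]] := Ac; have [oW _ _ _ _] := cW.
  have [x Wx xp] : (pi0 @` W0) p by rewrite -dE0.
  rewrite -xp psiE in cp *; have [bt [f Gf Wf]] := boundary_chart_dom cW cp.
  rewrite bt in cW; have fi := free_iso F0 Gf.
  apply: (affine_isometric_at (V := [set y | W (cat 1 (f y))]) fi).
  + exact: iW0.
  + by rewrite cE0.
  + rewrite dE0 => _ [y W0y <-]; rewrite cE0 // psiE => Wfy _.
    by rewrite -(bpoint_Gam y Gf) (boundary_chart_coord cW).
  + by apply: g0; rewrite xp.
  + exact: boundary_chart_metric.
Qed.

Theorem twisted_bundle_realizes : realized_as_totally_geodesic_boundary Gam0.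
Proof.
exists M, bundle_atlas; split.
- exact: bundle_riemannian.
- exact: bundle_connected.
- exact: bundle_compact.
- split; [exact: bundle_flat|exact: bundle_totally_geodesic|].
  exact: bundle_boundary_isometric.
Qed.

End twisted_interval_bundle.

Theorem extension_realized (R : realType) (m : nat)
    (Gam0 Gam : set ('rV[R]_m -> 'rV[R]_m)) :
  bieberbach_group Gam0 -> bieberbach_group Gam -> exact_over_Z2 Gam0 Gam ->
  realized_as_totally_geodesic_boundary Gam0.
Proof.
move=> B0 B1 [sub [chi [chiM chi_surj chiK]]].
(* The additive character with values in Z/2, rewritten multiplicatively with values 1 and -1 so
   that it can act on heights. *)
pose eps f : R := if chi f == 0 then 1 else -1.
apply: (@twisted_bundle_realizes R m Gam0 Gam eps); rewrite /eps => //.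
- exact: bieberbach_free.
- exact: bieberbach_free.
- by move=> f _; case: ifP => _; rewrite ?sqrrN expr1n.
- move=> f g Gf Gg; rewrite (chiM f g) //.
  have Z2 (z : 'Z_2) : z = 0 \/ z = 1.
    by case: z => [[|[|//]] ?]; [left|right]; exact/val_inj.
  have Z11 : (1 + 1 : 'Z_2) = 0 by exact/val_inj.
  by case: (Z2 (chi f)) => ->; case: (Z2 (chi g)) => ->;
    rewrite ?Z11 ?addr0 ?add0r ?eqxx ?oner_eq0 ?mulr1 ?mul1r ?mulrNN ?mulr1.
- move=> f Gf; have n1 : (-1 : R) != 1 by rewrite lt_eqF //; lra.
  by rewrite -(chiK f Gf); case: eqP => // nf; split=> // /eqP; rewrite (negPf n1).
- by have [f Gf f1] := chi_surj 1; exists f => //; rewrite f1 oner_eq0.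
- by case: B1.
Qed.

Theorem theorem2p3 (R : realType) (n : nat) (hn : (2 <= n)%N)
    (Gamma0 : set ('rV[R]_n.-1 -> 'rV[R]_n.-1))
    (hGamma0 : bieberbach_group Gamma0) :
  (realized_as_totally_geodesic_boundary Gamma0 <->
   has_free_isometric_involution Gamma0) /\
  (has_free_isometric_involution Gamma0 <->
   exists Gamma : set ('rV[R]_n.-1 -> 'rV[R]_n.-1),
     bieberbach_group Gamma /\ exact_over_Z2 Gamma0 Gamma).
Proof.
have F0 := bieberbach_free hGamma0.
split; split.
- by move=> /(boundary_has_flip hGamma0)/(flip_involution F0).
- move=> /(involution_flip F0)/(flip_extension hGamma0)[Gamma [hGamma ex]].
  exact: extension_realized hGamma0 hGamma ex.
- by move=> /(involution_flip F0)/(flip_extension hGamma0).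
- by move=> [Gamma [hGamma ex]]; exact: flip_involution F0 (extension_flip hGamma0 hGamma ex).
Qed.
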